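(* Let $(M,\Delta_M)$ be a compact Kac algebra, $\mathcal H$ a Hilbert space, and $\alpha:B(\mathcal H)\to M\bar\otimes B(\mathcal H)$ a (left) coaction of $(M,\Delta_M)$. Then: 1. The trace on $B(\mathcal H)$ is $\alpha$-invariant. 2. If $\alpha$ is ergodic, then $\mathcal H$ is finite-dimensional.
   Context: Hilbert spaces are separable, von Neumann algebras have separable predual; $\bar\otimes$ is the spatial von Neumann tensor product. A von Neumann bialgebra $(M,\Delta_M)$ is a von Neumann algebra with a faithful normal unital $^*$-homomorphism $\Delta_M:M\to M\bar\otimes M$ such that $(\Delta_M\otimes\iota)\Delta_M=(\iota\otimes\Delta_M)\Delta_M$. It is a compact Kac algebra if there is a normal tracial state $\tau_M$ on $M$ with $(\tau_M\otimes\iota)\Delta_M(x)=(\iota\otimes\tau_M)\Delta_M(x)=\tau_M(x)1$ for all $x\in M$. A left coaction of $(M,\Delta_M)$ on a von Neumann algebra $B$ is a faithful normal unital $^*$-homomorphism $\alpha:B\to M\bar\otimes B$ with $(\Delta_M\otimes\iota)\alpha=(\iota\otimes\alpha)\alpha$. It is ergodic if the only $x\in B$ with $\alpha(x)=1\otimes x$ are scalar multiples of the unit. $\alpha$-invariance of the trace $\mathrm{Tr}$ on $B(\mathcal H)$ means $\mathrm{Tr}((\omega\otimes\iota)\alpha(x))=\mathrm{Tr}(x)$ for all normal states $\omega$ on $M$ and all $x\in B(\mathcal H)^+$. *)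

(* Defs.v *)
From HB Require Import structures.
From mathcomp Require Import all_boot all_order all_algebra complex.
From mathcomp Require Import all_classical all_reals all_analysis.

Set Implicit Arguments.
Unset Strict Implicit.
Unset Printing Implicit Defensive.

Import Order.TTheory GRing.Theory Num.Theory numFieldNormedType.Exports.

Local Open Scope classical_set_scope.
Local Open Scope complex_scope.
Local Open Scope ring_scope.

(* Complex and separable; [inner] is linear in its first argument. *)
HB.mixin Record isHilbert (R : realType) H of CompleteNormedModule R[i] H := {
  inner : {dot H for @Num.conj R[i]} ;
  sqr_normE : forall v : H, `|v| ^+ 2 = inner v v ;
  hilbert_separable : exists2 D : set H, countable D & dense D
}.

#[short(type="hilbertType")]
HB.structure Definition Hilbert (R : realType) :=
  { H of isHilbert R H & CompleteNormedModule R[i] H }.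

Notation "''<' u , v >" := (inner u v)
  (at level 0, u at level 49, v at level 49, format "''<' u ,  v >") : ring_scope.

Notation op H := {linear H -> H}.

Definition idop (R : realType) (H : hilbertType R) : op H := idfun.

Definition finite_dimensional (R : realType) (H : hilbertType R) : Prop :=
  exists (n : nat) (e : 'I_n -> H),
    forall v : H, exists c : 'I_n -> R[i], v = \sum_(i < n) c i *: e i.

Definition orthonormal_basis (R : realType) (H : hilbertType R) (E : set H)
    : Prop :=
  [/\ forall e, E e -> '<e, e> = 1,
      forall e f, E e -> E f -> e <> f -> '<e, f> = 0 &
      forall v, (forall e, E e -> '<v, e> = 0) -> v = 0].

(* A choice of Hilbert tensor product for every pair of Hilbert spaces: the
   axioms determine it up to a unique unitary preserving elementary tensors. *)
Record hilbert_tensor (R : realType) := HilbertTensor {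
  tspace :> hilbertType R -> hilbertType R -> hilbertType R ;
  tens : forall K H : hilbertType R, K -> H -> tspace K H ;
  tens_linearl : forall (K H : hilbertType R) (h : H),
    linear (fun k : K => tens k h) ;
  tens_linearr : forall (K H : hilbertType R) (k : K), linear (@tens K H k) ;
  tens_inner : forall (K H : hilbertType R) (k k' : K) (h h' : H),
    '<tens k h, tens k' h'> = '<k, k'> * '<h, h'> ;
  tens_dense : forall K H : hilbertType R,
    dense [set z : tspace K H | exists n (k : 'I_n -> K) (h : 'I_n -> H),
             z = \sum_(i < n) tens (k i) (h i)]
}.

Definition bounded_op (R : realType) (H : hilbertType R) : set (op H) :=
  [set x | continuous x].

Definition adjoint (R : realType) (H : hilbertType R) (x y : op H) : Prop :=
  forall u v : H, '<x u, v> = '<u, y v>.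

(* [0 <= z] in [R[i]] forces [z] to be real. *)
Definition positive_op (R : realType) (H : hilbertType R) (x : op H) : Prop :=
  forall v : H, 0 <= '<x v, v>.

Definition commutant (R : realType) (H : hilbertType R) (S : set (op H))
    : set (op H) :=
  [set y | continuous y /\ forall x, S x -> y \o x =1 x \o y].

Definition von_neumann_algebra (R : realType) (H : hilbertType R)
    (M : set (op H)) : Prop :=
  [/\ M `<=` @bounded_op R H,
      forall x, M x -> exists2 y, M y & adjoint x y &
      commutant (commutant M) = M].

(* The members of the predual of [M], i.e. the ultraweakly continuous linear
   functionals on [M]; the values of [w] outside [M] are irrelevant. *)
Definition predual (R : realType) (H : hilbertType R) (M : set (op H))
    (w : op H -> R[i]) : Prop :=
  exists u v : nat -> H,
    [/\ cvgn (series (fun n => complex.Re '<u n, u n>)),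
        cvgn (series (fun n => complex.Re '<v n, v n>)) &
        forall x, M x ->
          series (fun n => '<x (u n), v n> : R[i]^o) @ \oo --> (w x : R[i]^o)].

Definition normal_state (R : realType) (H : hilbertType R) (M : set (op H))
    (w : op H -> R[i]) : Prop :=
  [/\ predual M w,
      forall x, M x -> positive_op x -> 0 <= w x &
      w (idop H) = 1].

(* The ultraweak topology is the weak topology of the predual, so a linear map
   is ultraweakly continuous iff its transpose preserves preduals. *)
Definition normal_linear_map (R : realType) (H K : hilbertType R)
    (M : set (op H)) (N : set (op K)) (f : op H -> op K) : Prop :=
  [/\ forall x, M x -> N (f x),
      forall (a : R[i]) x y, M x -> M y -> f (a \*: x \+ y) =1 a \*: f x \+ f y &
      forall w, predual N w -> predual M (w \o f)].

Definition normal_star_hom (R : realType) (H K : hilbertType R)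
    (M : set (op H)) (N : set (op K)) (f : op H -> op K) : Prop :=
  [/\ normal_linear_map M N f,
      forall x y, M x -> M y -> f (x \o y) =1 f x \o f y,
      forall x y, M x -> M y -> adjoint x y -> adjoint (f x) (f y) &
      f (idop H) =1 idop K].

Definition faithful (R : realType) (H K : hilbertType R) (M : set (op H))
    (f : op H -> op K) : Prop :=
  forall x y, M x -> M y -> f x =1 f y -> x =1 y.

Definition op_tens (R : realType) (T : hilbert_tensor R) (K H : hilbertType R)
    (x : op K) (y : op H) (z : op (T K H)) : Prop :=
  forall k h, z (tens T k h) = tens T (x k) (y h).

Definition vN_tensor (R : realType) (T : hilbert_tensor R) (K H : hilbertType R)
    (M : set (op K)) (N : set (op H)) : set (op (T K H)) :=
  commutant (commutant
    [set z : op (T K H) | continuous z /\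
             exists x y, [/\ M x, N y & op_tens x y z]]).

Arguments vN_tensor {R} T {K H}.

(* [F] is the normal *-homomorphism [f (x) g] from the tensor product of [M] and
   [N] to that of [P] and [Q]; it exists and is unique for normal f and g. *)
Definition hom_tens (R : realType) (T : hilbert_tensor R)
    (K H K' H' : hilbertType R)
    (M : set (op K)) (N : set (op H)) (P : set (op K')) (Q : set (op H'))
    (f : op K -> op K') (g : op H -> op H') (F : op (T K H) -> op (T K' H'))
    : Prop :=
  normal_star_hom (vN_tensor T M N) (vN_tensor T P Q) F /\
  forall x y (z : op (T K H)), M x -> N y -> continuous z -> op_tens x y z ->
    op_tens (f x) (g y) (F z).

(* [S] is the slice map [w (x) id] (resp. [id (x) w]); it exists and is unique
   for [w] in the predual. *)
Definition left_slice (R : realType) (T : hilbert_tensor R)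
    (K H : hilbertType R) (M : set (op K)) (N : set (op H))
    (w : op K -> R[i]) (S : op (T K H) -> op H) : Prop :=
  normal_linear_map (vN_tensor T M N) N S /\
  forall x y (z : op (T K H)), M x -> N y -> continuous z -> op_tens x y z -> S z =1 w x \*: y.

Definition right_slice (R : realType) (T : hilbert_tensor R)
    (K H : hilbertType R) (M : set (op K)) (N : set (op H))
    (w : op H -> R[i]) (S : op (T K H) -> op K) : Prop :=
  normal_linear_map (vN_tensor T M N) M S /\
  forall x y (z : op (T K H)), M x -> N y -> continuous z -> op_tens x y z -> S z =1 w y \*: x.

(* Equality of operators on [T (T K L) H] and [T K (T L H)] up to the canonical
   unitary between these spaces. *)
Definition assoc_eq (R : realType) (T : hilbert_tensor R)
    (K L H : hilbertType R) (x : op (T (T K L) H)) (y : op (T K (T L H)))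
    : Prop :=
  forall k k' l l' h h',
    '<x (tens T (tens T k l) h), tens T (tens T k' l') h'> =
    '<y (tens T k (tens T l h)), tens T k' (tens T l' h')>.

(* The identity [(D (x) id) a = (id (x) a) a]. *)
Definition coaction_identity (R : realType) (T : hilbert_tensor R)
    (K H : hilbertType R) (M : set (op K)) (N : set (op H))
    (D : op K -> op (T K K)) (a : op H -> op (T K H)) : Prop :=
  exists (F : op (T K H) -> op (T (T K K) H))
         (G : op (T K H) -> op (T K (T K H))),
    [/\ hom_tens M N (vN_tensor T M M) N D id F,
        hom_tens M N M (vN_tensor T M N) id a G &
        forall x, N x -> assoc_eq (F (a x)) (G (a x))].

Definition von_neumann_bialgebra (R : realType) (T : hilbert_tensor R)
    (K : hilbertType R) (M : set (op K)) (D : op K -> op (T K K)) : Prop :=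
  [/\ von_neumann_algebra M,
      normal_star_hom M (vN_tensor T M M) D,
      faithful M D &
      coaction_identity M M D D].

Definition tracial (R : realType) (K : hilbertType R) (M : set (op K))
    (w : op K -> R[i]) : Prop :=
  forall x y, M x -> M y -> w (x \o y) = w (y \o x).

Definition compact_kac_algebra (R : realType) (T : hilbert_tensor R)
    (K : hilbertType R) (M : set (op K)) (D : op K -> op (T K K)) : Prop :=
  von_neumann_bialgebra M D /\
  exists (tau : op K -> R[i]) (Sl Sr : op (T K K) -> op K),
    [/\ normal_state M tau, tracial M tau,
        left_slice M M tau Sl, right_slice M M tau Sr &
        forall x, M x -> Sl (D x) =1 tau x \*: idop K /\
                         Sr (D x) =1 tau x \*: idop K].

Definition left_coaction (R : realType) (T : hilbert_tensor R)
    (K H : hilbertType R) (M : set (op K)) (D : op K -> op (T K K))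
    (N : set (op H)) (a : op H -> op (T K H)) : Prop :=
  [/\ von_neumann_algebra N,
      normal_star_hom N (vN_tensor T M N) a,
      faithful N a &
      coaction_identity M N D a].

Definition ergodic (R : realType) (T : hilbert_tensor R)
    (K H : hilbertType R) (N : set (op H)) (a : op H -> op (T K H)) : Prop :=
  forall x, N x -> op_tens (idop K) x (a x) ->
    exists c : R[i], x =1 c \*: idop H.

Definition op_trace (R : realType) (H : hilbertType R) (E : set H) (x : op H)
    : \bar R :=
  \esum_(e in E) (complex.Re '<x e, e>)%:E.

(* Invariance of the trace of B(H), computed in an arbitrary orthonormal
   basis. *)
Definition trace_invariant (R : realType) (T : hilbert_tensor R)
    (K H : hilbertType R) (M : set (op K)) (a : op H -> op (T K H)) : Prop :=
  forall (w : op K -> R[i]) (S : op (T K H) -> op H) (E : set H) (x : op H),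
    normal_state M w -> left_slice M (@bounded_op R H) w S ->
    orthonormal_basis E -> bounded_op x -> positive_op x ->
    op_trace E (S (a x)) = op_trace E x.

(* Main.v *)
(* Write E = (tau (x) id) alpha and E_y = (tau(. y) (x) id) alpha; by invariance of
   tau, E((w (x) id) alpha(x)) = w(1) E(x).  Traciality of tau makes
   (tau (x) omega_i)(A (1 (x) e_jj) A^* ) symmetric under A <-> A^*, i <-> j, so
   that Tr E(x) = c Tr x for a constant c in ]0, +oo].  To see that c = 1 one needs
   a positive x with E(x) = x and 0 < Tr x < +oo.  Let psi be the E-invariant normal
   state <E(.) zeta, zeta> and h its density.  Traciality of tau, invariance and a
   trace-class argument in L^2(M, tau) give the modular identity
   h E_y(x h) = E_y(h x) h, which forces E(p) = p for the spectral projection p of h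
   at its norm; p has finite trace as h does.  With c = 1, invariance of the trace
   follows from Tr (w (x) id) alpha(x) = Tr E((w (x) id) alpha(x)) = Tr E(x), and in the
   ergodic case E(zeta zeta^* ) is a scalar of trace 1, so H is finite-dimensional. *)
From HB Require Import structures.
Require Import Defs.
From mathcomp Require Import all_boot all_order all_algebra.
From mathcomp Require Import all_classical all_reals all_analysis.
From mathcomp Require Import complex finmap ring lra.

Set Implicit Arguments.
Unset Strict Implicit.
Unset Printing Implicit Defensive.

Import Order.TTheory GRing.Theory Num.Theory numFieldNormedType.Exports.

Local Open Scope classical_set_scope.
Local Open Scope complex_scope.
Local Open Scope ring_scope.

(** The relation [Tr (E x) = c Tr x] does not determine [c] by itself: testing it on [x = 1] gives
    [c = 1] only when [H] is finite-dimensional. A fixed positive operator of finite trace is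
    therefore needed. The density of an invariant state suggests itself, but that it is fixed
    follows only once the trace is known to be invariant; its top eigenprojection can be reached
    before that. Besides [E] the slices [E_y] are needed because [alpha b alpha a] cannot be
    recovered from the averages of [a] and [b], whereas letting [y] run through [M] recovers enough.

    Three devices shape the rest. An identity in a von Neumann tensor product is tested by normal
    functionals on elementary tensors and extended by the double commutant theorem. Square roots and
    spectral theory are avoided: positive operators are split into rank-one operators by Cholesky
    elimination, and the top projection is the strong limit of the powers of the normalised density.
    The space [L^2 (M, t)] is neither completed nor divided by null vectors; finite Gram-Schmidt
    families replace its orthonormal bases. *)

Section Scalars.
Variable R : realType.
Local Notation C := R[i].
Implicit Types z w : C.

(** The norm of [R[i]] takes values in [R[i]], whose order is only partial; estimates are carried
    out in [R] through this version. *)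
Definition ab z : R := Normc.normc z.

Lemma normr_ab z : `|z| = (ab z)%:C.
Proof. by case: z => a b; rewrite normc_def. Qed.

Lemma ab_ge0 z : 0 <= ab z.
Proof. by case: z => a b; exact: sqrtr_ge0. Qed.

Lemma abM z w : ab (z * w) = ab z * ab w.
Proof. exact: Normc.normcM. Qed.

Lemma abN z : ab (- z) = ab z.
Proof. by case: z => a b; rewrite /ab /= !sqrrN. Qed.

Lemma ler_abD z w : ab (z + w) <= ab z + ab w.
Proof. exact: le_normcD. Qed.

Lemma ler_abB z w : ab (z - w) <= ab z + ab w.
Proof. by rewrite -[X in _ <= _ + X]abN ler_abD. Qed.

Lemma ab0 : ab 0 = 0.
Proof. exact: Normc.normc0. Qed.

Lemma ab_eq0 z : ab z = 0 -> z = 0.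
Proof. exact: Normc.eq0_normc. Qed.

Lemma abC z w : ab (z - w) = ab (w - z).
Proof. by rewrite -abN opprB. Qed.

Lemma ab_real (r : R) : ab r%:C = `|r|.
Proof. by rewrite /ab /= expr0n addr0 sqrtr_sqr. Qed.

Lemma abJ z : ab (conjc z) = ab z.
Proof. by case: z => a b; rewrite /ab /= sqrrN. Qed.

Lemma sqr_ab z : z * conjc z = (ab z ^+ 2)%:C.
Proof.
case: z => a b; rewrite /ab /= sqr_sqrtr ?addr_ge0 ?sqr_ge0//.
by apply/eqP; rewrite eq_complex /=; apply/andP; split; apply/eqP; ring.
Qed.

Lemma ReD z w : complex.Re (z + w) = complex.Re z + complex.Re w.
Proof. by case: z => ? ?; case: w. Qed.
Lemma ReN z : complex.Re (- z) = - complex.Re z.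
Proof. by case: z. Qed.
Lemma ImD z w : complex.Im (z + w) = complex.Im z + complex.Im w.
Proof. by case: z => ? ?; case: w. Qed.

Lemma ReJ z : complex.Re (conjc z) = complex.Re z.
Proof. by case: z. Qed.
Lemma ImJ z : complex.Im (conjc z) = - complex.Im z.
Proof. by case: z. Qed.
Lemma ReZ (r : R) z : complex.Re (r%:C * z) = r * complex.Re z.
Proof. by case: z => a b /=; rewrite mul0r subr0. Qed.

Lemma Re_le_ab z : `|complex.Re z| <= ab z.
Proof.
case: z => a b; rewrite /ab /= -sqrtr_sqr ler_wsqrtr// lerDl sqr_ge0//.
Qed.

Lemma Im_le_ab z : `|complex.Im z| <= ab z.
Proof.
case: z => a b; rewrite /ab /= -sqrtr_sqr ler_wsqrtr// lerDr sqr_ge0//.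
Qed.

Lemma Re_le z : complex.Re z <= ab z.
Proof. exact: le_trans (ler_norm _) (Re_le_ab z). Qed.

Lemma complex_ext z w :
  complex.Re z = complex.Re w -> complex.Im z = complex.Im w -> z = w.
Proof. by case: z => a b; case: w => c d /= -> ->. Qed.

Lemma ler_ab_sum (I : Type) (r : seq I) (P : pred I) (F : I -> C) :
  ab (\sum_(i <- r | P i) F i) <= \sum_(i <- r | P i) ab (F i).
Proof.
elim/big_rec2: _ => [|i y x _ H]; first by rewrite ab0.
by apply: le_trans (ler_abD _ _) _; rewrite lerD2l.
Qed.

Lemma Re_sum (I : Type) (r : seq I) (P : pred I) (F : I -> C) :
  complex.Re (\sum_(i <- r | P i) F i) = \sum_(i <- r | P i) complex.Re (F i).
Proof. by elim/big_rec2: _ => // i y x _ H; rewrite ReD H. Qed.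

Lemma conjcM z w : conjc (z * w) = conjc z * conjc w.
Proof. exact: rmorphM. Qed.
Lemma conjcD z w : conjc (z + w) = conjc z + conjc w.
Proof. exact: rmorphD. Qed.
Lemma conjcB z w : conjc (z - w) = conjc z - conjc w.
Proof. exact: rmorphB. Qed.
Lemma conjcN z : conjc (- z) = - conjc z.
Proof. exact: rmorphN. Qed.

Lemma conjc_sum (I : Type) (r : seq I) (P : pred I) (F : I -> C) :
  conjc (\sum_(i <- r | P i) F i) = \sum_(i <- r | P i) conjc (F i).
Proof. exact: rmorph_sum. Qed.

Lemma realc_sum (I : Type) (r : seq I) (P : pred I) (F : I -> R) :
  (\sum_(i <- r | P i) F i)%:C = \sum_(i <- r | P i) (F i)%:C.
Proof. exact: rmorph_sum. Qed.

Lemma ge0_complex z : 0 <= z -> z = (complex.Re z)%:C.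
Proof. by case: z => a b; rewrite lecE /= => /andP[/eqP-> _]. Qed.

Lemma ge0_Re z : 0 <= z -> 0 <= complex.Re z.
Proof. by case: z => a b; rewrite lecE /= => /andP[]. Qed.

Lemma realc_ge0 (r : R) : 0 <= r -> 0 <= r%:C.
Proof. by move=> r0; rewrite lecE /= eqxx. Qed.

Lemma ge0_conjc z : 0 <= z -> conjc z = z.
Proof. by move=> /ge0_complex ->; rewrite conjc_real. Qed.

Lemma ler_eps (x y : R) : (forall e, 0 < e -> x <= y + e) -> x <= y.
Proof. by move=> H; apply/ler_addgt0Pr => e /H. Qed.

Lemma ab_small0 z : (forall e : R, 0 < e -> ab z <= e) -> z = 0.
Proof.
move=> H; apply: ab_eq0; apply/eqP; rewrite eq_le ab_ge0 andbT.
by apply: ler_eps => e e0; rewrite add0r H.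
Qed.

End Scalars.

(** * Hilbert spaces: inner product, norm convergence, bounded operators *)

Section Hilbert.
Variable R : realType.
Local Notation C := R[i].
Implicit Types H K : hilbertType R.

Lemma ipDl H (u v w : H) : '<(u + v), w> = '<u, w> + '<v, w>.
Proof. exact: linearDl. Qed.
Lemma ipDr H (u v w : H) : '<w, (u + v)> = '<w, u> + '<w, v>.
Proof. exact: linearDr. Qed.

Lemma ipNr H (u w : H) : '<w, - u> = - '<w, u>.
Proof. exact: linearNr. Qed.
Lemma ipBl H (u v w : H) : '<(u - v), w> = '<u, w> - '<v, w>.
Proof. exact: linearBl. Qed.
Lemma ipBr H (u v w : H) : '<w, (u - v)> = '<w, u> - '<w, v>.
Proof. exact: linearBr. Qed.
Lemma ip0l H (w : H) : '<0, w> = 0.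
Proof. exact: linear0l. Qed.
Lemma ip0r H (w : H) : '<w, 0> = 0.
Proof. exact: linear0r. Qed.
Lemma ipZl H (a : C) (u w : H) : '<a *: u, w> = a * '<u, w>.
Proof. exact: linearZl_LR. Qed.
Lemma ipZr H (a : C) (u w : H) : '<w, a *: u> = conjc a * '<w, u>.
Proof. exact: linearZr_LR. Qed.
Lemma ipC H (u v : H) : '<u, v> = conjc '<v, u>.
Proof. by rewrite {1}(hermC (inner : {dot H for _})) expr0 mul1r. Qed.
Lemma ip_suml H (I : Type) (r : seq I) (P : pred I) (F : I -> H) w :
  '<\sum_(i <- r | P i) F i, w> = \sum_(i <- r | P i) '<F i, w>.
Proof. exact: linear_sumlz. Qed.
Lemma ip_sumr H (I : Type) (r : seq I) (P : pred I) (F : I -> H) w :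
  '<w, \sum_(i <- r | P i) F i> = \sum_(i <- r | P i) '<w, F i>.
Proof. exact: linear_sumr. Qed.

Definition nr H (v : H) : R := ab `|v|.

Lemma nr_ge0 H (v : H) : 0 <= nr v.
Proof. exact: ab_ge0. Qed.

Lemma normr_nr H (v : H) : `|v| = (nr v)%:C.
Proof. by rewrite /nr -normr_ab normr_id. Qed.

Lemma ipvv H (v : H) : '<v, v> = (nr v ^+ 2)%:C.
Proof. by rewrite -sqr_normE normr_nr rmorphXn. Qed.

Lemma nr0 H : nr (0 : H) = 0.
Proof. by rewrite /nr normr0 ab0. Qed.

Lemma nr_eq0 H (v : H) : nr v = 0 -> v = 0.
Proof. by move=> v0; apply/eqP; rewrite -normr_eq0 normr_nr v0. Qed.

Lemma ler_nrD H (u v : H) : nr (u + v) <= nr u + nr v.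
Proof.
have := ler_normD u v; rewrite !normr_nr -rmorphD/=.
by rewrite lecE /= eqxx.
Qed.

Lemma nrZ H a (v : H) : nr (a *: v) = ab a * nr v.
Proof.
have := normrZ a v; rewrite !normr_nr normr_ab -rmorphM /= => /eqP.
by rewrite eq_complex /= => /andP[/eqP].
Qed.

Lemma nrN H (v : H) : nr (- v) = nr v.
Proof. by rewrite /nr normrN. Qed.

Lemma ler_nrB H (u v : H) : nr (u - v) <= nr u + nr v.
Proof. by rewrite -[X in _ <= _ + X]nrN ler_nrD. Qed.

Lemma nrC H (u v : H) : nr (u - v) = nr (v - u).
Proof. by rewrite -nrN opprB. Qed.

Lemma sqr_nr H (v : H) : nr v ^+ 2 = complex.Re '<v, v>.
Proof. by rewrite ipvv. Qed.

Lemma ip_ge0 H (v : H) : 0 <= '<v, v>.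
Proof. by rewrite ipvv realc_ge0// sqr_ge0. Qed.

Lemma sqr_nrD H (u v : H) :
  nr (u + v) ^+ 2 = nr u ^+ 2 + nr v ^+ 2 + complex.Re '<u, v> *+ 2.
Proof.
rewrite !sqr_nr ipDl !ipDr !ReD (ipC v u) ReJ; ring.
Qed.

Lemma sqr_nrB H (u v : H) :
  nr (u - v) ^+ 2 = nr u ^+ 2 + nr v ^+ 2 - complex.Re '<u, v> *+ 2.
Proof. by rewrite sqr_nrD nrN ipNr ReN mulNrn. Qed.

Lemma Re_ip_le H (u v : H) : complex.Re '<u, v> <= nr u * nr v.
Proof.
have [->|u0] := eqVneq u 0; first by rewrite ip0l nr0 mul0r.
have [->|v0] := eqVneq v 0; first by rewrite ip0r nr0 mulr0.
have pu : 0 < nr u by rewrite lt_def nr_ge0 andbT; apply: contra_neq u0 => /nr_eq0.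
have pv : 0 < nr v by rewrite lt_def nr_ge0 andbT; apply: contra_neq v0 => /nr_eq0.
have := sqr_ge0 (nr ((nr v)%:C *: u - (nr u)%:C *: v)).
rewrite sqr_nrB !nrZ !ab_real !ger0_norm ?nr_ge0// ipZl ipZr conjc_real !ReZ.
have -> : (nr v * nr u) ^+ 2 + (nr u * nr v) ^+ 2 -
   (nr v * (nr u * complex.Re '< u, v >)) *+ 2 =
   2 * (nr u * nr v) * (nr u * nr v - complex.Re '<u,v>) by ring.
by rewrite pmulr_rge0 ?mulr_gt0// subr_ge0.
Qed.

Lemma CS H (u v : H) : ab '<u, v> <= nr u * nr v.
Proof.
set z := '<u, v>.
have [z0|z0] := eqVneq z 0; first by rewrite z0 ab0 mulr_ge0 ?nr_ge0.
have pz : 0 < ab z by rewrite lt_def ab_ge0 andbT; apply: contra_neq z0 => /ab_eq0.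
(* Multiplying [u] by [conjc z] makes the inner product real, equal to [|z|^2]. *)
have := Re_ip_le (conjc z *: u) v; rewrite ipZl -/z mulrC sqr_ab /= nrZ abJ.
by rewrite -mulrA expr2 ler_pM2l.
Qed.

Lemma ip_eq0 H (v : H) : '<v, v> = 0 -> v = 0.
Proof.
rewrite ipvv => /eqP; rewrite eq_complex /= => /andP[/eqP h _].
by apply: nr_eq0; apply/eqP; rewrite -sqrf_eq0 h.
Qed.

Lemma ip_ext H (u v : H) : (forall w, '<u, w> = '<v, w>) -> u = v.
Proof.
move=> h; apply/eqP; rewrite -subr_eq0; apply/eqP; apply: ip_eq0.
by rewrite ipBl h subrr.
Qed.

Lemma nr_le_ip H (v : H) (M : R) : 0 <= M ->
  (forall w, ab '<v, w> <= M * nr w) -> nr v <= M.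
Proof.
move=> M0 h; have := h v; rewrite ipvv ab_real ger0_norm ?sqr_ge0// expr2.
have [->|v0] := eqVneq v 0; first by rewrite nr0.
have pv : 0 < nr v by rewrite lt_def nr_ge0 andbT; apply: contra_neq v0 => /nr_eq0.
by rewrite ler_pM2r.
Qed.

Lemma parallelogram H (u v : H) :
  nr (u + v) ^+ 2 + nr (u - v) ^+ 2 = (nr u ^+ 2 + nr v ^+ 2) *+ 2.
Proof. by rewrite sqr_nrD sqr_nrB; ring. Qed.

Definition cvH H (f : nat -> H) (l : H) :=
  forall e : R, 0 < e -> exists N, forall n, (N <= n)%N -> nr (f n - l) < e.

Lemma cvH_unique H (f : nat -> H) l l' : cvH f l -> cvH f l' -> l = l'.
Proof.
move=> h h'; apply/eqP; rewrite -subr_eq0; apply/eqP; apply: nr_eq0.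
apply/eqP; rewrite eq_le nr_ge0 andbT; apply: ler_eps => e e0.
have e2 : 0 < e / 2 by rewrite divr_gt0.
have [N hN] := h _ e2; have [N' hN'] := h' _ e2.
set n := maxn N N'.
have -> : l - l' = (f n - l') - (f n - l) by rewrite opprB [RHS]addrC addrA subrK.
have := hN n (leq_maxl _ _); have := hN' n (leq_maxr _ _).
have := ler_nrB (f n - l') (f n - l); lra.
Qed.

Lemma cauchyH H (f : nat -> H) :
  (forall e : R, 0 < e -> exists N, forall m n, (N <= m)%N -> (N <= n)%N ->
     nr (f m - f n) < e) ->
  exists l, cvH f l.
Proof.
move=> h.
have : cvg (f @ \oo).
  apply/cauchy_cvgP/cauchy_ballP => e e0.
  have e0' : 0 < complex.Re e by move: e0; rewrite ltcE /= => /andP[].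
  have [N hN] := h _ e0'.
  exists ((f @` [set n | (N <= n)%N]), (f @` [set n | (N <= n)%N])).
    by split; exists N => // n /= Nn; exists n.
  move=> [x y] /= [[m Nm <-] [n Nn <-]].
  rewrite -ball_normE /ball_ /= normr_nr.
  have -> : e = (complex.Re e)%:C by apply: ge0_complex; exact: ltW.
  by rewrite ltcE /= eqxx /=; exact: hN.
move=> /cvg_ex[l hl]; exists l => e e0.
have := hl; move=> /cvgrPdist_lt /(_ e%:C).
rewrite ltcE /= eqxx e0 => /(_ isT) [N _ hN]; exists N => n Nn.
by have := hN n Nn; rewrite /= distrC normr_nr ltcE /= eqxx.
Qed.

Lemma cvH_ip H (f : nat -> H) l v (e : R) : cvH f l -> 0 < e ->
  exists N, forall n, (N <= n)%N -> ab ('<f n, v> - '<l, v>) < e.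
Proof.
move=> h e0; have [N hN] := h (e / (nr v + 1)) (divr_gt0 e0 (ltr_wpDl (nr_ge0 v) ltr01)).
exists N => n /hN h1; rewrite -ipBl; apply: le_lt_trans (CS _ _) _.
apply: (@le_lt_trans _ _ (nr (f n - l) * (nr v + 1))).
  by rewrite ler_wpM2l ?nr_ge0// lerDl.
by rewrite -ltr_pdivlMr// ltr_wpDl// nr_ge0.
Qed.

Lemma cvH_ip0 H (f : nat -> H) l v :
  cvH f l -> (forall n, '<f n, v> = 0) -> '<l, v> = 0.
Proof.
move=> h h0; apply: ab_small0 => e e0.
have [N /(_ N (leqnn _))] := cvH_ip v h e0.
by rewrite h0 sub0r abN => /ltW.
Qed.

Lemma cvH_nr_le H (f : nat -> H) l (M : R) :
  cvH f l -> (forall n, nr (f n) <= M) -> nr l <= M.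
Proof.
move=> h hM; apply: ler_eps => e e0; have [N /(_ N (leqnn _)) hN] := h _ e0.
have -> : l = f N - (f N - l) by rewrite opprB addrC subrK.
by apply: le_trans (ler_nrB _ _) _; rewrite lerD// ltW.
Qed.

Definition bdd H K (f : H -> K) :=
  exists2 M : R, 0 <= M & forall v, nr (f v) <= M * nr v.

Lemma bdd_continuous H K (f : {linear H -> K}) : continuous f <-> bdd f.
Proof.
split=> [cf|[M M0 hM]].
  have /linear_boundedP := continuous_linear_bounded 0 (cf 0).
  move=> /pinfty_ex_gt0 [M M0 hM].
  exists (complex.Re M); first by apply: ge0_Re; exact: ltW.
  move=> v; have := hM v; rewrite !normr_nr (ge0_complex (ltW M0)).
  by rewrite -rmorphM /= lecE /= eqxx.
apply: bounded_linear_continuous; apply/linear_boundedP.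
near=> r => x; rewrite !normr_nr.
have rr : M%:C <= r by near: r; apply: nbhs_pinfty_ge; rewrite ger0_real ?realc_ge0.
apply: (@le_trans _ _ (M%:C * (nr x)%:C)).
  by rewrite -rmorphM /= lecE /= eqxx hM.
by rewrite ler_wpM2r// realc_ge0 ?nr_ge0.
Unshelve. all: by end_near. Qed.

(** Functionals and maps such as [alpha] act on bundled linear maps. Proof irrelevance of the
    linearity fields turns pointwise equality into Leibniz equality, so that one can rewrite under
    them. *)
Lemma op_ext H K (x y : {linear H -> K}) : x =1 y -> x = y.
Proof.
case: x => x [[a] [b]]; case: y => y [[c] [d]] /= /funext exy.
by subst y; congr (GRing.Linear.Pack (GRing.Linear.Class _ _)); congr (_ _); exact: Prop_irrelevance.
Qed.

End Hilbert.

(** * Unordered sums *)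

Section Hsum.
Variable R : realType.
Local Notation C := R[i].

(** Convergence of the net of finite partial sums: no enumeration is fixed, so families over
    products and disjoint unions can be rearranged freely. *)
Definition hsum (I : choiceType) (c : I -> C) (s : C) := forall e : R, 0 < e ->
  exists A : {fset I}, forall B : {fset I}, (A `<=` B)%fset ->
    ab (\sum_(i <- B) c i - s) < e.

Lemma hsum_unique (I : choiceType) (c : I -> C) s s' :
  hsum c s -> hsum c s' -> s = s'.
Proof.
move=> h h'; apply/eqP; rewrite -subr_eq0; apply/eqP; apply: ab_small0 => e e0.
have e2 : 0 < e / 2 by rewrite divr_gt0.
have [A hA] := h _ e2; have [A' hA'] := h' _ e2.
have := hA _ (fsubsetUl A A'); have := hA' _ (fsubsetUr A A').
set t := \sum_(i <- _) _.
have -> : s - s' = (t - s') - (t - s) by rewrite opprB [RHS]addrC addrA subrK.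
have := ler_abB (t - s') (t - s); lra.
Qed.

Lemma eq_hsum (I : choiceType) (c d : I -> C) s : c =1 d -> hsum c s -> hsum d s.
Proof. by move=> /funext ->. Qed.

Lemma hsumD (I : choiceType) (c d : I -> C) s t :
  hsum c s -> hsum d t -> hsum (fun i => c i + d i) (s + t).
Proof.
move=> h h' e e0; have e2 : 0 < e / 2 by rewrite divr_gt0.
have [A hA] := h _ e2; have [A' hA'] := h' _ e2.
exists (A `|` A')%fset => B AB; rewrite big_split /=.
have := hA _ (fsubset_trans (fsubsetUl A A') AB).
have := hA' _ (fsubset_trans (fsubsetUr A A') AB).
have -> : \sum_(i <- B) c i + \sum_(i <- B) d i - (s + t) =
  (\sum_(i <- B) c i - s) + (\sum_(i <- B) d i - t) by ring.
have := ler_abD (\sum_(i <- B) c i - s) (\sum_(i <- B) d i - t); lra.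
Qed.

Lemma hsumZ (I : choiceType) (c : I -> C) s a :
  hsum c s -> hsum (fun i => a * c i) (a * s).
Proof.
move=> h e e0; have [A hA] := h (e / (ab a + 1)) (divr_gt0 e0 (ltr_wpDl (ab_ge0 a) ltr01)).
exists A => B /hA hB; rewrite -mulr_sumr -mulrBr abM.
apply: (@le_lt_trans _ _ ((ab a + 1) * ab (\sum_(i <- B) c i - s))).
  by rewrite ler_wpM2r ?ab_ge0// lerDl.
by rewrite mulrC -ltr_pdivlMr// ltr_wpDl// ab_ge0.
Qed.

Lemma hsumN (I : choiceType) (c : I -> C) s : hsum c s -> hsum (fun i => - c i) (- s).
Proof.
by move=> /(hsumZ (-1)); rewrite mulN1r; apply: eq_hsum => i; rewrite mulN1r.
Qed.

Lemma hsumB (I : choiceType) (c d : I -> C) s t :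
  hsum c s -> hsum d t -> hsum (fun i => c i - d i) (s - t).
Proof. by move=> h /hsumN; exact: hsumD. Qed.

Lemma hsumJ (I : choiceType) (c : I -> C) s :
  hsum c s -> hsum (fun i => conjc (c i)) (conjc s).
Proof.
move=> h e /h [A hA]; exists A => B /hA.
by rewrite -conjc_sum -rmorphB abJ.
Qed.

Lemma hsum0 (I : choiceType) : hsum (fun _ : I => 0) 0.
Proof. by move=> e e0; exists fset0 => B _; rewrite big1// subr0 ab0. Qed.

Lemma hsum_le (I : choiceType) (c : I -> C) s (M : R) :
  hsum c s -> (forall A : {fset I}, ab (\sum_(i <- A) c i) <= M) -> ab s <= M.
Proof.
move=> h hM; apply: ler_eps => e /h [A /(_ A (fsubset_refl _)) hA].
have -> : s = \sum_(i <- A) c i - (\sum_(i <- A) c i - s) by rewrite opprB addrC subrK.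
by apply: le_trans (ler_abB _ _) _; rewrite lerD// ltW.
Qed.

Lemma hsum_fset (I : choiceType) (c : I -> C) (A : {fset I}) :
  (forall i, i \notin A -> c i = 0) -> hsum c (\sum_(i <- A) c i).
Proof.
move=> h e e0; exists A => B AB; rewrite (big_fset_incl _ AB) ?subrr ?ab0//.
by move=> i _ /h.
Qed.

Lemma hsum1 (I : choiceType) (c : I -> C) (j : I) :
  (forall i, i != j -> c i = 0) -> hsum c (c j).
Proof.
move=> h; have := @hsum_fset _ c [fset j]%fset; rewrite big_seq_fset1; apply.
by move=> i; rewrite inE; exact: h.
Qed.

Lemma ler_sum_fset (I : choiceType) (f : I -> R) (A B : {fset I}) :
  (forall i, 0 <= f i) -> (A `<=` B)%fset ->
  \sum_(i <- A) f i <= \sum_(i <- B) f i.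
Proof.
move=> f0 AB; rewrite [leRHS](big_fsetID _ (mem A)) /=.
have -> : [fset x in B | x \in A]%fset = A.
  by apply/fsetP => i; rewrite !inE /= -(@in_fsetI _ B A) (fsetIidPr AB).
by rewrite lerDl sumr_ge0.
Qed.

Definition asum (I : choiceType) (c : I -> C) (M : R) :=
  forall A : {fset I}, \sum_(i <- A) ab (c i) <= M.

Lemma asum_hsum_nneg (I : choiceType) (f : I -> R) (M : R) :
  (forall i, 0 <= f i) -> (forall A : {fset I}, \sum_(i <- A) f i <= M) ->
  exists s : R, hsum (fun i => (f i)%:C) s%:C /\
    forall A : {fset I}, \sum_(i <- A) f i <= s.
Proof.
move=> f0 hM; set S := [set x | exists A : {fset I}, \sum_(i <- A) f i = x].
have hS : has_sup S.
  split; first by exists (\sum_(i <- fset0) f i); exists fset0.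
  by exists M => _ [A <-].
have ub (A : {fset I}) : \sum_(i <- A) f i <= sup S.
  by apply: sup_upper_bound => //; exists A.
exists (sup S); split => // e e0.
have [_ [A <-] hA] := sup_adherent e0 hS.
exists A => B AB; rewrite -realc_sum -rmorphB ab_real.
have := ub B; have := ler_sum_fset f0 AB => h1 h2.
by rewrite ler0_norm ?subr_le0//; lra.
Qed.

Lemma asum_hsum_real (I : choiceType) (f : I -> R) (M : R) :
  (forall A : {fset I}, \sum_(i <- A) `|f i| <= M) ->
  exists s : R, hsum (fun i => (f i)%:C) s%:C.
Proof.
move=> hM.
have [s [hs _]] := @asum_hsum_nneg I (fun i => `|f i|) M (fun=> normr_ge0 _) hM.
(* [f] is the difference of [|f| + f] and [|f|], both nonnegative with bounded partial sums. *)
have [||t [ht _]] := @asum_hsum_nneg I (fun i => `|f i| + f i) (2 * M).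
- by move=> i; have := ler_norm (- f i); rewrite normrN; lra.
- move=> A; apply: (@le_trans _ _ (2 * \sum_(i <- A) `|f i|)); last by rewrite ler_pM2l.
  by rewrite mulr_sumr ler_sum// => i _; have := ler_norm (f i); lra.
exists (t - s); rewrite rmorphB; apply: eq_hsum (hsumB ht hs) => i.
by rewrite rmorphD /= addrAC subrr add0r.
Qed.

Lemma asum_hsum (I : choiceType) (c : I -> C) (M : R) :
  asum c M -> exists s, hsum c s.
Proof.
move=> hM.
have [|s hs] := @asum_hsum_real I (fun i => complex.Re (c i)) M.
  by move=> A; apply: le_trans (hM A); rewrite ler_sum// => i _; exact: Re_le_ab.
have [|t ht] := @asum_hsum_real I (fun i => complex.Im (c i)) M.
  by move=> A; apply: le_trans (hM A); rewrite ler_sum// => i _; exact: Im_le_ab.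
exists (s%:C + 'i * t%:C); apply: eq_hsum (hsumD hs (hsumZ 'i ht)) => i.
by rewrite [RHS]complexE.
Qed.

Lemma asum_le (I : choiceType) (c : I -> C) s (M : R) :
  asum c M -> hsum c s -> ab s <= M.
Proof.
by move=> hM h; apply: hsum_le h _ => A; apply: le_trans (ler_ab_sum _ _ _) (hM A).
Qed.

Lemma sum_prodset (V : nmodType) (I J : choiceType) (F : I * J -> V)
    (A : {fset I}) (B : {fset J}) :
  \sum_(k <- (A `*` B)%fset) F k =
  \sum_(i <- A) \sum_(j <- B) F (i, j).
Proof. by rewrite /fsetM big_imfset2 //= => -[? ?] [? ?] _ _ /= [-> ->]. Qed.

Lemma hsum_fubini (I J : choiceType) (c : I * J -> C) s (r : I -> C) :
  hsum c s -> (forall i, hsum (fun j => c (i, j)) (r i)) -> hsum r s.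
Proof.
move=> h hr e e0; have e2 : 0 < e / 2 by rewrite divr_gt0.
have [A hA] := h _ e2; exists [fset x.1 | x in A]%fset => B AB.
(* The error [e / 2] is shared among the rows in [B]; the [+ 1] covers the empty [B]. The column set
   [J0] below serves the double sum and all these rows at once. *)
pose d : R := e / 2 / ((size B)%:R + 1).
have d0 : 0 < d by rewrite !divr_gt0// ltr_wpDl.
pose Jx i := projT1 (cid (hr i d d0)).
pose J0 := ([fset x.2 | x in A] `|` \bigcup_(i <- B) Jx i)%fset.
have := hA (B `*` J0)%fset.
rewrite sum_prodset => hB.
have {}hB : ab (\sum_(i <- B) \sum_(j <- J0) c (i, j) - s) < e / 2.
  apply: hB; apply/fsubsetP => -[x y] xyA; rewrite in_fsetM; apply/andP; split.
    by apply: (fsubsetP AB); apply/imfsetP; exists (x, y).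
  by rewrite !inE; apply/orP; left; apply/imfsetP; exists (x, y).
have h2 : ab (\sum_(i <- B) \sum_(j <- J0) c (i, j) - \sum_(i <- B) r i) <= e / 2.
  rewrite -sumrB; apply: le_trans (ler_ab_sum _ _ _) _.
  apply: (@le_trans _ _ (\sum_(i <- B) d)).
    rewrite big_seq [leRHS]big_seq ler_sum// => i iB.
    apply: ltW; apply: (projT2 (cid (hr i d d0))).
    apply/fsubsetP => j ji; rewrite !inE; apply/orP; right.
    by apply: (fsubsetP (bigfcup_sup _ iB (erefl true))).
  rewrite big_const_seq count_predT iter_addr_0 -[d *+ _]mulr_natr.
  have -> : e / 2 = d * ((size B)%:R + 1) by rewrite /d divfK// gt_eqF// ltr_wpDl.
  by rewrite ler_pM2l// lerDl.
set u := \sum_(i <- B) r i in h2 *; set v := \sum_(i <- B) \sum_(j <- J0) _ in hB h2.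
have -> : u - s = (v - s) - (v - u) by ring.
have := ler_abB (v - s) (v - u); lra.
Qed.

Definition pickle_set (I : countType) (n : nat) : {fset I} :=
  [fset i in pmap (@pickle_inv I) (iota 0 n)]%fset.

Lemma pickle_sum (V : nmodType) (I : countType) (f : I -> V) n :
  \sum_(0 <= k < n) (if @pickle_inv I k is Some i then f i else 0) =
  \sum_(i <- pickle_set I n) f i.
Proof.
transitivity (\sum_(i <- pmap (@pickle_inv I) (iota 0 n)) f i).
  rewrite /index_iota subn0; elim: (iota 0 n) => [|k l IH]; first by rewrite !big_nil.
  by rewrite big_cons /= IH; case: pickle_inv => [i|] /=; rewrite ?big_cons ?add0r.
apply: perm_big; apply: uniq_perm.
- apply: (@pmap_uniq _ _ _ (@choice.pickle I)); first exact: pickle_invK.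
  exact: iota_uniq.
- exact: fset_uniq.
- by move=> i; rewrite !inE.
Qed.

Lemma hsum_nat (I : countType) (c : I -> C) s : hsum c s ->
  forall e : R, 0 < e -> exists N, forall n, (N <= n)%N ->
    ab (\sum_(0 <= k < n) (if @pickle_inv I k is Some i then c i else 0) - s) < e.
Proof.
move=> h e /h [A hA].
exists (\max_(i <- A) @choice.pickle I i).+1 => n Nn; rewrite pickle_sum.
apply: hA; apply/fsubsetP => i iA; rewrite !inE mem_pmap; apply/mapP.
exists (@choice.pickle I i); last by rewrite pickleK_inv.
rewrite mem_iota /= add0n; apply: leq_trans Nn; rewrite ltnS.
by rewrite (big_rem i)//= leq_maxl.
Qed.

Lemma nat_hsum (c : nat -> C) s l : hsum c s ->
  (forall e : R, 0 < e -> exists N, forall n, (N <= n)%N ->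
    ab (\sum_(0 <= k < n) c k - l) < e) -> s = l.
Proof.
move=> h hl; apply/eqP; rewrite -subr_eq0; apply/eqP; apply: ab_small0 => e e0.
have e2 : 0 < e / 2 by rewrite divr_gt0.
have [N hN] := hl _ e2; have [A hA] := h _ e2.
pose n := maxn N (\max_(i <- A) i).+1.
have := hN n (leq_maxl _ _).
have := hA [fset i in iota 0 n]%fset.
have -> : \sum_(i <- [fset i in iota 0 n]%fset) c i = \sum_(0 <= k < n) c k.
  rewrite /index_iota subn0; apply: perm_big; apply: uniq_perm.
  - exact: fset_uniq.
  - exact: iota_uniq.
  - by move=> i; rewrite !inE.
move=> h1 h2; have {}h1 : ab (\sum_(0 <= k < n) c k - s) < e / 2.
  apply: h1; apply/fsubsetP => i iA; rewrite !inE mem_iota /= add0n.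
  by apply: leq_trans (leq_maxr _ _); rewrite ltnS (big_rem i)//= leq_maxl.
set t := \sum_(_ <= _ < _) _ in h1 h2.
have -> : s - l = (t - l) - (t - s) by ring.
have := ler_abB (t - l) (t - s); lra.
Qed.

Lemma sum_le_hsum (I : choiceType) (f : I -> R) (s : R) (A : {fset I}) :
  (forall i, 0 <= f i) -> hsum (fun i => (f i)%:C) s%:C -> \sum_(i <- A) f i <= s.
Proof.
move=> f0 h; apply: ler_eps => e e0; have [B hB] := h _ e0.
have := hB _ (fsubsetUl B A); rewrite -realc_sum -rmorphB ab_real => h1.
apply: le_trans (ler_sum_fset f0 (fsubsetUr B A)) _.
by have := ler_norm (\sum_(i <- (B `|` A)%fset) f i - s); lra.
Qed.

Lemma hsum_ge0_real (I : choiceType) (c : I -> C) (s : C) : (forall i, 0 <= c i) -> hsum c s ->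
  s = (complex.Re s)%:C /\ hsum (fun i => (complex.Re (c i))%:C) (complex.Re s)%:C.
Proof.
move=> c0 hs; have es : s = (complex.Re s)%:C.
  have es : s = conjc s.
    by apply: (hsum_unique hs); apply: eq_hsum (hsumJ hs) => i; rewrite ge0_conjc.
  by apply: complex_ext => //=; have := congr1 (@complex.Im R) es; rewrite ImJ; lra.
by split=> //; rewrite -es; apply: eq_hsum hs => i; exact: ge0_complex.
Qed.

Lemma hsum_ge0 (I : choiceType) (c : I -> C) (s : C) : (forall i, 0 <= c i) -> hsum c s -> 0 <= s.
Proof.
move=> c0 /(hsum_ge0_real c0)[-> hs]; apply: realc_ge0.
have := sum_le_hsum fset0 (fun i => ge0_Re (c0 i)) hs.
by rewrite big_seq_fset0.
Qed.

Lemma esum_hsum (I : choiceType) (f : I -> R) (s : R) :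
  (forall i, 0 <= f i) -> hsum (fun i => (f i)%:C) s%:C ->
  (\esum_(i in [set: I]) (f i)%:E = s%:E)%E.
Proof.
move=> f0 h.
apply/eqP; rewrite eq_le; apply/andP; split.
  apply: ge_ereal_sup => _ [X [finX _]] <-.
  by rewrite fsbig_finite//= sumEFin lee_fin sum_le_hsum.
apply/lee_addgt0Pr => e e0; have [A hA] := h _ e0.
have := hA A (fsubset_refl _); rewrite -realc_sum -rmorphB ab_real => h1.
apply: (@le_trans _ _ ((\sum_(i <- A) f i)%:E + e%:E)%E).
  rewrite -EFinD lee_fin; have := ler_norm (- (\sum_(i <- A) f i - s)).
  by rewrite normrN; lra.
rewrite leeD2r//; apply: esum_ge; exists [set` A]; first by split.
by rewrite fsbig_finite//= set_fsetK sumEFin.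
Qed.

End Hsum.

(** * Projections, adjoints and orthonormal bases *)

Section Geometry.
Variable R : realType.
Local Notation C := R[i].
Implicit Types H K : hilbertType R.

Lemma eps_inv (e : R) : 0 < e -> exists N : nat, forall n, (N <= n)%N -> n.+1%:R^-1 < e.
Proof.
move=> e0; have [N _ hN] := near_infty_natSinv_lt (PosNum e0).
by exists N => n Nn; exact: hN.
Qed.

Definition closed_subspace H (S : set H) :=
  [/\ S 0, forall a u v, S u -> S v -> S (a *: u + v) &
      forall f l, (forall n : nat, S (f n)) -> cvH f l -> S l].

Lemma projection_theorem H (S : set H) (v : H) : closed_subspace S ->
  exists p, S p /\ forall s, S s -> '<(v - p), s> = 0.
Proof.
move=> [S0 SP Sc].
pose D := [set nr (v - s) ^+ 2 | s in S].
have hD : has_inf D.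
  split; first by exists (nr (v - 0) ^+ 2), 0.
  by exists 0 => _ [s _ <-]; exact: sqr_ge0.
set d := inf D.
have lb s : S s -> d <= nr (v - s) ^+ 2.
  by move=> Ss; apply: ge_inf; [case: hD | exists s].
have ex n : exists s, S s /\ nr (v - s) ^+ 2 < d + n.+1%:R^-1.
  have n0 : 0 < n.+1%:R^-1 :> R by rewrite invr_gt0.
  by have [_ [s Ss <-] hs] := inf_adherent n0 hD; exists s.
have [f hf] := choice ex.
(* Parallelogram law for [v - f m] and [v - f n]: the midpoint of [f m] and [f n] stays in [S], so
   its distance to [v] is bounded below by [d]. *)
have mid m n : nr (f m - f n) ^+ 2 <= (m.+1%:R^-1 + n.+1%:R^-1) *+ 2.
  have := parallelogram (v - f m) (v - f n).
  have -> : v - f m - (v - f n) = - (f m - f n) by rewrite opprB addrC addrA subrK opprB.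
  have -> : v - f m + (v - f n) = 2%:R *: (v - 2%:R^-1 *: (f m + f n)).
    rewrite scalerBr scalerA divff ?pnatr_eq0// scale1r scaler_nat mulr2n.
    by rewrite opprD addrACA.
  rewrite nrN nrZ exprMn.
  have -> : ab (2%:R : C) = 2%:R.
    by have := @ab_real R 2%:R; rewrite rmorph_nat ger0_norm.
  have Sm : S (2%:R^-1 *: (f m + f n)).
    have -> : 2%:R^-1 *: (f m + f n) = 2%:R^-1 *: (f m + f n) + 0 by rewrite addr0.
    apply: (SP) => //; rewrite -[f m]scale1r; apply: (SP); first exact: (hf m).1.
    exact: (hf n).1.
  have := lb _ Sm; have := (hf m).2; have := (hf n).2.
  have -> : (2 : R) ^+ 2 = 4 by ring.
  rewrite !mulr2n; move: (m.+1%:R^-1) (n.+1%:R^-1) => x y.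
  move: (nr (v - f n) ^+ 2) (nr (v - f m) ^+ 2) (nr (f m - f n) ^+ 2) => a b c.
  move: (nr _ ^+ 2) => q; lra.
have [p hp] : exists p, cvH f p.
  apply: cauchyH => e e0.
  have [N hN] := eps_inv (divr_gt0 (exprn_gt0 2 e0) (ltr0n R 4)).
  exists N => m n Nm Nn; rewrite -(@ltr_pXn2r _ 2%N) ?nnegrE ?nr_ge0 ?(ltW e0)//.
  have := mid m n; have := hN _ Nm; have := hN _ Nn; rewrite !mulr2n.
  by move: (m.+1%:R^-1) (n.+1%:R^-1) (e ^+ 2) => x y z; lra.
have Sp : S p by apply: Sc hp => n; exact: (hf n).1.
have dp : nr (v - p) ^+ 2 <= d.
  (* The terms [e], [e], [2 e nr (v - p)] and [2 e e] of the expanded square are collected using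
     [e <= 1]. *)
  have h e : 0 < e -> e <= 1 -> nr (v - p) ^+ 2 <= d + e * (4 + 2 * nr (v - p)).
    move=> e0 e1; have [N1 hN1] := hp _ e0; have [N2 hN2] := eps_inv e0.
    set n := maxn N1 N2; have h1 := hN1 n (leq_maxl _ _).
    have := hN2 n (leq_maxr _ _); have := (hf n).2; move: (n.+1%:R^-1) => x h4 h2.
    have -> : v - p = (v - f n) + (f n - p) by rewrite addrA subrK.
    have h3 : nr (v - f n) <= nr (v - p) + e.
      have -> : v - f n = (v - p) - (f n - p) by rewrite opprB addrA subrK.
      by apply: le_trans (ler_nrB _ _) _; rewrite lerD2l ltW.
    rewrite sqr_nrD; have h5 := Re_ip_le (v - f n) (f n - p).
    have -> : v - f n + (f n - p) = v - p by rewrite addrA subrK.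
    have h6 : nr (v - f n) * nr (f n - p) <= (nr (v - p) + e) * e.
      by rewrite ler_pM ?nr_ge0// ltW.
    have h7 : nr (f n - p) ^+ 2 <= e.
      apply: (@le_trans _ _ (e * e)); last by rewrite -[leRHS]mulr1 ler_pM2l.
      by rewrite expr2 ler_pM ?nr_ge0// ltW.
    have h8 : e * e <= e by rewrite -[leRHS]mulr1 ler_pM2l.
    rewrite mulr2n; lra.
  rewrite leNgt; apply/negP => hlt.
  pose e := Num.min 1 ((nr (v - p) ^+ 2 - d) / 2 / (4 + 2 * nr (v - p))).
  have p3 : 0 < 4 + 2 * nr (v - p) by rewrite ltr_pwDl// mulr_ge0// nr_ge0.
  have e0 : 0 < e by rewrite lt_min ltr01 /= !divr_gt0// subr_gt0.
  have e1 : e <= 1 by rewrite ge_min lexx.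
  have := h e e0 e1.
  have : e * (4 + 2 * nr (v - p)) <= (nr (v - p) ^+ 2 - d) / 2.
    by rewrite -ler_pdivlMr// ge_min lexx orbT.
  lra.
exists p; split => // s Ss.
set z := '<(v - p), s>; apply: ab_eq0; apply/eqP; rewrite eq_le ab_ge0 andbT.
rewrite leNgt; apply/negP => z0.
(* Moving [p] by [t z s] changes the squared distance by [- 2 t |z|^2 + t^2 |z|^2 |s|^2]. This [t]
   makes the second term at most half the size of the first, so the distance would drop below its
   infimum. *)
pose t := (nr s ^+ 2 + 1)^-1.
have t0 : 0 < t by rewrite invr_gt0 ltr_wpDl// sqr_ge0.
have h := lb _ (SP (t%:C * z) s p Ss Sp).
have := le_trans dp h.
have -> : v - ((t%:C * z) *: s + p) = (v - p) - (t%:C * z) *: s.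
  by rewrite opprD addrA addrAC.
rewrite (sqr_nrB (v - p)) nrZ abM ab_real gtr0_norm// ipZr conjcM conjc_real -/z.
rewrite -(mulrA t%:C) [conjc z * z]mulrC sqr_ab ReZ /= !exprMn => hh.
have ht : t * nr s ^+ 2 <= 1.
  by rewrite /t mulrC ler_pdivrMr ?ltr_wpDl ?sqr_ge0// mul1r lerDl.
have z2 : 0 < ab z ^+ 2 by rewrite exprn_gt0.
have hk : t * ab z ^+ 2 * (t * nr s ^+ 2) <= t * ab z ^+ 2 * 1.
  by rewrite ler_pM2l// mulr_gt0.
have : 0 < t * ab z ^+ 2 by rewrite mulr_gt0.
have : t ^+ 2 * ab z ^+ 2 * nr s ^+ 2 = t * ab z ^+ 2 * (t * nr s ^+ 2) by ring.
rewrite mulr2n in hh; lra.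
Qed.

Lemma cvH_nr H (f : nat -> H) l : cvH f l -> forall e : R, 0 < e ->
  exists n, nr (l - f n) < e.
Proof. by move=> h e /h[N hN]; exists N; rewrite nrC hN. Qed.

Lemma riesz H (phi : H -> C) (M : R) : 0 <= M ->
  (forall a u v, phi (a *: u + v) = a * phi u + phi v) ->
  (forall v, ab (phi v) <= M * nr v) ->
  exists z, forall v, phi v = '<v, z>.
Proof.
move=> M0 lin bd.
have phi0 : phi 0 = 0.
  by have := lin (-1) 0 0; rewrite scaler0 addr0 mulN1r addNr.
have phiB u v : phi (u - v) = phi u - phi v.
  by have := lin (-1) v u; rewrite scaleN1r addrC mulN1r [_ + phi u]addrC.
have [h0|/existsNP [v0 hv0]] := pselect (forall v, phi v = 0).
  by exists 0 => v; rewrite h0 ip0r.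
have cS : closed_subspace [set v | phi v = 0].
  split => //= [a u v hu hv|f l hf hl]; first by rewrite lin hu hv mulr0 addr0.
  apply: ab_small0 => e e0.
  have [n hn] := cvH_nr hl (divr_gt0 e0 (ltr_wpDl M0 ltr01)).
  have := bd (l - f n); rewrite phiB hf subr0 => h; apply: le_trans h _.
  apply: (@le_trans _ _ ((M + 1) * nr (l - f n))).
    by rewrite ler_wpM2r ?nr_ge0// lerDl.
  by rewrite mulrC -ler_pdivlMr ?ltr_wpDl// ltW.
have [p [/= Sp hp]] := projection_theorem v0 cS.
set w := v0 - p in hp.
have phiw : phi w = phi v0 by rewrite /w phiB Sp subr0.
have ww0 : '<w, w> != 0.
  apply/eqP => /ip_eq0 w0; apply: hv0; by rewrite -phiw w0 phi0.
exists ((conjc (phi w) / '<w, w>) *: w) => v.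
rewrite ipZr.
have : '<((phi w) *: v - (phi v) *: w), w> = 0.
  rewrite ipC hp ?conjc0//=.
  by rewrite phiB -[_ *: v]addr0 -[_ *: w]addr0 !lin phi0 !addr0 mulrC subrr.
rewrite ipBl !ipZl => /eqP; rewrite subr_eq0 => /eqP h.
rewrite conjcM conjcK fmorphV /= -ipC mulrAC h mulfK//.
Qed.

Definition mklin H K (f : H -> K) (h : linear f) : {linear H -> K} :=
  HB.pack_for {linear H -> K} f (GRing.isLinear.Build _ _ _ _ f h).

Lemma linear_of H K (f : {linear H -> K}) a u v : f (a *: u + v) = a *: f u + f v.
Proof. exact: linearP. Qed.

(** The source of the operators that no formula gives: adjoints, [x (x) 1], slices and densities are
    all obtained from their bounded sesquilinear forms. *)
Lemma form_operator H K (B : H -> K -> C) (M : R) : 0 <= M ->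
  (forall a u u' v, B (a *: u + u') v = a * B u v + B u' v) ->
  (forall a u v v', B u (a *: v + v') = conjc a * B u v + B u v') ->
  (forall u v, ab (B u v) <= M * nr u * nr v) ->
  exists2 X : {linear H -> K}, (forall u, nr (X u) <= M * nr u) &
    forall u v, '<X u, v> = B u v.
Proof.
move=> M0 linl linr bd.
have ex u : exists z, forall v, '<z, v> = B u v.
  have [|||z hz] := @riesz K (fun v => conjc (B u v)) (M * nr u).
  - by rewrite mulr_ge0 ?nr_ge0.
  - by move=> a v v'; rewrite linr conjcD conjcM conjcK.
  - by move=> v; rewrite abJ.
  by exists z => v; rewrite ipC -hz conjcK.
have [f hf] := choice ex.
have fl : linear f.
  by move=> a u v; apply: ip_ext => w; rewrite ipDl ipZl !hf linl.
exists (mklin fl) => [u|u v /=]; last by rewrite hf.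
by apply: nr_le_ip; rewrite ?mulr_ge0 ?nr_ge0// => w; rewrite /= hf.
Qed.

Lemma adjoint_exists H K (x : {linear H -> K}) : bdd x ->
  exists2 y : {linear K -> H}, bdd y & forall u v, '<x u, v> = '<u, y v>.
Proof.
move=> [M M0 hM].
have [|||y hy1 hy2] := @form_operator K H (fun v u => conjc '<x u, v>) M M0.
- by move=> a u u' v; rewrite ipDr ipZr conjcD conjcM conjcK.
- by move=> a u v v'; rewrite linear_of ipDl ipZl conjcD conjcM.
- move=> u v; rewrite abJ; apply: le_trans (CS _ _) _.
  by rewrite mulrAC ler_wpM2r ?nr_ge0.
exists y; first by exists M.
by move=> u v; rewrite [RHS]ipC hy2 conjcK.
Qed.

(* Junk value [0] when [x] is unbounded. *)
Definition adj H K (x : {linear H -> K}) : {linear K -> H} :=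
  if pselect (bdd x) is left h then s2val (cid2 (adjoint_exists h)) else \0.

Lemma bdd_adj H K (x : {linear H -> K}) : bdd (adj x).
Proof.
rewrite /adj; case: pselect => [h|_]; first by case: cid2.
by exists 0 => // v; rewrite mul0r /= nr0.
Qed.

Lemma adjP H K (x : {linear H -> K}) u v : bdd x -> '<x u, v> = '<u, adj x v>.
Proof. by move=> h; rewrite /adj; case: pselect => // h'; case: cid2. Qed.

Lemma adjP' H K (x : {linear H -> K}) u v : bdd x -> '<adj x u, v> = '<u, x v>.
Proof. by move=> h; rewrite ipC -adjP// -ipC. Qed.

Lemma adjK H K (x : {linear H -> K}) : bdd x -> adj (adj x) =1 x.
Proof.
move=> h u; apply: ip_ext => v.
by rewrite (adjP' _ _ (bdd_adj _)) [RHS]adjP.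
Qed.

Lemma bdd_comp (H1 H2 H3 : hilbertType R) (f : H2 -> H3) (g : H1 -> H2) :
  bdd f -> bdd g -> bdd (f \o g).
Proof.
move=> [M M0 hM] [N N0 hN]; exists (M * N); first exact: mulr_ge0.
move=> v /=; apply: le_trans (hM _) _; rewrite -mulrA ler_wpM2l//.
Qed.

Lemma bdd_id H : bdd (@idfun H).
Proof. by exists 1 => // v; rewrite mul1r. Qed.

Lemma bdd_comb H K (a : C) (f g : H -> K) : bdd f -> bdd g ->
  bdd (fun v => a *: f v + g v).
Proof.
move=> [M M0 hM] [N N0 hN]; exists (ab a * M + N); first by rewrite addr_ge0// mulr_ge0// ab_ge0.
move=> v; apply: le_trans (ler_nrD _ _) _; rewrite nrZ mulrDl lerD// -mulrA.
by rewrite ler_wpM2l// ab_ge0.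
Qed.

Lemma bdd_sub H K (f g : {linear H -> K}) : bdd f -> bdd g -> bdd (f \- g).
Proof.
move=> bf bg; have [M M0 hM] := bdd_comb (-1) bg bf; exists M => // v.
by have := hM v; rewrite scaleN1r addrC.
Qed.

Lemma bdd_cvH H K (x : {linear H -> K}) f l : bdd x -> cvH f l -> cvH (x \o f) (x l).
Proof.
move=> [M M0 hM] h e e0.
have [N hN] := h _ (divr_gt0 e0 (ltr_wpDl M0 ltr01)).
exists N => n /hN hn /=; rewrite -linearB; apply: le_lt_trans (hM _) _.
apply: (@le_lt_trans _ _ ((M + 1) * nr (f n - l))).
  by rewrite ler_wpM2r ?nr_ge0// lerDl.
by rewrite mulrC -ltr_pdivlMr// ltr_wpDl.
Qed.

(* Zero vectors are allowed, so that every separable space has a basis indexed by [nat]. *)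
Definition onf H (I : choiceType) (e : I -> H) :=
  (forall i j, i != j -> '<e i, e j> = 0) /\
  (forall i, '<e i, e i> = 1 \/ e i = 0).

Definition total_family H (I : Type) (e : I -> H) :=
  forall v, (forall i, '<v, e i> = 0) -> v = 0.

Section Bessel.
Variables (H : hilbertType R) (I : choiceType) (e : I -> H).
Hypothesis he : onf e.

Definition fproj (A : {fset I}) (v : H) : H := \sum_(i <- A) '<v, e i> *: e i.

Lemma fproj_ip (A : {fset I}) v j : j \in A -> '<fproj A v, e j> = '<v, e j>.
Proof.
move=> jA; rewrite /fproj ip_suml (big_fsetD1 j)//= big1_fset ?addr0.
  rewrite ipZl; case: (he.2 j) => [->|->]; first by rewrite mulr1.
  by rewrite !ip0r mul0r.
by move=> i; rewrite !inE => /andP[ij _] _; rewrite ipZl he.1 ?mulr0.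
Qed.

Lemma fproj_orth (A : {fset I}) v j : j \in A -> '<(v - fproj A v), e j> = 0.
Proof. by move=> jA; rewrite ipBl fproj_ip// subrr. Qed.

Lemma fproj_pyth (A : {fset I}) v :
  nr v ^+ 2 = nr (v - fproj A v) ^+ 2 + nr (fproj A v) ^+ 2.
Proof.
have h : '<(v - fproj A v), fproj A v> = 0.
  rewrite {2}/fproj ip_sumr big1_fset// => i iA _.
  by rewrite ipZr fproj_orth// mulr0.
by rewrite -{1}[v](subrK (fproj A v)) (sqr_nrD (v - fproj A v)) h /= mul0rn addr0.
Qed.

Lemma fproj_le (A : {fset I}) v : nr (fproj A v) <= nr v.
Proof.
rewrite -(@ler_pXn2r _ 2%N) ?nnegrE ?nr_ge0// [leRHS](fproj_pyth A).
by rewrite lerDr sqr_ge0.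
Qed.

Lemma fproj_sqr (A : {fset I}) v :
  nr (fproj A v) ^+ 2 = \sum_(i <- A) ab '<v, e i> ^+ 2.
Proof.
rewrite sqr_nr {2}/fproj ip_sumr Re_sum big_seq [RHS]big_seq.
by apply: eq_bigr => i iA; rewrite ipZr fproj_ip// mulrC sqr_ab.
Qed.

Lemma bessel (A : {fset I}) v : \sum_(i <- A) ab '<v, e i> ^+ 2 <= nr v ^+ 2.
Proof. by rewrite -fproj_sqr ler_pXn2r ?nnegrE ?nr_ge0// fproj_le. Qed.

Hypothesis te : total_family e.

Lemma fproj_lin (A : {fset I}) a u v : fproj A (a *: u + v) = a *: fproj A u + fproj A v.
Proof.
rewrite /fproj scaler_sumr -big_split; apply: eq_bigr => i _ /=.
by rewrite ipDl ipZl scalerDl scalerA.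
Qed.

Lemma fprojB (A : {fset I}) u v : fproj A (u - v) = fproj A u - fproj A v.
Proof. by have := fproj_lin A (-1) v u; rewrite !scaleN1r addrC [RHS]addrC. Qed.

(** The vectors approximated by their finite Fourier sums form a closed subspace containing every
    [e i]; by totality nothing is orthogonal to it. *)
Lemma onb_expand v (d : R) : 0 < d -> exists A : {fset I},
  forall B : {fset I}, (A `<=` B)%fset -> nr (v - fproj B v) < d.
Proof.
pose S := [set v | forall d : R, 0 < d -> exists A : {fset I},
  forall B : {fset I}, (A `<=` B)%fset -> nr (v - fproj B v) < d].
move: d; rewrite -/(S v).
have fp0 (B : {fset I}) : fproj B 0 = 0 by rewrite -[0 in LHS](subrr (0 : H)) fprojB subrr.
have cS : closed_subspace S.
  split.
  - by move=> d d0; exists fset0 => B _; rewrite fp0 subr0 nr0.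
  - move=> a u w hu hw d d0.
    have d1 : 0 < d / 2 / (ab a + 1) by rewrite !divr_gt0// ltr_wpDl// ab_ge0.
    have d2 : 0 < d / 2 by rewrite divr_gt0.
    have [A1 h1] := hu _ d1; have [A2 h2] := hw _ d2.
    exists (A1 `|` A2)%fset => B AB.
    have {}h1 := h1 _ (fsubset_trans (fsubsetUl A1 A2) AB).
    have {}h2 := h2 _ (fsubset_trans (fsubsetUr A1 A2) AB).
    rewrite fproj_lin opprD addrACA -scalerBr.
    apply: le_lt_trans (ler_nrD _ _) _; rewrite nrZ.
    have : ab a * nr (u - fproj B u) <= (ab a + 1) * nr (u - fproj B u).
      by rewrite ler_wpM2r ?nr_ge0// lerDl.
    have : (ab a + 1) * nr (u - fproj B u) < d / 2.
      by rewrite mulrC -ltr_pdivlMr// ltr_wpDl// ab_ge0.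
    lra.
  - move=> f l hf hl d d0; have d3 : 0 < d / 3 by rewrite divr_gt0.
    have [n hn] := cvH_nr hl d3; have [A hA] := hf n _ d3.
    exists A => B /hA hB.
    have -> : l - fproj B l = (l - f n) + (f n - fproj B (f n)) - fproj B (l - f n).
      by rewrite fprojB opprB !subrKA.
    apply: le_lt_trans (ler_nrB _ _) _.
    have := ler_nrD (l - f n) (f n - fproj B (f n)).
    have := fproj_le B (l - f n); lra.
have [p [Sp hp]] := projection_theorem v cS.
suff -> : v = p by [].
apply/eqP; rewrite -subr_eq0; apply/eqP; apply: te => i; apply: hp => d d0.
exists [fset i]%fset => B iB; suff -> : fproj B (e i) = e i by rewrite subrr nr0.
have iB' : i \in B by apply: (fsubsetP iB); rewrite inE.
rewrite /fproj (big_fsetD1 i)//= big1_fset ?addr0; last first.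
  by move=> j; rewrite !inE => /andP[ji _] _; rewrite he.1 ?scale0r// eq_sym.
by case: (he.2 i) => [->|->]; rewrite ?scale1r ?scaler0.
Qed.

Lemma parseval u v : hsum (fun i => '<u, e i> * conjc '<v, e i>) '<u, v>.
Proof.
move=> d d0; have d1 : 0 < d / (nr v + 1) by rewrite divr_gt0// ltr_wpDl// nr_ge0.
have [A hA] := onb_expand u d1; exists A => B /hA hB.
have -> : \sum_(i <- B) '<u, e i> * conjc '<v, e i> = '<fproj B u, v>.
  by rewrite /fproj ip_suml; apply: eq_bigr => i _; rewrite ipZl (ipC (e i) v).
rewrite abC -ipBl; apply: le_lt_trans (CS _ _) _.
apply: (@le_lt_trans _ _ (nr (u - fproj B u) * (nr v + 1))).
  by rewrite ler_wpM2l ?nr_ge0// lerDl.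
by rewrite -ltr_pdivlMr// ltr_wpDl// nr_ge0.
Qed.

Lemma parseval_sqr v : hsum (fun i => (ab '<v, e i> ^+ 2)%:C) (nr v ^+ 2)%:C.
Proof. by rewrite -ipvv; apply: eq_hsum (parseval v v) => i; rewrite sqr_ab. Qed.

End Bessel.

Lemma ip_unit H (v : H) : v != 0 -> '<((nr v)^-1%:C *: v), (nr v)^-1%:C *: v> = 1.
Proof.
move=> v0; have nv : nr v != 0 by apply: contra_neq v0; exact: nr_eq0.
rewrite ipZl ipZr conjc_real ipvv -!rmorphM /= -[RHS](rmorph1 (real_complex R)).
by congr (_%:C); field.
Qed.

Definition is_onb H (e : nat -> H) := onf e /\ total_family e.

(** Gram-Schmidt on a dense sequence. Each projection is taken onto the double orthogonal complement
    of the earlier vectors, which is visibly closed. A vector that depends on the earlier ones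
    contributes [e n = 0]. *)
Lemma onb_exists H : exists e : nat -> H, is_onb e.
Proof.
have [D cD dD] := @hilbert_separable R H.
have [f hf] : exists f : nat -> H, D `<=` range f.
  have /countable_injP[g ginj] := cD.
  exists (fun n => xget 0 [set d | D d /\ g d = n]) => d Dd; exists (g d) => //.
  case: xgetP => [d' _ [Dd' gd]|/(_ d)]; last by case.
  by apply: ginj => //; exact: mem_set.
have cS n : closed_subspace
    [set w | forall z, (forall i, (i < n)%N -> '<f i, z> = 0) -> '<w, z> = 0].
  split => /= [z _|a u v hu hv z hz|g l hg hl z hz]; first by rewrite ip0l.
    by rewrite ipDl ipZl hu// hv// mulr0 addr0.
  by apply: cvH_ip0 hl _ => m; exact: hg.
have [p hp] := choice (fun n => projection_theorem (f n) (cS n)).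
pose g n := f n - p n.
have gE n : f n = g n + p n by rewrite /g subrK.
have gorth i j : (i < j)%N -> '<g i, g j> = 0.
  move=> ij; rewrite ipC (hp j).2 ?conjc0//= => z hz.
  rewrite /g ipBl hz// (hp i).1 ?subr0// => k ki; apply: hz.
  exact: ltn_trans ki ij.
pose e n := ((nr (g n))^-1)%:C *: g n.
exists e; split; first split.
- move=> i j; rewrite neq_lt => /orP[] ij; rewrite /e ipZl ipZr.
    by rewrite gorth// !mulr0.
  by rewrite ipC gorth// conjc0 !mulr0.
- move=> i; have [gi|gi] := eqVneq (g i) 0; first by right; rewrite /e gi scaler0.
  by left; exact: ip_unit.
- move=> v hv.
  have hg i : '<g i, v> = 0.
    have [->|gi] := eqVneq (g i) 0; first by rewrite ip0l.
    have := hv i; rewrite /e ipZr => /eqP; rewrite mulf_eq0 => /orP[|/eqP h].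
      rewrite conjc_real => /eqP [] /eqP; rewrite invr_eq0 => /eqP /nr_eq0 /eqP.
      by rewrite (negPf gi).
    by rewrite ipC h conjc0.
  have hfv n : '<f n, v> = 0.
    elim/ltn_ind: n => n IH; rewrite gE ipDl hg (hp n).1 ?add0r//.
  apply: nr_eq0; apply/eqP; rewrite eq_le nr_ge0 andbT; apply: ler_eps => d d0.
  have [z [hz Dz]] : (ball v d%:C `&` D) !=set0.
    apply: dD; last exact: ball_open.
    by exists v; apply: ballxx; rewrite ltcE /= eqxx.
  have [n _ fz] := hf _ Dz.
  move: hz; rewrite -ball_normE /= normr_nr ltcE /= eqxx /= => hz.
  rewrite add0r; apply: le_trans (ltW hz).
  rewrite -(@ler_pXn2r _ 2%N) ?nnegrE ?nr_ge0//.
  by rewrite sqr_nrB -fz ipC hfv conjc0 /= mul0rn subr0 lerDl sqr_ge0.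
Qed.

End Geometry.

(** * Normal functionals *)

Section NormalFunctionals.
Variable R : realType.
Local Notation C := R[i].
Implicit Types H K W : hilbertType R.

Lemma CS_sum (I : Type) (r : seq I) (a b : I -> R) (s t : R) :
  0 <= s -> 0 <= t -> (forall i, 0 <= a i) -> (forall i, 0 <= b i) ->
  \sum_(i <- r) a i ^+ 2 <= s ^+ 2 -> \sum_(i <- r) b i ^+ 2 <= t ^+ 2 ->
  \sum_(i <- r) a i * b i <= s * t.
Proof.
move=> s0 t0 a0 b0 hs ht.
have zero (c d : I -> R) : \sum_(i <- r) c i ^+ 2 <= 0 ^+ 2 -> \sum_(i <- r) c i * d i = 0.
  rewrite expr0n /=; elim: r {hs ht} => [|j r IH]; first by rewrite !big_nil.
  rewrite !big_cons => h.
  have h1 := sqr_ge0 (c j); have h2 : 0 <= \sum_(i <- r) c i ^+ 2 by apply: sumr_ge0 => i _; exact: sqr_ge0.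
  rewrite (IH ltac:(lra)).
  have /eqP : c j ^+ 2 = 0 by lra.
  by rewrite sqrf_eq0 => /eqP ->; rewrite mul0r addr0.
have [s00|s1] := eqVneq s 0.
  by rewrite s00 in hs *; rewrite mul0r zero.
have [t00|t1] := eqVneq t 0.
  rewrite t00 in ht *; rewrite mulr0; under eq_bigr do rewrite mulrC.
  by rewrite zero.
have sp : 0 < s by rewrite lt_def s1.
have tp : 0 < t by rewrite lt_def t1.
(* Termwise [2 a b <= (t / s) a^2 + (s / t) b^2]; with these weights each of the two sums is at most
   [s t]. *)
apply: (@le_trans _ _ ((t / s * \sum_(i <- r) a i ^+ 2 + s / t * \sum_(i <- r) b i ^+ 2) / 2)).
  rewrite !mulr_sumr -big_split mulr_suml ler_sum// => i _ /=.
  have : 0 <= (t * a i - s * b i) ^+ 2 / (s * t).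
    by rewrite divr_ge0 ?sqr_ge0 ?mulr_ge0.
  have -> : (t * a i - s * b i) ^+ 2 / (s * t) =
    t / s * a i ^+ 2 + s / t * b i ^+ 2 - (a i * b i) * 2.
    by field; rewrite s1 t1.
  lra.
have : t / s * \sum_(i <- r) a i ^+ 2 <= t / s * s ^+ 2 by rewrite ler_wpM2l ?divr_ge0.
have : s / t * \sum_(i <- r) b i ^+ 2 <= s / t * t ^+ 2 by rewrite ler_wpM2l ?divr_ge0.
have -> : t / s * s ^+ 2 = s * t by field.
have -> : s / t * t ^+ 2 = s * t by field.
lra.
Qed.

Definition sqf H (I : choiceType) (u : I -> H) :=
  exists2 M : R, 0 <= M & forall A : {fset I}, \sum_(i <- A) nr (u i) ^+ 2 <= M ^+ 2.

Lemma sqf_bdd H K (I : choiceType) (u : I -> H) (x : H -> K) :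
  bdd x -> sqf u -> sqf (x \o u).
Proof.
move=> [M M0 hM] [N N0 hN]; exists (M * N); first exact: mulr_ge0.
move=> A; rewrite exprMn; apply: le_trans (_ : M ^+ 2 * \sum_(i <- A) nr (u i) ^+ 2 <= _).
  rewrite mulr_sumr ler_sum// => i _ /=; rewrite -exprMn.
  by rewrite lerXn2r ?nnegrE ?mulr_ge0 ?nr_ge0.
by rewrite ler_wpM2l// sqr_ge0.
Qed.

Lemma sqf_const H (u : H) : sqf (fun _ : unit => u).
Proof.
exists (nr u); first exact: nr_ge0.
move=> A; have As : (A `<=` [fset tt])%fset by apply/fsubsetP => -[]; rewrite inE.
apply: le_trans (ler_sum_fset (f := fun=> nr u ^+ 2) _ As) _; last by rewrite big_seq_fset1.
by move=> i; exact: sqr_ge0.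
Qed.

Lemma asum_sqf H (I : choiceType) (u v : I -> H) : sqf u -> sqf v ->
  exists2 M : R, 0 <= M & forall (x : H -> H) (N : R), 0 <= N ->
    (forall v, nr (x v) <= N * nr v) -> asum (fun i => '<x (u i), v i>) (M * N).
Proof.
move=> [Mu Mu0 hu] [Mv Mv0 hv]; exists (Mu * Mv); first exact: mulr_ge0.
move=> x N N0 hN A.
apply: le_trans (_ : N * \sum_(i <- A) nr (u i) * nr (v i) <= _).
  rewrite mulr_sumr ler_sum// => i _; apply: le_trans (CS _ _) _.
  by rewrite mulrA ler_wpM2r ?nr_ge0.
rewrite mulrC ler_wpM2r// CS_sum// => i; exact: nr_ge0.
Qed.

Definition rep H (w : op H -> C) (I : choiceType) (u v : I -> H) :=
  [/\ sqf u, sqf v & forall x : op H, bdd x -> hsum (fun i => '<x (u i), v i>) (w x)].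

(* The functionals of [predual], indexed by an arbitrary countable type. *)
Definition nf H (w : op H -> C) := exists (I : countType) (u v : I -> H), rep w u v.

Lemma rep_exists H (I : choiceType) (u v : I -> H) : sqf u -> sqf v ->
  exists w : op H -> C, rep w u v.
Proof.
move=> hu hv; have [M M0 hM] := asum_sqf hu hv.
have ex (x : op H) : exists s, bdd x -> hsum (fun i => '<x (u i), v i>) s.
  have [[N N0 hN]|nb] := pselect (bdd x); last by exists 0.
  by have [s hs] := asum_hsum (hM _ _ N0 hN); exists s.
by have [w hw] := choice ex; exists w; split.
Qed.

Lemma nf_bound H (w : op H -> C) : nf w ->
  exists2 M : R, 0 <= M & forall (x : op H) (N : R), 0 <= N ->
    (forall v, nr (x v) <= N * nr v) -> ab (w x) <= M * N.
Proof.
move=> [I [u [v [hu hv h]]]]; have [M M0 hM] := asum_sqf hu hv; exists M => // x N N0 hN.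
by apply: asum_le (hM _ _ N0 hN) _; apply: h; exists N.
Qed.

Lemma nf_linear H (w : op H -> C) (a : C) (x y z : op H) : nf w -> bdd x -> bdd y ->
  (forall v, z v = a *: x v + y v) -> w z = a * w x + w y.
Proof.
move=> [I [u [v [hu hv h]]]] bx bY hz.
have bz : bdd z.
  have -> : (z : H -> H) = (fun v => a *: x v + y v) by exact/funext.
  exact: bdd_comb.
apply: hsum_unique (h _ bz) _.
apply: eq_hsum (hsumD (hsumZ a (h _ bx)) (h _ bY)) => i /=.
by rewrite hz ipDl ipZl.
Qed.

Lemma bdd0 H K : bdd (fun _ : H => 0 : K).
Proof. by exists 0 => // v; rewrite nr0 mul0r. Qed.

Lemma nf_0 H (w : op H -> C) (z : op H) : nf w -> (forall v, z v = 0) -> w z = 0.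
Proof.
move=> nw hz.
have bz : bdd z by exists 0 => // v; rewrite hz nr0 mul0r.
have := nf_linear (a := -1) nw bz bz (z := z).
by rewrite mulN1r addNr; apply=> v; rewrite hz scaler0 addr0.
Qed.

Lemma nf_scale H (w : op H -> C) (a : C) (x z : op H) : nf w -> bdd x ->
  (forall v, z v = a *: x v) -> w z = a * w x.
Proof.
move=> nw bx hz; have b0 := @bdd0 H H.
rewrite (@nf_linear _ w a x \0 z nw bx b0) ?(nf_0 (z := \0) nw) ?addr0//.
by move=> v; rewrite addr0.
Qed.

Lemma nf_add H (w : op H -> C) (x y z : op H) : nf w -> bdd x -> bdd y ->
  (forall v, z v = x v + y v) -> w z = w x + w y.
Proof.
move=> nw bx bY hz; rewrite (nf_linear (a := 1) nw bx bY) ?mul1r// => v.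
by rewrite hz scale1r.
Qed.

Lemma nf_vec H (u v : H) : nf (fun x : op H => '<x u, v>).
Proof.
exists unit, (fun=> u), (fun=> v); split; try exact: sqf_const.
move=> x _; have := @hsum1 R unit (fun=> '<x u, v>) tt; apply.
by case.
Qed.

Lemma nf_mulr H (w : op H -> C) (b : op H) : bdd b -> nf w -> nf (fun x => w (x \o b)).
Proof.
move=> bb [I [u [v [hu hv h]]]]; exists I, (b \o u), v; split => //.
  exact: sqf_bdd.
by move=> x bx; exact: (h _ (bdd_comp bx bb)).
Qed.

Lemma nf_mull H (w : op H -> C) (b : op H) : bdd b -> nf w -> nf (fun x => w (b \o x)).
Proof.
move=> bb [I [u [v [hu hv h]]]]; exists I, u, (adj b \o v); split => //.
  exact: sqf_bdd (bdd_adj b) hv.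
move=> x bx; apply: eq_hsum (h _ (bdd_comp bb bx)) => i /=.
by rewrite adjP.
Qed.

Lemma sum_imfset (I J : choiceType) (V : nmodType) (f : I -> J) (A : {fset I}) (c : J -> V) :
  injective f -> \sum_(z <- [fset f x | x in A]%fset) c z = \sum_(i <- A) c (f i).
Proof. by move=> fi; rewrite big_imfset// => x y _ _ /fi. Qed.

Lemma fset_sumtype (I J : choiceType) (B : {fset (I + J)%type}) :
  exists (B1 : {fset I}) (B2 : {fset J}),
    [/\ forall x, (x \in B1) = (inl x \in B), forall x, (x \in B2) = (inr x \in B) &
        forall (V : nmodType) (c : I + J -> V), \sum_(i <- B) c i =
          \sum_(i <- B1) c (inl i) + \sum_(i <- B2) c (inr i)].
Proof.
pose B1 := [fset x in pmap (fun z : I + J => if z is inl x then Some x else None) B]%fset.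
pose B2 := [fset x in pmap (fun z : I + J => if z is inr x then Some x else None) B]%fset.
have m1 x : (x \in B1) = (inl x \in B).
  rewrite !inE mem_pmap; apply/mapP/idP => [[[y|y] yB //= [->]]//|xB].
  by exists (inl x).
have m2 x : (x \in B2) = (inr x \in B).
  rewrite !inE mem_pmap; apply/mapP/idP => [[[y|y] yB //= [->]]//|xB].
  by exists (inr x).
exists B1, B2; split => // V c.
rewrite (big_fsetID _ (fun z : I + J => if z is inl _ then true else false)) /=.
congr (_ + _).
  have -> : \sum_(i <- B1) c (inl i) = \sum_(z <- [fset inl x | x in B1]%fset) c z.
    by rewrite sum_imfset// => x y [].
  apply: eq_fbigl => -[x|x]; rewrite !inE /= ?andbT ?andbF.
    by apply/idP/imfsetP => [xB|[y /= yB [->]]]; [exists x; rewrite //= m1|rewrite -m1].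
  by apply/esym/negbTE/imfsetP => -[].
have -> : \sum_(i <- B2) c (inr i) = \sum_(z <- [fset inr x | x in B2]%fset) c z.
  by rewrite sum_imfset// => x y [].
apply: eq_fbigl => -[x|x]; rewrite !inE /= ?andbT ?andbF.
  by apply/esym/negbTE/imfsetP => -[].
by apply/idP/imfsetP => [xB|[y /= yB [->]]]; [exists x; rewrite //= m2|rewrite -m2].
Qed.

Lemma hsum_sumtype (I J : choiceType) (c : I + J -> C) s t :
  hsum (c \o inl) s -> hsum (c \o inr) t -> hsum c (s + t).
Proof.
move=> hs ht e e0; have e2 : 0 < e / 2 by rewrite divr_gt0.
have [A1 h1] := hs _ e2; have [A2 h2] := ht _ e2.
exists ([fset inl x | x in A1] `|` [fset inr x | x in A2])%fset => B AB.
have [B1 [B2 [m1 m2 ->]]] := fset_sumtype B.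
have {}h1 : ab (\sum_(i <- B1) c (inl i) - s) < e / 2.
  apply: h1; apply/fsubsetP => x xA; rewrite m1; apply: (fsubsetP AB).
  by rewrite inE; apply/orP; left; apply/imfsetP; exists x.
have {}h2 : ab (\sum_(i <- B2) c (inr i) - t) < e / 2.
  apply: h2; apply/fsubsetP => x xA; rewrite m2; apply: (fsubsetP AB).
  by rewrite inE; apply/orP; right; apply/imfsetP; exists x.
set X := \sum_(i <- B1) _ in h1 *; set Y := \sum_(i <- B2) _ in h2 *.
have -> : X + Y - (s + t) = (X - s) + (Y - t) by ring.
have := ler_abD (X - s) (Y - t); lra.
Qed.

Definition sumf (I J : Type) (V : Type) (u : I -> V) (v : J -> V) (z : I + J) : V :=
  match z with inl i => u i | inr j => v j end.

Lemma sqf_sum H (I J : choiceType) (u : I -> H) (v : J -> H) :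
  sqf u -> sqf v -> sqf (sumf u v).
Proof.
move=> [M M0 hM] [N N0 hN]; exists (M + N); first exact: addr_ge0.
move=> A; have [A1 [A2 [_ _ ->]]] /= := fset_sumtype A.
apply: le_trans (lerD (hM A1) (hN A2)) _; rewrite sqrrD.
have := mulr_ge0 M0 N0; rewrite mulr2n; lra.
Qed.

Lemma nfD H (w w' : op H -> C) : nf w -> nf w' -> nf (fun x => w x + w' x).
Proof.
move=> [I [u [v [hu hv h]]]] [J [u' [v' [hu' hv' h']]]].
exists (I + J)%type, (sumf u u'), (sumf v v'); split; try exact: sqf_sum.
by move=> x bx; apply: hsum_sumtype; [exact: h|exact: h'].
Qed.

Lemma bddZ H (a : C) : bdd (fun v : H => a *: v).
Proof. by exists (ab a); [exact: ab_ge0|move=> v; rewrite nrZ]. Qed.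

Lemma nfZ H (a : C) (w : op H -> C) : nf w -> nf (fun x => a * w x).
Proof.
move=> [I [u [v [hu hv h]]]]; exists I, u, (fun i => conjc a *: v i); split => //.
  exact: (sqf_bdd (@bddZ _ (conjc a))).
move=> x bx; apply: eq_hsum (hsumZ a (h _ bx)) => i.
by rewrite ipZr conjcK.
Qed.

Lemma nfB H (w w' : op H -> C) : nf w -> nf w' -> nf (fun x => w x - w' x).
Proof.
move=> nw /(nfZ (-1)) nw'; have := nfD nw nw'; congr nf.
by apply/funext => x; rewrite mulN1r.
Qed.

Lemma sqf_series H (u : nat -> H) :
  cvgn (series (fun n => complex.Re '<u n, u n>)) -> sqf u.
Proof.
move=> cu; pose l := limn (series (fun n => complex.Re '<u n, u n>)).
have nd : nondecreasing_seq (series (fun n => complex.Re '<u n, u n>)).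
  by apply: nondecreasing_series => n _ _; rewrite -sqr_nr sqr_ge0.
exists (l + 1).
  rewrite addr_ge0//; apply: limr_ge => //; apply: nearW => n.
  by rewrite sumr_ge0// => i _; rewrite -sqr_nr sqr_ge0.
have l0 : 0 <= l.
  by apply: limr_ge => //; apply: nearW => n; rewrite sumr_ge0// => i _; rewrite -sqr_nr sqr_ge0.
move=> A; apply: (@le_trans _ _ l); last by rewrite sqrrD expr1n mulr1; have := sqr_ge0 l; rewrite mulr2n; lra.
have [n hn] : exists n, forall i, i \in A -> (i < n)%N.
  by exists (\max_(i <- A) i).+1 => i iA; rewrite ltnS (big_rem i)//= leq_maxl.
apply: (@le_trans _ _ (series (fun n => complex.Re '<u n, u n>) n)); last exact: nondecreasing_cvgn_le.
have As : (A `<=` [fset i in iota 0 n])%fset.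
  by apply/fsubsetP => i iA; rewrite !inE mem_iota /= add0n hn.
apply: le_trans (ler_sum_fset (f := fun i => nr (u i) ^+ 2) (fun=> sqr_ge0 _) As) _.
rewrite /series /= /index_iota subn0.
under [leRHS]eq_bigr do rewrite -sqr_nr.
rewrite le_eqVlt; apply/orP; left; apply/eqP; apply: perm_big; apply: uniq_perm.
- exact: fset_uniq.
- exact: iota_uniq.
- by move=> i; rewrite !inE.
Qed.

(** A member of the predual is constrained on [M] only. Its representing vectors define a functional
    on all bounded operators, which can then be used without reference to [M]. *)
Lemma predual_nf H (M : set (op H)) (w : op H -> C) :
  (forall x, M x -> bdd x) -> predual M w ->
  exists2 w', nf w' & forall x, M x -> w' x = w x.
Proof.
move=> bM [u [v [/sqf_series hu /sqf_series hv h]]].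
have [w' [_ _ hw']] := rep_exists hu hv.
exists w' => [|x Mx]; first by exists nat, u, v.
apply: nat_hsum (hw' _ (bM _ Mx)) _ => e e0.
have := h _ Mx => /cvgrPdist_lt /(_ e%:C).
rewrite ltcE /= eqxx e0 => /(_ isT) [N _ hN]; exists N => n Nn.
by have := hN n Nn; rewrite /= distrC normr_ab ltcE /= eqxx.
Qed.

Lemma nf_predual H (M : set (op H)) (w : op H -> C) :
  (forall x, M x -> bdd x) -> nf w -> predual M w.
Proof.
move=> bM [I [u [v [hu hv h]]]].
pose ext (u : I -> H) (n : nat) := if @pickle_inv I n is Some i then u i else 0.
have cv f : sqf f -> cvgn (series (fun n => complex.Re '<ext f n, ext f n>)).
  move=> [N N0 hN]; apply: nondecreasing_is_cvgn.
    by apply: nondecreasing_series => n _ _; rewrite -sqr_nr sqr_ge0.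
  exists (N ^+ 2) => _ [n _ <-]; rewrite /series /=.
  rewrite [leLHS](_ : _ = \sum_(0 <= k < n)
      (if @pickle_inv I k is Some i then nr (f i) ^+ 2 else 0)).
    by rewrite pickle_sum.
  apply: eq_bigr => k _; rewrite -sqr_nr /ext; case: pickle_inv => //.
  by rewrite nr0 expr0n.
exists (ext u), (ext v); split; [exact: cv|exact: cv|].
move=> x Mx; apply/cvgrPdist_lt => e; rewrite ltcE /= => /andP[/eqP ie e0].
have [N hN] := hsum_nat (h _ (bM _ Mx)) e0; exists N => // n /= /hN.
rewrite distrC normr_ab ltcE /= ie eqxx /= /series /=.
congr (ab (_ - _) < _); apply: eq_bigr => k _; rewrite /ext; case: pickle_inv => //.
by rewrite ip0r.
Qed.

End NormalFunctionals.

(** * Tensor products and slice maps *)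

Section Tensors.
Variable R : realType.
Local Notation C := R[i].
Implicit Types H K W V : hilbertType R.

(** Abstracted from [T] so that exchanging the two legs gives another instance; results on the first
    leg then carry over to the second. *)
Definition istens K H W (t : K -> H -> W) :=
  [/\ forall h, linear (t^~ h), forall k, linear (t k),
      forall k k' h h', '<t k h, t k' h'> = '<k, k'> * '<h, h'> &
      forall z, (forall k h, '<z, t k h> = 0) -> z = 0].

Lemma istens_flip K H W (t : K -> H -> W) : istens t -> istens (fun h k => t k h).
Proof. by case=> h1 h2 h3 h4; split => // [*|z hz]; [rewrite h3 mulrC|exact: h4]. Qed.

Lemma istens_tens (T : hilbert_tensor R) K H : istens (@tens R T K H).
Proof.
split; [exact: tens_linearl|exact: tens_linearr|exact: tens_inner|].
move=> z hz; apply: nr_eq0; apply/eqP; rewrite eq_le nr_ge0 andbT; apply: ler_eps => d d0.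
have [y [hy [n [k [h yE]]]]] : (ball z d%:C `&` [set z : T K H | exists n (k : 'I_n -> K)
    (h : 'I_n -> H), z = \sum_(i < n) tens T (k i) (h i)]) !=set0.
  apply: (@tens_dense R T K H); last exact: ball_open.
  by exists z; apply: ballxx; rewrite ltcE /= eqxx.
move: hy; rewrite -ball_normE /= normr_nr ltcE /= eqxx /= => hy.
rewrite add0r; apply: le_trans (ltW hy).
rewrite -(@ler_pXn2r _ 2%N) ?nnegrE ?nr_ge0//.
have zy : '<z, y> = 0 by rewrite yE ip_sumr big1.
rewrite sqr_nrB zy.
by rewrite /= mul0rn subr0 lerDl sqr_ge0.
Qed.

Section OneTensor.
Variables (K H W : hilbertType R) (t : K -> H -> W).
Hypothesis ht : istens t.

Lemma t_ip k k' h h' : '<t k h, t k' h'> = '<k, k'> * '<h, h'>.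
Proof. by case: ht. Qed.

Lemma t_total z : (forall k h, '<z, t k h> = 0) -> z = 0.
Proof. by case: ht => _ _ _; exact. Qed.

Lemma t_ext z z' : (forall k h, '<z, t k h> = '<z', t k h>) -> z = z'.
Proof.
move=> h; apply/eqP; rewrite -subr_eq0; apply/eqP; apply: t_total => k l.
by rewrite ipBl h subrr.
Qed.

Lemma nr_t k h : nr (t k h) = nr k * nr h.
Proof.
apply/eqP; rewrite -(@eqrXn2 _ 2%N) ?mulr_ge0 ?nr_ge0//; apply/eqP.
by rewrite sqr_nr t_ip !ipvv -rmorphM /= exprMn.
Qed.

Lemma t_lin_l h : linear (t^~ h).
Proof. by case: ht. Qed.
Lemma t_lin_r k : linear (t k).
Proof. by case: ht. Qed.

(* [Rr h] is [k |-> k (x) h] and [RrA h] its adjoint. *)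
Definition Rr (h : H) : {linear K -> W} := mklin (t_lin_l h).

Lemma tZl a k h : t (a *: k) h = a *: t k h.
Proof. exact: (linearZ_LR (Rr h)). Qed.

Lemma bdd_Rr h : bdd (Rr h).
Proof. by exists (nr h); [exact: nr_ge0|move=> k; rewrite /= nr_t mulrC]. Qed.

Definition RrA (h : H) : {linear W -> K} := adj (Rr h).

Lemma RrAP h z k : '<RrA h z, k> = '<z, t k h>.
Proof. exact: adjP' (bdd_Rr h). Qed.

Lemma RrA_nr h z : nr (RrA h z) <= nr h * nr z.
Proof.
apply: nr_le_ip; first by rewrite mulr_ge0 ?nr_ge0.
move=> k; rewrite RrAP; apply: le_trans (CS _ _) _; rewrite nr_t.
have -> : nr z * (nr k * nr h) = nr h * nr z * nr k by ring.
exact: lexx.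
Qed.

Lemma bdd_RrA h : bdd (RrA h).
Proof. exact: bdd_adj. Qed.

Lemma RrA_t h h' k : RrA h (t k h') = '<h', h> *: k.
Proof. by apply: ip_ext => k'; rewrite RrAP t_ip ipZl mulrC. Qed.

Lemma RrA_comb a h h' z : RrA (a *: h + h') z = conjc a *: RrA h z + RrA h' z.
Proof.
by apply: ip_ext => k; rewrite ipDl ipZl !RrAP t_lin_r ipDr ipZr.
Qed.

(** [p] is the projection of [z] onto the span of the [k (x) f i]: both [<z, p>] and [|p|^2] equal
    the sum on the left, and Cauchy-Schwarz gives [|p| <= |z|]. *)
Lemma RrA_bessel (I : choiceType) (f : I -> H) (A : {fset I}) z : onf f ->
  \sum_(i <- A) nr (RrA (f i) z) ^+ 2 <= nr z ^+ 2.
Proof.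
move=> hf; pose p := \sum_(i <- A) t (RrA (f i) z) (f i).
have e1 : '<z, p> = (\sum_(i <- A) nr (RrA (f i) z) ^+ 2)%:C.
  rewrite /p ip_sumr realc_sum; apply: eq_bigr => i _.
  by rewrite -RrAP ipvv.
have e2 : nr p ^+ 2 = \sum_(i <- A) nr (RrA (f i) z) ^+ 2.
  rewrite sqr_nr {1}/p ip_suml Re_sum big_seq [RHS]big_seq; apply: eq_bigr => i iA.
  rewrite /p ip_sumr (big_fsetD1 i iA) /= big1_fset ?addr0.
    case: (hf.2 i) => [h1|h0]; first by rewrite t_ip h1 mulr1 ipvv.
    rewrite h0 t_ip ip0l mulr0.
    suff -> : RrA 0 z = 0 by rewrite nr0 expr0n.
    apply: nr_eq0; apply/eqP; rewrite eq_le nr_ge0 andbT.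
    by have := RrA_nr 0 z; rewrite nr0 mul0r.
  move=> j; rewrite !inE => /andP[ji _] _.
  by rewrite t_ip hf.1 ?mulr0// eq_sym.
rewrite -e2 ler_pXn2r ?nnegrE ?nr_ge0//.
have [->|p0] := eqVneq (nr p) 0; first exact: nr_ge0.
have pp : 0 < nr p by rewrite lt_def p0 nr_ge0.
by rewrite -(ler_pM2r pp) -expr2 e2; have := Re_ip_le z p; rewrite e1.
Qed.

Definition RlA k : {linear W -> H} := adj (mklin (t_lin_r k)).

Lemma RlAP k z h : '<RlA k z, h> = '<z, t k h>.
Proof. by apply: adjP'; exists (nr k); [exact: nr_ge0|move=> x; rewrite /= nr_t]. Qed.

Lemma t_onf (I J : choiceType) (d : I -> K) (e : J -> H) : onf d -> onf e ->
  onf (fun p : J * I => t (d p.2) (e p.1)).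
Proof.
move=> od oe; split => [[i j] [i' j']|[i j]]; rewrite t_ip /=.
  rewrite xpair_eqE negb_and => /orP[ij|ij]; first by rewrite oe.1 ?mulr0.
  by rewrite od.1 ?mul0r.
case: (oe.2 i) => ei; case: (od.2 j) => dj; rewrite ?ei ?dj ?mulr1; [by left| | |];
  by right; apply: nr_eq0; rewrite nr_t !nr0 ?mul0r ?mulr0.
Qed.

Lemma t_total_family (I J : choiceType) (d : I -> K) (e : J -> H) :
  total_family d -> total_family e ->
  total_family (fun p : J * I => t (d p.2) (e p.1)).
Proof.
move=> td te y hy; apply: t_total => k h.
suff : RlA k y = 0 by rewrite -RlAP => ->; rewrite ip0l.
apply: te => i; rewrite RlAP -RrAP.
by rewrite (td (RrA (e i) y)) ?ip0l// => j; rewrite RrAP; exact: (hy (i, j)).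
Qed.

Lemma RrA_parseval (e : nat -> H) z z' : is_onb e ->
  hsum (fun i => '<RrA (e i) z, RrA (e i) z'>) '<z, z'>.
Proof.
move=> [oe te]; have [d [od td]] := onb_exists K.
have of_ := t_onf od oe; have tf := t_total_family td te.
apply: hsum_fubini (parseval of_ tf z z') _ => i.
apply: eq_hsum (parseval od td _ _) => j /=.
by rewrite !RrAP.
Qed.

(** Along a basis [e] of the second leg, [x (x) 1] acts as [x] on every component
    [z_i = RrA (e i) z]. This suggests the form [\sum_i <x z_i, z'_i>], which Bessel bounds. *)
Lemma tl_exists (x : op K) : exists X : op W, bdd X /\
  (bdd x -> forall k h, X (t k h) = t (x k) h).
Proof.
have [[M M0 hM]|nb] := pselect (bdd x); last by exists \0; split; [exact: bdd0|].
have [e he] := onb_exists H.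
have bnd z z' : asum (fun i => '<x (RrA (e i) z), RrA (e i) z'>) (M * nr z * nr z').
  move=> A; apply: (@le_trans _ _ (M * \sum_(i <- A) nr (RrA (e i) z) * nr (RrA (e i) z'))).
    rewrite mulr_sumr ler_sum// => i _; apply: le_trans (CS _ _) _.
    by rewrite mulrA ler_wpM2r ?nr_ge0.
  rewrite -mulrA ler_wpM2l// CS_sum ?nr_ge0//; try by move=> i; exact: nr_ge0.
    exact: (RrA_bessel A z he.1).
  exact: (RrA_bessel A z' he.1).
have ex (p : W * W) : exists s, hsum (fun i => '<x (RrA (e i) p.1), RrA (e i) p.2>) s.
  by apply: asum_hsum; exact: bnd.
have [B hB] := choice ex.
have [|||X bX hX] := @form_operator R W W (fun z z' => B (z, z')) M M0.
- move=> a u u' v; apply: hsum_unique (hB _) _.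
  apply: eq_hsum (hsumD (hsumZ a (hB (u, v))) (hB (u', v))) => i /=.
  by rewrite (linear_of (RrA (e i))) linear_of ipDl ipZl.
- move=> a u v v'; apply: hsum_unique (hB _) _.
  apply: eq_hsum (hsumD (hsumZ (conjc a) (hB (u, v))) (hB (u, v'))) => i /=.
  by rewrite (linear_of (RrA (e i))) ipDr ipZr.
- by move=> u v; exact: asum_le (bnd u v) (hB (u, v)).
exists X; split; first by exists M.
move=> _ k h; apply: t_ext => k' h'; rewrite hX t_ip.
apply: hsum_unique (hB (_, _)) _.
apply: eq_hsum (hsumZ '<x k, k'> (parseval he.1 he.2 h h')) => i /=.
by rewrite !RrA_t (linearZ_LR x) ipZl ipZr; ring.
Qed.

(* [x (x) 1], a junk value for unbounded [x]; [1 (x) y] is [tr y] below. *)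
Definition tl (x : op K) : op W := projT1 (cid (tl_exists x)).

Lemma bdd_tl (x : op K) : bdd (tl x).
Proof. by rewrite /tl; case: cid => X []. Qed.

Lemma tlE (x : op K) k h : bdd x -> tl x (t k h) = t (x k) h.
Proof. by rewrite /tl => bx; case: cid => X /= [_]; apply. Qed.

Lemma op_eqt V (X Y : {linear W -> V}) : bdd X -> bdd Y ->
  (forall k h, X (t k h) = Y (t k h)) -> X = Y.
Proof.
move=> bX bY h; apply: op_ext => z; apply: ip_ext => v.
rewrite !adjP//; congr '<_, _>; apply: t_ext => k l.
by rewrite !adjP'// h.
Qed.

Lemma tlM (x y : op K) : bdd x -> bdd y -> tl (x \o y) = tl x \o tl y :> op W.
Proof.
move=> bx bY; apply: op_eqt; [exact: bdd_tl|exact: bdd_comp (bdd_tl _) (bdd_tl _)|].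
by move=> k h /=; rewrite !tlE//; exact: bdd_comp.
Qed.

Lemma tl_id (x : op K) : x =1 id -> tl x = idop W.
Proof.
move=> xi; apply: op_eqt; [exact: bdd_tl|exact: bdd_id|] => k h.
rewrite tlE ?xi//; have -> : (x : K -> K) = idfun by apply/funext.
exact: bdd_id.
Qed.

Lemma adj_eq H1 H2 (x : {linear H1 -> H2}) (y : {linear H2 -> H1}) : bdd x ->
  (forall u v, '<x u, v> = '<u, y v>) -> adj x = y.
Proof.
move=> bx h; apply: op_ext => v; apply: ip_ext => u.
by rewrite adjP'// ipC h -ipC.
Qed.

Lemma adj_tl (x : op K) : bdd x -> adj (tl x) = tl (adj x).
Proof.
move=> bx; apply: op_eqt; [exact: bdd_adj|exact: bdd_tl|] => k h.
apply: t_ext => k' h'; rewrite adjP'; last exact: bdd_tl.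
rewrite !tlE//; last exact: bdd_adj.
by rewrite !t_ip adjP'.
Qed.

Lemma RrA_tl (x : op K) h z : bdd x -> RrA h (tl x z) = x (RrA h z).
Proof.
move=> bx; apply: ip_ext => k; rewrite RrAP (adjP _ _ (bdd_tl x)) (adjP _ _ bx).
by rewrite adj_tl// tlE ?RrAP//; exact: bdd_adj.
Qed.

(* The slice [(id (x) <. xi, eta>)(Z)]. *)
Definition rs (xi eta : H) (Z : op W) : op K := RrA eta \o Z \o Rr xi.

Lemma rsP xi eta (Z : op W) k k' : '<rs xi eta Z k, k'> = '<Z (t k xi), t k' eta>.
Proof. by rewrite /rs /= RrAP. Qed.

Lemma bdd_rs xi eta (Z : op W) : bdd Z -> bdd (rs xi eta Z).
Proof. by move=> bZ; apply: bdd_comp (bdd_comp (bdd_RrA _) bZ) (bdd_Rr _). Qed.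

Lemma Sl_exists (w : op K -> C) (Z : op W) : exists S : op H, bdd S /\
  (nf w -> bdd Z -> forall xi eta, '<S xi, eta> = w (rs xi eta Z)).
Proof.
have [[nw bZ]|nb] := pselect (nf w /\ bdd Z); last first.
  by exists \0; split; [exact: bdd0|move=> nw bZ; exfalso; apply: nb].
have [M M0 hM] := nf_bound nw; have [N N0 hN] := bZ.
have [||||S bS hS] := @form_operator R H H (fun xi eta => w (rs xi eta Z)) (M * N).
- exact: mulr_ge0.
- move=> a u u' v; apply: nf_linear => //; try exact: bdd_rs.
  by move=> k; rewrite /rs /= t_lin_r !linear_of.
- move=> a u v v'; apply: nf_linear => //; try exact: bdd_rs.
  by move=> k; rewrite /rs /= RrA_comb.
- move=> u v; have := hM (rs u v Z) (N * nr u * nr v); rewrite !mulrA; apply.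
    by rewrite !mulr_ge0 ?nr_ge0.
  move=> k; rewrite /rs /=; apply: le_trans (RrA_nr _ _) _.
  have := hN (t k u); rewrite nr_t => h.
  have -> : N * nr u * nr v * nr k = nr v * (N * (nr k * nr u)) by ring.
  by rewrite ler_wpM2l ?nr_ge0.
exists S; split => //; exists (M * N) => //; exact: mulr_ge0.
Qed.

(* The slice [(w (x) id)(Z)]; a junk value unless [nf w] and [bdd Z]. *)
Definition Sl (w : op K -> C) (Z : op W) : op H := projT1 (cid (Sl_exists w Z)).

Lemma bdd_Sl w (Z : op W) : bdd (Sl w Z).
Proof. by rewrite /Sl; case: cid => X []. Qed.

Lemma SlP w (Z : op W) xi eta : nf w -> bdd Z -> '<Sl w Z xi, eta> = w (rs xi eta Z).
Proof. by rewrite /Sl => nw bZ; case: cid => X /= [_]; apply. Qed.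

Lemma Sl_ext w w' (Z Z' : op W) : nf w -> nf w' -> bdd Z -> bdd Z' ->
  (forall xi eta, w (rs xi eta Z) = w' (rs xi eta Z')) -> Sl w Z = Sl w' Z'.
Proof.
move=> nw nw' bZ bZ' h; apply: op_ext => xi; apply: ip_ext => eta.
by rewrite !SlP.
Qed.

Lemma Sl_elem w (x : op K) (y : op H) (Z : op W) : nf w -> bdd x -> bdd Z ->
  (forall k h, Z (t k h) = t (x k) (y h)) -> forall v, Sl w Z v = w x *: y v.
Proof.
move=> nw bx bZ h v; apply: ip_ext => eta; rewrite SlP// ipZl mulrC.
apply: nf_scale => // k; apply: ip_ext => k'.
by rewrite rsP h t_ip ipZl mulrC.
Qed.

Lemma sqf_t (I J : choiceType) (u : I -> K) (u' : J -> H) :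
  sqf u -> sqf u' -> sqf (fun p : J * I => t (u p.2) (u' p.1)).
Proof.
move=> [M M0 hM] [N N0 hN]; exists (M * N); first exact: mulr_ge0.
move=> A; pose B := ([fset x.1 | x in A] `*` [fset x.2 | x in A])%fset.
have AB : (A `<=` B)%fset.
  apply/fsubsetP => -[j i] jA; rewrite in_fsetM; apply/andP.
  by split; apply/imfsetP; exists (j, i).
apply: le_trans (ler_sum_fset _ AB) _; first by move=> p; exact: sqr_ge0.
rewrite /B sum_prodset exprMn [leRHS]mulrC.
apply: le_trans (_ : (\sum_(j <- [fset x.1 | x in A]%fset) nr (u' j) ^+ 2) * M ^+ 2 <= _); last first.
  by rewrite ler_wpM2r ?sqr_ge0.
rewrite mulr_suml ler_sum// => j _ /=.
under eq_bigr do rewrite nr_t exprMn mulrC.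
by rewrite -mulr_sumr ler_wpM2l ?sqr_ge0.
Qed.

(* The product functional [w (x) kappa]. *)
Definition pf (w : op K -> C) (kappa : op H -> C) (Z : op W) : C := kappa (Sl w Z).

(** The double family of tensors is absolutely summable by itself, so Fubini identifies its sum with
    the iterated one that computes [kappa (Sl w Z)]. *)
Lemma pf_rep (w : op K -> C) (kappa : op H -> C) (I J : choiceType) u v u' v' :
  nf w -> rep w (I := I) u v -> rep kappa (I := J) u' v' ->
  rep (pf w kappa) (fun p : J * I => t (u p.2) (u' p.1)) (fun p : J * I => t (v p.2) (v' p.1)).
Proof.
move=> nw [hu hv h] [hu' hv' h']; split; try exact: sqf_t.
move=> Z bZ; have [q [_ _ hq]] := rep_exists (sqf_t hu hu') (sqf_t hv hv').
suff -> : pf w kappa Z = q Z by exact: hq.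
apply: hsum_unique (h' _ (bdd_Sl _ _)) _.
apply: hsum_fubini (hq _ bZ) _ => j /=; rewrite SlP//.
apply: eq_hsum (h _ (bdd_rs _ _ bZ)) => i /=.
by rewrite rsP.
Qed.

Lemma nf_pf w kappa : nf w -> nf kappa -> nf (pf w kappa).
Proof.
move=> nw nk; have [I [u [v h]]] := nw; have [J [u' [v' h']]] := nk.
exists (J * I)%type, (fun p => t (u p.2) (u' p.1)), (fun p => t (v p.2) (v' p.1)).
exact: (pf_rep nw h h').
Qed.

Lemma pf_elem w kappa (x : op K) (y : op H) (Z : op W) : nf w -> nf kappa ->
  bdd x -> bdd y -> bdd Z ->
  (forall k h, Z (t k h) = t (x k) (y h)) -> pf w kappa Z = w x * kappa y.
Proof.
move=> nw nk bx bY bZ h; rewrite /pf; apply: (nf_scale nk bY) => v; exact: Sl_elem.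
Qed.

(** Each representing vector [u i] is split into its components [RrA (e j) (u i)]; these represent
    the restriction of [w] to the first leg. *)
Lemma nf_tl (w : op W -> C) : nf w -> nf (fun x => w (tl x)).
Proof.
move=> [I [u [v [hu hv h]]]]; have [e he] := onb_exists H.
pose f (u : I -> W) (p : I * nat) := RrA (e p.2) (u p.1).
have sf u0 : sqf u0 -> sqf (f u0).
  move=> [M M0 hM]; exists M => // A.
  pose B := ([fset x.1 | x in A] `*` [fset x.2 | x in A])%fset.
  have AB : (A `<=` B)%fset.
    apply/fsubsetP => -[j i] jA; rewrite in_fsetM; apply/andP.
    by split; apply/imfsetP; exists (j, i).
  apply: le_trans (ler_sum_fset _ AB) _; first by move=> p; exact: sqr_ge0.
  rewrite /B sum_prodset; apply: le_trans (hM [fset x.1 | x in A]%fset).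
  by rewrite ler_sum// => i _; exact: (RrA_bessel _ (u0 i) he.1).
exists (I * nat)%type, (f u), (f v); split; try exact: sf.
move=> x bx; have [q [_ _ hq]] := rep_exists (sf _ hu) (sf _ hv).
suff -> : w (tl x) = q x by exact: hq.
apply: hsum_unique (h _ (bdd_tl x)) _.
apply: hsum_fubini (hq _ bx) _ => i /=.
apply: eq_hsum (RrA_parseval (tl x (u i)) (v i) he) => j /=.
by rewrite RrA_tl.
Qed.

End OneTensor.

End Tensors.

(** * The double commutant *)

Section Density.
Variable R : realType.
Local Notation C := R[i].
Implicit Types H K W V : hilbertType R.

Lemma kb_linear H (xi eta : H) : linear (fun v : H => '<v, eta> *: xi).
Proof. by move=> a u v; rewrite ipDl ipZl scalerDl scalerA. Qed.

(** The rank-one operator [xi eta^*], where [eta^*] is the functional [<., eta>]. *)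
Definition kb H (xi eta : H) : op H := mklin (kb_linear xi eta).

Lemma bdd_kb H (xi eta : H) : bdd (kb xi eta).
Proof.
exists (nr eta * nr xi); first by rewrite mulr_ge0 ?nr_ge0.
move=> v; rewrite /= nrZ mulrAC ler_wpM2r ?nr_ge0// mulrC.
exact: CS.
Qed.

Lemma comp_kb H (b : op H) (xi eta : H) : b \o kb xi eta = kb (b xi) eta :> op H.
Proof. by apply: op_ext => v /=; rewrite (linearZ_LR b). Qed.

Lemma kb_comp H (b : op H) (xi eta : H) : bdd b ->
  kb xi eta \o b = kb xi (adj b eta) :> op H.
Proof. by move=> bb; apply: op_ext => v /=; rewrite adjP. Qed.

Lemma adj_kb H (xi eta : H) : adj (kb xi eta) = kb eta xi.
Proof.
apply: adj_eq => [|u v /=]; first exact: bdd_kb.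
by rewrite ipZl ipZr -ipC mulrC.
Qed.

Lemma hsum_swap (I J : choiceType) (c : I * J -> C) s :
  hsum c s -> hsum (fun p : J * I => c (p.2, p.1)) s.
Proof.
move=> h e /h [A hA]; exists [fset (p.2, p.1) | p in A]%fset => B AB.
have := hA [fset (p.2, p.1) | p in B]%fset.
rewrite sum_imfset; last by move=> [? ?] [? ?] [-> ->].
apply; apply/fsubsetP => -[i j] ijA; apply/imfsetP; exists (j, i) => //=.
by apply: (fsubsetP AB); apply/imfsetP; exists (i, j).
Qed.

Lemma asum_subset (I : choiceType) (c : I -> C) (M : R) :
  (forall A : {fset I}, exists2 B : {fset I}, (A `<=` B)%fset & \sum_(i <- B) ab (c i) <= M) ->
  asum c M.
Proof.
move=> h A; have [B AB hB] := h A; apply: le_trans hB.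
by apply: ler_sum_fset => // i; exact: ab_ge0.
Qed.

Lemma fset_sub_prod (I J : choiceType) (A : {fset I * J}) :
  (A `<=` [fset x.1 | x in A] `*` [fset x.2 | x in A])%fset.
Proof.
apply/fsubsetP => -[j i] jA; rewrite in_fsetM; apply/andP.
by split; apply/imfsetP; exists (j, i).
Qed.

(** Normality in the form in which it is mostly used: [1] is the sum of the [kb (e i) (e i)]. The
    family [<u j, e i> <e i, v j>] is absolutely summable by Cauchy-Schwarz and Bessel, so the two
    summations may be exchanged. *)
Lemma nf_onb_sum H (kappa : op H -> C) (e : nat -> H) : nf kappa -> is_onb e ->
  hsum (fun i => kappa (kb (e i) (e i))) (kappa (idop H)).
Proof.
move=> [J [u [v [hu hv h]]]] [oe te].
pose c (p : nat * J) := '<u p.2, e p.1> * '<e p.1, v p.2>.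
have [M M0 hM] := hu; have [N N0 hN] := hv.
have [S hS] : exists S, hsum c S.
  apply: (@asum_hsum _ _ c (M * N)); apply: asum_subset => A.
  exists ([fset x.1 | x in A] `*` [fset x.2 | x in A])%fset; first exact: fset_sub_prod.
  rewrite sum_prodset exchange_big /=.
  apply: le_trans (_ : \sum_(j <- [fset x.2 | x in A]%fset) nr (u j) * nr (v j) <= _); last first.
    by rewrite CS_sum//; try by move=> i; exact: nr_ge0.
  rewrite ler_sum// => j _; rewrite /c /=; under eq_bigr do rewrite abM.
  rewrite CS_sum ?nr_ge0//; try by move=> i; exact: ab_ge0.
    exact: bessel.
  by under eq_bigr do rewrite ipC abJ; exact: bessel.
have e1 : kappa (idop H) = S.
  apply: hsum_unique (h _ (@bdd_id _ H)) _.
  apply: hsum_fubini (hsum_swap hS) _ => j /=.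
  by apply: eq_hsum (parseval oe te (u j) (v j)) => i; rewrite /c /= -ipC.
rewrite e1; apply: hsum_fubini hS _ => i.
apply: eq_hsum (h _ (bdd_kb (e i) (e i))) => j /=.
by rewrite /c /= ipZl.
Qed.

Lemma nf_kb0 H (kappa : op H -> C) (b : op H) : nf kappa -> bdd b ->
  (forall xi eta, kappa (kb xi eta) = 0) -> kappa b = 0.
Proof.
move=> nk bb h; have [e he] := onb_exists H.
have -> : b = b \o idop H :> op H by apply: op_ext.
apply: hsum_unique (nf_onb_sum (nf_mull bb nk) he) _.
by apply: eq_hsum (@hsum0 _ _) => i; rewrite comp_kb h.
Qed.

Lemma nf_kb_ext H (kappa kappa' : op H -> C) (b : op H) : nf kappa -> nf kappa' -> bdd b ->
  (forall xi eta, kappa (kb xi eta) = kappa' (kb xi eta)) -> kappa b = kappa' b.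
Proof.
move=> nk nk' bb h; apply/eqP; rewrite -subr_eq0; apply/eqP.
by apply: (nf_kb0 (nfB nk nk') bb) => xi eta; rewrite h subrr.
Qed.

Section TwoSided.
Variables (K H W : hilbertType R) (t : K -> H -> W) (ht : istens t).

Definition tr (y : op H) : op W := tl (istens_flip ht) y.

Lemma bdd_tr (y : op H) : bdd (tr y).
Proof. exact: bdd_tl. Qed.
Lemma trE (y : op H) k h : bdd y -> tr y (t k h) = t k (y h).
Proof. by move=> b; exact: (tlE (istens_flip ht)). Qed.
Lemma trM (x y : op H) : bdd x -> bdd y -> tr (x \o y) = tr x \o tr y :> op W.
Proof. exact: tlM. Qed.
Lemma tr_id (x : op H) : x =1 id -> tr x = idop W.
Proof. exact: tl_id. Qed.
Lemma adj_tr (x : op H) : bdd x -> adj (tr x) = tr (adj x).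
Proof. exact: adj_tl. Qed.
Lemma nf_tr (w : op W -> C) : nf w -> nf (fun x => w (tr x)).
Proof. exact: nf_tl. Qed.

Lemma tl_tr (x : op K) (y : op H) : bdd x -> bdd y ->
  tl ht x \o tr y = tr y \o tl ht x :> op W.
Proof.
move=> bx bY; apply: (op_eqt ht).
- exact: bdd_comp (bdd_tl _ _) (bdd_tr _).
- exact: bdd_comp (bdd_tr _) (bdd_tl _ _).
- by move=> k h /=; rewrite trE// !tlE// trE.
Qed.

Lemma tl_trE (x : op K) (y : op H) v : bdd x -> bdd y ->
  tl ht x (tr y v) = tr y (tl ht x v).
Proof. by move=> bx bY; have /(congr1 (fun f : op W => f v)) := tl_tr bx bY. Qed.

(** Here and in the next three lemmas: slicing the first leg is a bimodule map over operators on the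
    second leg, while factors on the first leg are absorbed into the functional. *)
Lemma Sl_trr (w : op K -> C) (Z : op W) (b : op H) : nf w -> bdd Z -> bdd b ->
  Sl ht w (Z \o tr b) = Sl ht w Z \o b :> op H.
Proof.
move=> nw bZ bb; apply: op_ext => xi; apply: ip_ext => eta.
rewrite (SlP ht _ _ nw (bdd_comp bZ (bdd_tr b))) /= SlP//.
by congr w; apply: op_ext => k; rewrite /rs /= trE.
Qed.

Lemma Sl_trl (w : op K -> C) (Z : op W) (b : op H) : nf w -> bdd Z -> bdd b ->
  Sl ht w (tr b \o Z) = b \o Sl ht w Z :> op H.
Proof.
move=> nw bZ bb; apply: op_ext => xi; apply: ip_ext => eta.
rewrite (SlP ht _ _ nw (bdd_comp (bdd_tr b) bZ)) /= adjP// SlP//.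
congr w; apply: op_ext => k; apply: ip_ext => k'; rewrite !rsP /= adjP; last exact: bdd_tr.
by rewrite adj_tr// trE//; exact: bdd_adj.
Qed.

Lemma Sl_tlr (w : op K -> C) (Z : op W) (x : op K) : nf w -> bdd Z -> bdd x ->
  Sl ht w (Z \o tl ht x) = Sl ht (fun y => w (y \o x)) Z.
Proof.
move=> nw bZ bx; apply: Sl_ext => //; first exact: nf_mulr.
  exact: bdd_comp bZ (bdd_tl _ _).
by move=> xi eta; congr w; apply: op_ext => k; rewrite /rs /= tlE.
Qed.

Lemma Sl_tll (w : op K -> C) (Z : op W) (x : op K) : nf w -> bdd Z -> bdd x ->
  Sl ht w (tl ht x \o Z) = Sl ht (fun y => w (x \o y)) Z.
Proof.
move=> nw bZ bx; apply: Sl_ext => //; first exact: nf_mull.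
  exact: bdd_comp (bdd_tl _ _) bZ.
by move=> xi eta; congr w; apply: op_ext => k; rewrite /rs /= RrA_tl.
Qed.

Lemma pf_tltr (w : op K -> C) (kappa : op H -> C) (x : op K) (y : op H) :
  nf w -> nf kappa -> bdd x -> bdd y -> pf ht w kappa (tl ht x \o tr y) = w x * kappa y.
Proof.
move=> nw nk bx bY; apply: pf_elem => //; first exact: bdd_comp (bdd_tl _ _) (bdd_tr _).
by move=> k h /=; rewrite trE// tlE.
Qed.

End TwoSided.

Lemma infinite_orthonormal H (e : nat -> H) : is_onb e ->
  (exists N, forall i, (N <= i)%N -> e i = 0) \/
  (exists f : nat -> H, forall i j, '<f i, f j> = (i == j)%:R).
Proof.
move=> [oe te]; have [fin|inf] := pselect (exists N, forall i, (N <= i)%N -> e i = 0).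
  by left.
right.
have ex N : exists i, (N <= i)%N /\ e i <> 0.
  apply: contrapT => h; apply: inf; exists N => i Ni; apply: contrapT => ei.
  by apply: h; exists i.
have [s hs] := choice ex.
pose g n := iter n (fun k => s k.+1) (s 0%N).
have gS n : (g n < g n.+1)%N by rewrite /= (hs _).1.
have gne n : e (g n) <> 0 by case: n => [|n]; exact: (hs _).2.
have gm : {homo g : i j / (i < j)%N} by apply: homo_ltn => // ? ? ?; exact: ltn_trans.
exists (e \o g) => i j /=; have [->|ij] := eqVneq i j.
  by case: (oe.2 (g j)) => // /gne.
rewrite oe.1//; move: ij; rewrite neq_lt => /orP[] /gm; rewrite ltn_neqAle => /andP[] // + _.
by rewrite eq_sym.
Qed.

(* If [H] is infinite-dimensional, sum the representing vectors of [w] against an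
   orthonormal sequence in the second leg; otherwise use a basis of [H]. *)
Lemma amplification (T : hilbert_tensor R) H (w : op H -> C) : nf w ->
  exists U V : T H H, forall x : op H, bdd x -> w x = '<tl (istens_tens T H H) x U, V>.
Proof.
move=> nw; set ht := istens_tens T H H.
have [e he] := onb_exists H.
have [[N hN]|[f hf]] := infinite_orthonormal he.
  have [M M0 hM] := nf_bound nw.
  have ex a : exists v, forall z, w (kb z (e a)) = '<z, v>.
    apply: (@riesz _ _ (fun z => w (kb z (e a))) (M * nr (e a))).
    - by rewrite mulr_ge0 ?nr_ge0.
    - move=> c u v; apply: nf_linear nw (bdd_kb _ _) (bdd_kb _ _) _ => z /=.
      by rewrite scalerDr !scalerA mulrC.
    - move=> z; rewrite -mulrA; apply: hM; first by rewrite mulr_ge0 ?nr_ge0.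
      move=> v; rewrite /= nrZ mulrAC ler_wpM2r ?nr_ge0// mulrC; exact: CS.
  have [v hv] := choice ex.
  exists (\sum_(a < N) tens T (e a) (e a)), (\sum_(a < N) tens T (v a) (e a)) => x bx.
  rewrite (linear_sum (tl ht x)) ip_suml.
  have -> : w x = \sum_(a < N) w (kb (x (e a)) (e a)).
    have [J [u [v' [hu hv' h]]]] := nw.
    have := nf_onb_sum (nf_mull bx nw) he.
    rewrite (_ : x \o idop H = x :> op H); last exact: op_ext.
    move=> hs; apply: hsum_unique hs _.
    pose B := [fset i in iota 0 N]%fset.
    have -> : \sum_(a < N) w (kb (x (e a)) (e a)) = \sum_(i <- B) w (kb (x (e i)) (e i)).
      rewrite -(big_mkord xpredT (fun a => w (kb (x (e a)) (e a)))) /index_iota subn0.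
      apply: perm_big; apply: uniq_perm; [exact: iota_uniq|exact: fset_uniq|].
      by move=> i; rewrite !inE.
    under [X in hsum X _]eq_fun do rewrite comp_kb.
    apply: hsum_fset => i; rewrite !inE mem_iota /= add0n -leqNgt => Ni.
    rewrite (nf_0 nw)// => z; rewrite /= (hN _ Ni) ip0r scale0r//.
  apply: eq_bigr => a _; rewrite hv tlE// ip_sumr (bigD1 a)//= big1 ?addr0.
    rewrite (t_ip ht); case: (he.1.2 a) => [->|ea]; first by rewrite mulr1.
    by rewrite ea linear0 ip0l mul0r.
  by move=> b ba; rewrite (t_ip ht) he.1.1 ?mulr0// eq_sym.
have [I [u [v [hu hv h]]]] := nw.
(* Distinct indices have distinct codes, hence are attached to orthogonal unit vectors. *)
pose F i := f (@choice.pickle I i).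
have oF : onf F.
  split => [i j ij|i]; rewrite /F hf; last by rewrite eqxx; left.
  case: eqVneq => // /(pcan_inj choice.pickleK) /eqP; by rewrite (negPf ij).
(* [Y] is the vector [\sum_i y i (x) F i], obtained by Riesz from its pairing with [z] instead of as
   a limit. *)
have ex (y : I -> H) : sqf y -> exists Y : T H H,
    forall z, hsum (fun i => '<RrA ht (F i) z, y i>) '<z, Y>.
  move=> [N N0 hN].
  have as_ z : asum (fun i => '<RrA ht (F i) z, y i>) (nr z * N).
    move=> A; apply: (@le_trans _ _ (\sum_(i <- A) nr (RrA ht (F i) z) * nr (y i))).
      by rewrite ler_sum// => i _; exact: CS.
    rewrite CS_sum ?nr_ge0//; try by move=> i; exact: nr_ge0.
    exact: RrA_bessel.
  have [phi hphi] := choice (fun z => asum_hsum (as_ z)).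
  have [||Y hY] := @riesz _ _ phi N N0.
  - move=> a z z'; apply: hsum_unique (hphi _) _.
    apply: eq_hsum (hsumD (hsumZ a (hphi z)) (hphi z')) => i.
    by rewrite (linear_of (RrA ht (F i))) ipDl ipZl.
  - by move=> z; rewrite mulrC; exact: asum_le (as_ z) (hphi z).
  by exists Y => z; rewrite -hY.
have [U hU] := ex u hu; have [V hV] := ex v hv.
exists U, V => x bx; apply: hsum_unique (h _ bx) _.
apply: eq_hsum (hV (tl ht x U)) => i /=; rewrite RrA_tl//; congr '<x _, _>.
apply: ip_ext => k; rewrite RrAP ipC [RHS]ipC; congr conjc.
apply: hsum_unique (hU _) _.
have := @hsum1 _ I (fun j => '<RrA ht (F j) (tens T k (F i)), u j>) i.
rewrite RrA_t {2}/F {2}/F hf eqxx scale1r; apply => j ji.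
by rewrite RrA_t oF.1 ?scale0r ?ip0l// eq_sym.
Qed.

(** Closure under addition is not included, because orthogonal complements and commutants do not see
    linear combinations; thus the elementary tensors qualify without passing to their span. *)
Definition staralg H (M : set (op H)) :=
  [/\ forall x : op H, M x -> bdd x, M (idop H),
      forall x y, M x -> M y -> M (x \o y) & forall x, M x -> M (adj x)].

Lemma commutant_bdd H (S : set (op H)) (x : op H) : commutant S x -> bdd x.
Proof. by case=> /bdd_continuous. Qed.

Lemma sub_bicommutant H (S : set (op H)) (x : op H) : bdd x -> S x -> commutant (commutant S) x.
Proof.
move=> bx Sx; split; first exact/bdd_continuous.
by move=> y [_ hy] v; rewrite hy.
Qed.

Lemma staralg_commutant H (S : set (op H)) : (forall x, S x -> bdd x) ->
  (forall x, S x -> S (adj x)) -> staralg (commutant S).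
Proof.
move=> bS aS; split.
- by move=> x; exact: commutant_bdd.
- by split => // v; exact: cvg_id.
- move=> x y [cx hx] [cy hy]; split.
    by apply/bdd_continuous; apply: bdd_comp; exact/bdd_continuous.
  by move=> z Sz v /=; have /= -> := hy z Sz v; exact: (hx z Sz (y v)).
- move=> x [/bdd_continuous bx hx]; split; first exact/bdd_continuous/bdd_adj.
  move=> z Sz v; apply: ip_ext => u /=.
  have bz := bS _ Sz.
  rewrite adjP'// adjP// adjP; last exact: bz.
  by rewrite adjP'//; congr '<_, _>; exact/esym/(hx _ (aS _ Sz)).
Qed.

Lemma staralg_bicommutant H (S : set (op H)) : (forall x, S x -> bdd x) ->
  (forall x, S x -> S (adj x)) -> staralg (commutant (commutant S)).
Proof.
move=> bS aS; have [h1 _ _ h4] := staralg_commutant bS aS.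
exact: staralg_commutant.
Qed.

Lemma staralg_vN H (M : set (op H)) : von_neumann_algebra M -> staralg M.
Proof.
move=> [hb hs hc]; rewrite -hc; apply: staralg_bicommutant => x Mx.
  by apply/bdd_continuous; exact: hb.
have [y My xy] := hs _ Mx.
by rewrite (adj_eq (_ : bdd x) xy)//; apply/bdd_continuous; exact: hb.
Qed.

(* After amplification this is von Neumann's argument: the projection onto the
   orthogonal complement of [(S (x) 1) U] commutes with [y (x) 1]. *)
Lemma density_principle (T : hilbert_tensor R) H (S : set (op H)) (w : op H -> C) (y : op H) :
  staralg S -> nf w -> (forall s, S s -> w s = 0) -> commutant (commutant S) y -> w y = 0.
Proof.
move=> [bS S1 SM SA] nw h hy; set ht := istens_tens T H H.
have [U [V hUV]] := amplification T nw.
pose Y := [set z : T H H | forall s, S s -> '<tl ht s U, z> = 0].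
have cY : closed_subspace Y.
  split => /= [s Ss|a u v hu hv s Ss|f l hf hl s Ss]; first by rewrite ip0r.
    by rewrite ipDr ipZr hu// hv// mulr0 addr0.
  by rewrite ipC (cvH_ip0 (v := tl ht s U) hl) ?conjc0//= => n; rewrite ipC hf ?conjc0.
have [P hP] := choice (fun v => projection_theorem v cY).
have Puniq v p : Y p -> (forall s, Y s -> '<(v - p), s> = 0) -> P v = p.
  move=> Yp hp; apply/eqP; rewrite -subr_eq0; apply/eqP; apply: ip_eq0.
  have Yd : Y (P v - p).
    case: cY => _ hc _; rewrite -[P v - p]addrC -scaleN1r; apply: hc => //.
    exact: (hP v).1.
  have -> : '<(P v - p), (P v - p)> = '<(v - p), (P v - p)> - '<(v - P v), (P v - p)>.
    by rewrite -ipBl; congr '<_, _>; rewrite opprB [RHS]addrC subrKA.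
  by rewrite hp// (hP v).2// subrr.
have Plin : linear P.
  move=> a u v; apply: Puniq; first by case: cY => _ hc _; apply: hc; exact: (hP _).1.
  move=> s Ys; have -> : a *: u + v - (a *: P u + P v) = a *: (u - P u) + (v - P v).
    by rewrite scalerBr opprD addrACA.
  by rewrite ipDl ipZl !(hP _).2// mulr0 addr0.
pose PP := mklin Plin.
have Psa u v : '<P u, v> = '<u, P v>.
  have e1 : '<P u, v> = '<P u, P v>.
    rewrite -[v in LHS](subrK (P v)) ipDr ipC (hP v).2 ?conjc0 ?add0r//; exact: (hP u).1.
  rewrite e1 -[u in RHS](subrK (P u)) ipDl (hP u).2 ?add0r//; exact: (hP v).1.
have bP : bdd PP.
  exists 1 => // v; rewrite mul1r /=; apply: nr_le_ip; first exact: nr_ge0.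
  have hv : nr (P v) <= nr v.
    have h1 : nr (P v) ^+ 2 = complex.Re '<v, P v>.
      have -> : '<v, P v> = '<(v - P v), P v> + '<P v, P v> by rewrite -ipDl subrK.
      by rewrite sqr_nr (hP v).2 ?add0r//; exact: (hP v).1.
    have [->|p0] := eqVneq (nr (P v)) 0; first exact: nr_ge0.
    have pp : 0 < nr (P v) by rewrite lt_def p0 nr_ge0.
    by rewrite -(ler_pM2r pp) -expr2 h1; exact: Re_ip_le.
  by move=> u; apply: le_trans (CS _ _) _; rewrite ler_wpM2r ?nr_ge0.
have Yinv s z : S s -> Y z -> Y (tl ht s z).
  move=> Ss Yz s' Ss'; rewrite -adjP'; last exact: bdd_tl.
  rewrite adj_tl; last exact: bS.
  have := Yz _ (SM _ _ (SA _ Ss) Ss'); rewrite tlM//; first exact/bS/SA.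
  exact: bS.
have Pcomm s z : S s -> P (tl ht s z) = tl ht s (P z).
  move=> Ss; apply: Puniq; first by apply: Yinv => //; exact: (hP z).1.
  move=> r Yr; rewrite -linearB adjP; last exact: bdd_tl.
  by rewrite adj_tl ?(hP z).2//; [apply: Yinv => //; exact: SA|exact: bS].
have yb : bdd y by exact: commutant_bdd hy.
(* The slices of [PP] lie in the commutant of [S], with which [y] commutes; tested on elementary
   tensors, this makes [y (x) 1] commute with [PP]. *)
have rsc xi eta : commutant S (rs ht xi eta PP).
  split; first exact/bdd_continuous/bdd_rs.
  move=> s Ss k; have bs := bS _ Ss.
  by rewrite /rs /= -(tlE ht _ _ bs) (Pcomm _ _ Ss) RrA_tl.
have Py z : P (tl ht y z) = tl ht y (P z).
  suff : PP \o tl ht y = tl ht y \o PP :> op _.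
    by move=> /(congr1 (fun f : op _ => f z)).
  apply: (op_eqt ht).
  - exact: bdd_comp bP (bdd_tl _ _).
  - exact: bdd_comp (bdd_tl _ _) bP.
  move=> k l; apply: (t_ext ht) => k' l' /=; rewrite tlE// -RrAP -[RHS]RrAP RrA_tl//.
  by have := hy.2 _ (rsc l l') k; rewrite /rs /= => <-.
(* [U] is orthogonal to [Y] because [1] is in [S], and [V] is in [Y] because [w] vanishes on [S].
   Hence [w y = <(y (x) 1) U, P V> = <(y (x) 1) P U, V> = 0]. *)
have PU : P U = 0.
  apply: Puniq; first by case: cY.
  move=> s Ys; rewrite subr0.
  by have := Ys _ S1; rewrite tl_id.
have PV : P V = V.
  apply: Puniq; last by move=> s _; rewrite subrr ip0l.
  by move=> s Ss /=; rewrite -hUV ?h//; exact: bS.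
by rewrite hUV// -PV -Psa Py PU linear0 ip0l.
Qed.

End Density.

(** * Tensor products of von Neumann algebras *)

Section VonNeumannTensor.
Variable R : realType.
Local Notation C := R[i].
Variable T : hilbert_tensor R.
Implicit Types H K W V : hilbertType R.

Notation htt K H := (istens_tens T K H).

Lemma op_tensE K H (x : op K) (y : op H) (z : op (T K H)) :
  bdd x -> bdd y -> bdd z -> op_tens x y z -> z = tl (htt K H) x \o tr (htt K H) y.
Proof.
move=> bx bY bz h; apply: (op_eqt (htt K H)) => //.
  exact: bdd_comp (bdd_tl _ _) (bdd_tr _ _).
by move=> k l /=; rewrite h trE// tlE.
Qed.

Lemma op_tens_tltr K H (x : op K) (y : op H) : bdd x -> bdd y ->
  op_tens x y (tl (htt K H) x \o tr (htt K H) y).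
Proof. by move=> bx bY k h /=; rewrite (trE (htt K H))// (tlE (htt K H)). Qed.

Lemma bdd_tltr K H (x : op K) (y : op H) : bdd (tl (htt K H) x \o tr (htt K H) y).
Proof. exact: bdd_comp (bdd_tl _ _) (bdd_tr _ _). Qed.

Section OneTensor.
Variables (K H : hilbertType R) (M : set (op K)) (N : set (op H)).
Hypotheses (sM : staralg M) (sN : staralg N).

Definition elem_tens : set (op (T K H)) :=
  [set z : op (T K H) | continuous z /\ exists x y, [/\ M x, N y & op_tens x y z]].

Lemma elem_tensP z : elem_tens z -> exists x y,
  [/\ M x, N y & z = tl (htt K H) x \o tr (htt K H) y].
Proof.
move=> [/bdd_continuous bz [x [y [Mx Ny h]]]]; exists x, y; split => //.
by apply: op_tensE => //; [case: sM => + _ _ _; exact|case: sN => + _ _ _; exact].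
Qed.

Lemma elem_tltr x y : M x -> N y -> elem_tens (tl (htt K H) x \o tr (htt K H) y).
Proof.
move=> Mx Ny; split; first exact/bdd_continuous/bdd_tltr.
exists x, y; split => //; apply: op_tens_tltr.
  by case: sM => + _ _ _; exact.
by case: sN => + _ _ _; exact.
Qed.

Lemma staralg_elem_tens : staralg elem_tens.
Proof.
have [bM M1 MM MA] := sM; have [bN N1 NM NA] := sN.
split.
- by move=> x [/bdd_continuous].
- split; first by move=> v; exact: cvg_id.
  by exists (idop K), (idop H).
- move=> _ _ /elem_tensP[x [y [Mx Ny ->]]] /elem_tensP[x' [y' [Mx' Ny' ->]]].
  suff -> : (tl (htt K H) x \o tr (htt K H) y) \o (tl (htt K H) x' \o tr (htt K H) y') =
    tl (htt K H) (x \o x') \o tr (htt K H) (y \o y') :> op (T K H).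
    by apply: elem_tltr; [exact: MM|exact: NM].
  apply: (op_eqt (htt K H)); [exact: bdd_comp (bdd_tltr _ _) (bdd_tltr _ _)|exact: bdd_tltr|].
  move=> k h /=; have bx := bM _ Mx; have bx' := bM _ Mx'.
  have bY := bN _ Ny; have bY' := bN _ Ny'.
  rewrite !(trE (htt K H))// ?tlE ?trE ?tlE//; exact: bdd_comp.
- move=> _ /elem_tensP[x [y [Mx Ny ->]]].
  have bx := bM _ Mx; have bY := bN _ Ny.
  suff -> : adj (tl (htt K H) x \o tr (htt K H) y) =
    tl (htt K H) (adj x) \o tr (htt K H) (adj y) by apply: elem_tltr; [exact: MA|exact: NA].
  apply: adj_eq => [|u v]; first exact: bdd_tltr.
  rewrite /= (adjP _ _ (bdd_tl (htt K H) x)) (adjP _ _ (bdd_tr (htt K H) y)).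
  by rewrite adj_tl// adj_tr// tl_trE//; exact: bdd_adj.
Qed.

Lemma vNt_elem z : elem_tens z -> vN_tensor T M N z.
Proof. by move=> h; apply: sub_bicommutant => //; case: h => /bdd_continuous. Qed.

Lemma vNt_tltr x y : M x -> N y -> vN_tensor T M N (tl (htt K H) x \o tr (htt K H) y).
Proof. by move=> Mx Ny; apply: vNt_elem; exact: elem_tltr. Qed.

Lemma tl_tltr (x : op K) : tl (htt K H) x = tl (htt K H) x \o tr (htt K H) (idop H) :> op (T K H).
Proof. by apply: op_ext => v /=; rewrite (@tr_id _ _ _ _ _ (htt K H)). Qed.

Lemma tr_tltr (y : op H) : tr (htt K H) y = tl (htt K H) (idop K) \o tr (htt K H) y :> op (T K H).
Proof. by apply: op_ext => v /=; rewrite (@tl_id _ _ _ _ _ (htt K H)). Qed.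

Lemma vNt_tl x : M x -> vN_tensor T M N (tl (htt K H) x).
Proof. by move=> Mx; rewrite tl_tltr; apply: vNt_tltr => //; case: sN. Qed.

Lemma vNt_tr y : N y -> vN_tensor T M N (tr (htt K H) y).
Proof. by move=> Ny; rewrite tr_tltr; apply: vNt_tltr => //; case: sM. Qed.

Lemma staralg_vNt : staralg (vN_tensor T M N).
Proof. by apply: staralg_bicommutant; case: staralg_elem_tens. Qed.

(** The working form of the density principle: an identity in the tensor product is read through
    normal functionals and compared on elementary tensors. *)
Lemma vNt_ext (w w' : op (T K H) -> C) z : nf w -> nf w' ->
  (forall x y, M x -> N y -> w (tl (htt K H) x \o tr (htt K H) y) =
                          w' (tl (htt K H) x \o tr (htt K H) y)) ->
  vN_tensor T M N z -> w z = w' z.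
Proof.
move=> nw nw' h hz; apply/eqP; rewrite -subr_eq0; apply/eqP.
apply: (density_principle T staralg_elem_tens (nfB nw nw') _ hz).
by move=> _ /elem_tensP[x [y [Mx Ny ->]]]; rewrite h// subrr.
Qed.

End OneTensor.

Lemma normal_nf H K (M : set (op H)) (N : set (op K)) (f : op H -> op K) (w : op K -> C) :
  (forall x, M x -> bdd x) -> (forall x, N x -> bdd x) ->
  normal_linear_map M N f -> nf w ->
  exists2 w', nf w' & forall x, M x -> w' x = w (f x).
Proof.
move=> bM bN [_ _ h] nw.
by have [w' nw' hw'] := predual_nf bM (h _ (nf_predual bN nw)); exists w'.
Qed.

Section Assoc.
Variables (K L H : hilbertType R).

Notation WF := (T (T K L) H).
Notation WG := (T K (T L H)).
Notation sF k l h := (tens T (tens T k l) h).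
Notation sG k l h := (tens T k (tens T l h)).

(* [v] and [v'] correspond under the canonical unitary. *)
Definition corr (v : WF) (v' : WG) :=
  forall (k : K) (l : L) (h : H), '<v, sF k l h> = '<v', sG k l h>.

Lemma sFG (k k' : K) (l l' : L) (h h' : H) : '<sF k l h, sF k' l' h'> = '<sG k l h, sG k' l' h'>.
Proof. by rewrite !tens_inner mulrA. Qed.

Lemma assoc_basis : exists (f : nat * (nat * nat) -> K * (L * H)),
  let fF p := sF (f p).1 (f p).2.1 (f p).2.2 in
  let fG p := sG (f p).1 (f p).2.1 (f p).2.2 in
  [/\ onf fF, total_family fF, onf fG & total_family fG].
Proof.
have [d [od td]] := onb_exists K; have [e [oe te]] := onb_exists L.
have [g [og tg]] := onb_exists H.
exists (fun p => (d p.2.2, (e p.2.1, g p.1))) => /=; split.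
- exact: (t_onf (htt _ _) (t_onf (htt _ _) od oe) og).
- exact: (t_total_family (htt _ _) (t_total_family (htt _ _) td te) tg).
- have [q1 q2] := t_onf (htt _ _) od (t_onf (htt _ _) oe og).
  split => [[i [j k]] [i' [j' k']] ij|[i [j k]]] /=.
    apply: (q1 ((i, j), k) ((i', j'), k')); apply: contra_neq ij.
    by case=> -> -> ->.
  exact: (q2 ((i, j), k)).
- move=> y hy; apply: (t_total_family (htt _ _) td (t_total_family (htt _ _) te tg)).
  by move=> [[i j] k]; exact: (hy (i, (j, k))).
Qed.

(** The canonical unitary is not built as an operator: [v] receives, in the basis of triple tensors,
    the coordinates of [v']. *)
Lemma corr_exists (v' : WG) : exists v, corr v v'.
Proof.
have [f [/= oF tF oG tG]] := assoc_basis.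
set fF := fun p => _ in oF tF; set fG := fun p => _ in oG tG.
have as_ z : asum (fun p => '<z, fF p> * conjc '<v', fG p>) (nr z * nr v').
  move=> A; under eq_bigr do rewrite abM abJ.
  by rewrite CS_sum ?nr_ge0//; try (by move=> i; exact: ab_ge0); exact: bessel.
have [phi hphi] := choice (fun z => asum_hsum (as_ z)).
have [|||v hv] := @riesz _ _ phi (nr v').
- exact: nr_ge0.
- move=> a z z'; apply: hsum_unique (hphi _) _.
  apply: eq_hsum (hsumD (hsumZ a (hphi z)) (hphi z')) => i.
  by rewrite ipDl ipZl; ring.
- by move=> z; rewrite mulrC; exact: asum_le (as_ z) (hphi z).
exists v => k l h; rewrite ipC [RHS]ipC; congr conjc; rewrite -hv.
apply: hsum_unique (hphi _) _; apply: eq_hsum (parseval oG tG _ _) => p.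
by rewrite /fF sFG.
Qed.

Lemma corr_ip v v' z z' : corr v v' -> corr z z' -> '<v, z> = '<v', z'>.
Proof.
move=> hv hz; have [f [/= oF tF oG tG]] := assoc_basis.
apply: hsum_unique (parseval oF tF _ _) _.
by apply: eq_hsum (parseval oG tG _ _) => p; rewrite hv hz.
Qed.

Lemma corr_nr v v' : corr v v' -> nr v = nr v'.
Proof.
move=> h; apply/eqP; rewrite -(@eqrXn2 _ 2%N) ?nr_ge0//; apply/eqP.
by rewrite !sqr_nr (corr_ip h h).
Qed.

(** [assoc_eq] tests elementary tensors only, and operators do not preserve these. Passing to
    arbitrary corresponding vectors is what makes [assoc_eq] multiplicative. *)
Lemma corr_op (X : op WF) (Y : op WG) v v' : bdd X -> bdd Y -> assoc_eq X Y ->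
  corr v v' -> corr (X v) (Y v').
Proof.
move=> bX bY h hv k l m; rewrite !adjP//; apply: corr_ip hv _ => k' l' m'.
by rewrite !adjP'// ipC [RHS]ipC h.
Qed.

Lemma assoc_eq_comp (X X' : op WF) (Y Y' : op WG) :
  bdd X -> bdd Y -> bdd X' -> bdd Y' ->
  assoc_eq X Y -> assoc_eq X' Y' -> assoc_eq (X \o X') (Y \o Y').
Proof.
move=> bX bY bX' bY' h h' k k' l l' m m' /=.
have h0 : corr (sF k l m) (sG k l m) by move=> ? ? ?; exact: sFG.
by apply: corr_op => //; exact: corr_op.
Qed.

Lemma assoc_eq_elem (x : op K) (y : op L) (z : op H) : bdd x -> bdd y -> bdd z ->
  assoc_eq (tl (htt _ _) (tl (htt _ _) x \o tr (htt _ _) y) \o tr (htt _ _) z)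
           (tl (htt _ _) x \o tr (htt _ _) (tl (htt _ _) y \o tr (htt _ _) z)).
Proof.
move=> bx bY bz k k' l l' m m' /=.
have b1 := @bdd_tltr K L x y; have b2 := @bdd_tltr L H y z.
rewrite (trE (htt (T K L) H))// (tlE (htt (T K L) H))// (trE (htt K (T L H)))//.
rewrite (tlE (htt K (T L H)))// /= (trE (htt K L))// (tlE (htt K L))//.
by rewrite (trE (htt L H))// (tlE (htt L H))// sFG.
Qed.

(** The representing vectors are moved through [corr]; a functional for one bracketing can then be
    evaluated on the other. *)
Lemma assoc_nf (kappa : op WG -> C) : nf kappa -> exists2 kF : op WF -> C, nf kF &
  forall (X : op WF) (Y : op WG), bdd X -> bdd Y -> assoc_eq X Y -> kF X = kappa Y.
Proof.
move=> [I [u' [v' [hu hv h]]]].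
have [U hU] := choice corr_exists.
have sU y : sqf y -> sqf (U \o y).
  move=> [M M0 hM]; exists M => // A; under eq_bigr do rewrite (corr_nr (hU _)).
  exact: hM.
have [kF hk] := rep_exists (sU _ _ hu) (sU _ _ hv); exists kF.
  by exists I, (U \o u'), (U \o v').
case: hk => _ _ hk X Y bX bY XY; apply: hsum_unique (hk _ bX) _.
apply: eq_hsum (h _ bY) => i /=; apply/esym/corr_ip; last exact: hU.
exact: corr_op.
Qed.

End Assoc.

End VonNeumannTensor.

(** * Positive semidefinite forms *)

Section SemiInner.
Variable R : realType.
Local Notation C := R[i].
(** The intended instance is [M] with the form [t (y^* x)], where [comb u c v] means [u + c v]. This
    form may be degenerate and [M] is not complete for it, so only finite orthonormal families are
    used. *)
Variables (V : Type) (P : set V) (comb : V -> C -> V -> V) (s : V -> V -> C).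
Hypothesis hP : forall u c v, P u -> P v -> P (comb u c v).
Hypothesis hl : forall u c v w, P u -> P v -> P w -> s (comb u c v) w = s u w + c * s v w.
Hypothesis hC : forall u v, P u -> P v -> s u v = conjc (s v u).
Hypothesis hpos : forall u, P u -> 0 <= s u u.

Let q u := complex.Re (s u u).

Lemma semi_r u c v w : P u -> P v -> P w -> s w (comb u c v) = s w u + conjc c * s w v.
Proof.
move=> Pu Pv Pw; rewrite hC ?hl//; last exact: hP.
by rewrite conjcD conjcM -!hC.
Qed.

Lemma semi_q u : P u -> s u u = (q u)%:C.
Proof. by move=> /hpos /ge0_complex. Qed.

Lemma semi_q_ge0 u : P u -> 0 <= q u.
Proof. by move=> /hpos /ge0_Re. Qed.

Lemma semi_CS u v : P u -> P v -> ab (s u v) ^+ 2 <= q u * q v.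
Proof.
move=> Pu Pv; set z := s u v; set m := ab z ^+ 2.
have key (r : R) : 0 <= q u - 2 * r * m + r ^+ 2 * m * q v.
  have := semi_q_ge0 (hP (- (r%:C * z)) Pu Pv).
  rewrite /q hl ?semi_r//; try exact: hP.
  rewrite (hC Pv Pu) -/z (semi_q Pu) (semi_q Pv) conjcN conjcM conjc_real.
  rewrite !mulrDr.
  have -> : - (r%:C * z) * conjc z = (- (r * m))%:C.
    by rewrite mulNr -mulrA sqr_ab -rmorphM -rmorphN.
  have -> : - (r%:C * conjc z) * z = (- (r * m))%:C.
    by rewrite mulNr -mulrA [conjc z * z]mulrC sqr_ab -rmorphM -rmorphN.
  have -> : - (r%:C * z) * (- (r%:C * conjc z) * (q v)%:C) = (r ^+ 2 * m * q v)%:C.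
    have E (x y : R) : (x * y)%:C = x%:C * y%:C by exact: rmorphM.
    by rewrite (E _ (q v)) (E _ m) expr2 (E r r) /m -sqr_ab; ring.
  by rewrite !ReD /= => h; lra.
have m0 : 0 <= m by exact: sqr_ge0.
have [v0|v0] := eqVneq (q v) 0.
  rewrite v0 mulr0 leNgt; apply/negP => m1.
  (* When [q v = 0] the bound is affine in [r], and this [r] makes it equal to [-1]. *)
  have := key ((q u + 1) / (2 * m)); rewrite v0 mulr0 addr0.
  have -> : 2 * ((q u + 1) / (2 * m)) * m = q u + 1 by field; lra.
  by lra.
have vp : 0 < q v by rewrite lt_neqAle eq_sym v0 semi_q_ge0.
have := key (q v)^-1.
have -> : q u - 2 * (q v)^-1 * m + (q v)^-1 ^+ 2 * m * q v = (q u * q v - m) / q v.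
  by field.
by rewrite pmulr_lge0 ?invr_gt0// subr_ge0.
Qed.

Lemma semi_null u v : P u -> P v -> q v = 0 -> s u v = 0.
Proof.
move=> Pu Pv v0; apply: ab_eq0; apply/eqP; rewrite -sqrf_eq0 eq_le sqr_ge0 andbT.
by rewrite -[leRHS](mulr0 (q u)) -v0; exact: semi_CS.
Qed.

(** The remainder [z - \sum_y s z y y] of [z] along an orthonormal family [ys]. *)
Let defect (ys : seq V) (z : V) := foldr (fun y u => comb u (- s z y) y) z ys.

Fixpoint allQ (Q : V -> Prop) (ys : seq V) : Prop :=
  if ys is y :: ys' then Q y /\ allQ Q ys' else True.
Local Notation allP := (allQ P).

Lemma P_defect ys z : P z -> allP ys -> P (defect ys z).
Proof. by move=> Pz; elim: ys => //= y ys IH [Py Pys]; apply: hP => //; exact: IH. Qed.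

Lemma s_defect ys z x : P z -> P x -> allP ys ->
  s x (defect ys z) = s x z - \sum_(y <- ys) s x y * conjc (s z y).
Proof.
move=> Pz Px; elim: ys => [|y ys IH] /=; first by rewrite big_nil subr0.
move=> [Py Pys]; rewrite semi_r//; last exact: P_defect.
by rewrite IH// big_cons conjcN mulNr opprD addrA addrAC mulrC.
Qed.

(** [v] lies in the span of the orthonormal family [ys], up to a vector that [s] does not see. *)
Let reproduces ys v := forall x, P x -> s x v = \sum_(y <- ys) s x y * conjc (s v y).

Lemma allQ_impl (Q Q' : V -> Prop) ys : allP ys -> (forall v, P v -> Q v -> Q' v) ->
  allQ Q ys -> allQ Q' ys.
Proof. by move=> + h; elim: ys => //= y ys IH [? ?] [? ?]; split; [exact: h|exact: IH]. Qed.

Lemma sum_allQ (Q : V -> Prop) ys (f : V -> C) : allP ys -> (forall v, P v -> Q v -> f v = 0) ->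
  allQ Q ys -> \sum_(y <- ys) f y = 0.
Proof.
move=> + h; elim: ys => [|y ys IH] /=; first by rewrite big_nil.
by move=> [? ?] [? ?]; rewrite big_cons h// add0r IH.
Qed.

(** Orthonormality is recorded only through Bessel's inequality and the fact that [ys] reproduces
    its own members. A remainder of length [0] adds no vector: the family then reproduces [z]
    already. *)
Lemma semi_gram_schmidt zs : allP zs -> exists ys,
  [/\ allP ys, forall x, P x -> \sum_(y <- ys) ab (s x y) ^+ 2 <= q x,
      allQ (reproduces ys) ys & allQ (reproduces ys) zs].
Proof.
elim: zs => [_|z zs IH /= [Pz Pzs]].
  by exists [::]; split=> // x Px; rewrite big_nil semi_q_ge0.
have [ys [Pys hB hy hz]] := IH Pzs.
set z' := defect ys z; have Pz' : P z' by exact: P_defect.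
have orth v : P v -> reproduces ys v -> s v z' = 0.
  move=> Pv rv; rewrite s_defect// (hC Pv Pz) rv// conjc_sum -sumrB big1// => y _.
  by rewrite conjcM conjcK mulrC subrr.
have [n0|n0] := eqVneq (q z') 0.
  exists ys; split=> //; split=> // x Px; have := semi_null Px Pz' n0.
  by rewrite s_defect// => /eqP; rewrite subr_eq0 => /eqP.
have np : 0 < q z' by rewrite lt_neqAle eq_sym n0 semi_q_ge0.
pose r := Num.sqrt (q z'); have r0 : 0 < r by rewrite sqrtr_gt0.
(* This is [r^-1 z'], expressed by [comb]. *)
pose y' := comb z' (r^-1 - 1)%:C z'; have Py' : P y' by exact: hP.
have sy' x : P x -> s x y' = (r^-1)%:C * s x z'.
  move=> Px; rewrite semi_r// conjc_real rmorphB rmorph1 mulrBl mul1r; ring.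
have rr : r * r = q z' by rewrite -expr2 sqr_sqrtr// ltW.
have sz'y' : s z' y' = r%:C.
  rewrite sy'// semi_q// -rmorphM -rr; congr (_%:C).
  by rewrite mulKf// gt_eqF.
have syy : s y' y' = 1.
  rewrite sy'// hC// sz'y' conjc_real -rmorphM mulVf ?gt_eqF//.
have orth' v : P v -> reproduces ys v -> s v y' = 0.
  by move=> Pv rv; rewrite sy'// orth// mulr0.
have mono v : P v -> reproduces ys v -> reproduces (y' :: ys) v.
  by move=> Pv rv x Px; rewrite big_cons (orth' v)// conjc0 mulr0 add0r rv.
exists (y' :: ys); split => /=.
- by split.
- move=> x Px; rewrite big_cons.
  set x' := defect ys x; have Px' : P x' by exact: P_defect.
  have o v : P v -> reproduces ys v -> s v x' = 0.
    move=> Pv rv; rewrite s_defect// (hC Pv Px) rv// conjc_sum -sumrB big1// => y _.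
    by rewrite conjcM conjcK mulrC subrr.
  have e1 : s y' x = s y' x'.
    rewrite s_defect// (sum_allQ Pys _ hy) ?subr0// => v Pv rv.
    by rewrite (hC Py' Pv) orth'// conjc0 mul0r.
  have e2 : q x' = q x - \sum_(y <- ys) ab (s x y) ^+ 2.
    have h : s x' x' = s x' x.
      rewrite [LHS]s_defect// (sum_allQ Pys _ hy) ?subr0//.
      by move=> v Pv rv; rewrite (hC Px' Pv) o// conjc0 mul0r.
    have : s x' x' = s x x' by rewrite [RHS]hC// -h -hC.
    rewrite /q => ->; rewrite s_defect// ReD ReN Re_sum; congr (_ - _).
    by apply: eq_bigr => y _; rewrite sqr_ab.
  rewrite -lerBrDr -e2 -(abJ (s x y')) -hC// e1.
  have := semi_CS Py' Px'; rewrite {1}/q syy /= mul1r => h.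
  by lra.
- split; last exact: allQ_impl hy.
  move=> x Px; rewrite big_cons syy conjc1 mulr1 (sum_allQ Pys _ hy) ?addr0// => v Pv rv.
  by rewrite (hC Py' Pv) orth'// conjc0 conjc0 mulr0.
- split; last exact: allQ_impl hz.
  move=> x Px; rewrite big_cons.
  have e1 : conjc (s z y') = r%:C.
    have : s y' z' = conjc r%:C by rewrite -sz'y' -hC.
    rewrite -(hC Py' Pz) conjc_real [s y' z']s_defect// (sum_allQ Pys _ hy) ?subr0// => v Pv rv.
    by rewrite (hC Py' Pv) orth'// conjc0 mul0r.
  rewrite e1 sy'// s_defect// mulrC mulrA -rmorphM mulfV ?gt_eqF// mul1r.
  by rewrite subrK.
Qed.

Lemma sum_ab_CS ys x w : P x -> P w ->
  (forall x, P x -> \sum_(y <- ys) ab (s x y) ^+ 2 <= q x) ->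
  ab (\sum_(y <- ys) s x y * conjc (s w y)) <= Num.sqrt (q x) * Num.sqrt (q w).
Proof.
move=> Px Pw hB; apply: le_trans (ler_ab_sum _ _ _) _.
have sx : \sum_(y <- ys) ab (s x y) ^+ 2 <= Num.sqrt (q x) ^+ 2.
  by rewrite sqr_sqrtr ?hB// semi_q_ge0.
have sw : \sum_(y <- ys) ab (s w y) ^+ 2 <= Num.sqrt (q w) ^+ 2.
  by rewrite sqr_sqrtr ?hB// semi_q_ge0.
under eq_bigr do rewrite abM abJ.
by apply: (CS_sum _ _ _ _ sx sw) => *; rewrite ?sqrtr_ge0 ?ab_ge0.
Qed.

Lemma tail_small (I : choiceType) (f : I -> R) (m : R) (e : R) : (forall i, 0 <= f i) ->
  (forall A : {fset I}, \sum_(i <- A) f i <= m) -> 0 < e ->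
  exists A : {fset I}, forall B : {fset I}, (forall i, i \in A -> i \notin B) ->
    \sum_(i <- B) f i <= e.
Proof.
move=> f0 hm e0; have [z [hz hle]] := asum_hsum_nneg f0 hm.
have [A hA] := hz e e0; exists A => B dAB.
have := hA A (fsubset_refl _); have := hle (A `|` B)%fset.
rewrite (big_fsetID _ [in A])/=.
have -> : [fset i in A `|` B | i \in A]%fset = A.
  by apply/fsetP => i; rewrite !inE /=; case: (i \in A); rewrite ?andbF.
have -> : [fset i in A `|` B | i \notin A]%fset = B.
  by apply/fsetP => i; rewrite !inE /=; have := dAB i; case: (i \in A) => [/(_ isT)/negbTE->|_]; rewrite ?andbT.
rewrite -realc_sum -rmorphB ab_real distrC => h1 h2.
have := le_lt_trans (ler_norm _) h2; lra.
Qed.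

(** A trace-class operator whose diagonal coefficients all vanish has trace [0]; no orthonormal
    basis is available here. Apart from a tail of mass [e / 2] only finitely many [w i] matter, and
    a finite family [ys] reproduces them. Subtracting the coefficients along [ys], which sum to [0],
    cancels those terms and at most doubles the tail. *)
Lemma semi_trace_zero (I : choiceType) (x w : I -> V) (m : R) (z0 : C) :
  (forall i, P (x i)) -> (forall i, P (w i)) ->
  (forall A : {fset I}, \sum_(i <- A) Num.sqrt (q (x i)) * Num.sqrt (q (w i)) <= m) ->
  hsum (fun i => s (x i) (w i)) z0 ->
  (forall y, P y -> hsum (fun i => s (x i) y * conjc (s (w i) y)) 0) -> z0 = 0.
Proof.
move=> Px Pw hm hz h0; apply: ab_small0 => e e0.
have f0 i : 0 <= Num.sqrt (q (x i)) * Num.sqrt (q (w i)) by rewrite mulr_ge0 ?sqrtr_ge0.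
have [|A hA] := @tail_small _ _ m (e / 2) f0 hm; first by rewrite divr_gt0.
pose zs := [seq w i | i <- A].
have Pzs : allP zs by rewrite /zs; elim: (A : seq I) => //= i r IH; split.
have [ys [Pys hB _ hz']] := semi_gram_schmidt Pzs.
have rep i : i \in A -> s (x i) (w i) = \sum_(y <- ys) s (x i) y * conjc (s (w i) y).
  move: hz'; rewrite /zs -[i \in A]/(i \in (A : seq I)); elim: (A : seq I) => //= j r IH [rj rr].
  by rewrite inE => /orP[/eqP->|/IH]; [exact: rj|exact].
pose d i := s (x i) (w i) - \sum_(y <- ys) s (x i) y * conjc (s (w i) y).
have hq : hsum (fun i => \sum_(y <- ys) s (x i) y * conjc (s (w i) y)) 0.
  move: Pys; elim: (ys) => [_|y r IH /= [Py Pr]].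
    by apply: eq_hsum (@hsum0 R I) => i; rewrite big_nil.
  have := hsumD (h0 y Py) (IH Pr); rewrite addr0; apply: eq_hsum => i.
  by rewrite big_cons.
have hd : hsum d z0 by rewrite -[z0]subr0; exact: hsumB hz hq.
apply: (hsum_le hd) => B.
apply: le_trans (ler_ab_sum _ _ _) _.
rewrite (big_fsetID _ [in A])/= [X in X + _]big1_seq ?add0r; last first.
  by move=> i; rewrite !inE /= => /andP[_ iA]; rewrite /d rep// subrr ab0.
set B' := [fset _ | _ in _ & _]%fset.
have dB : forall i, i \in A -> i \notin B'.
  by move=> i iA; rewrite !inE /= iA andbF.
apply: (@le_trans _ _ (\sum_(i <- B') 2 * (Num.sqrt (q (x i)) * Num.sqrt (q (w i))))).
  apply: ler_sum => i _; apply: le_trans (ler_abB _ _) _; rewrite mulr_natl mulr2n lerD//.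
    rewrite -sqrtrM ?semi_q_ge0// -[leLHS]ger0_norm ?ab_ge0// -sqrtr_sqr ler_wsqrtr//.
    exact: semi_CS.
  exact: sum_ab_CS.
rewrite -mulr_sumr; have := hA B' dB; lra.
Qed.

Lemma semi_trace_eq (I J : choiceType) (x w : I -> V) (x' w' : J -> V) (m m' : R) (z z' : C) :
  (forall i, P (x i) /\ P (w i)) -> (forall j, P (x' j) /\ P (w' j)) ->
  (forall A : {fset I}, \sum_(i <- A) Num.sqrt (q (x i)) * Num.sqrt (q (w i)) <= m) ->
  (forall A : {fset J}, \sum_(j <- A) Num.sqrt (q (x' j)) * Num.sqrt (q (w' j)) <= m') ->
  hsum (fun i => s (x i) (w i)) z -> hsum (fun j => s (x' j) (w' j)) z' ->
  (forall y, P y -> exists d, hsum (fun i => s (x i) y * conjc (s (w i) y)) d /\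
    hsum (fun j => s (x' j) y * conjc (s (w' j) y)) d) -> z = z'.
Proof.
move=> Pi Pj hm hm' hz hz' hd.
(* [u + (-2) u] plays the role of [- u], so that the difference of the two traces becomes one trace
   over [I + J]. *)
pose n u := comb u (- 2) u.
have sn u v : P u -> P v -> s (n u) v = - s u v by move=> *; rewrite hl//; ring.
have Pn u : P u -> P (n u) by move=> Pu; exact: hP.
have qn u : P u -> q (n u) = q u.
  move=> Pu; have Pnu := Pn u Pu.
  by rewrite /q (sn _ _ Pu Pnu) (hC Pu Pnu) (sn _ _ Pu Pu) conjcN -(hC Pu Pu) opprK.
pose xx : I + J -> V := sumf x (fun j => n (x' j)).
pose ww : I + J -> V := sumf w w'.
have P1 k : P (xx k) by case: k => [i|j] /=; [case: (Pi i)|apply: Pn; case: (Pj j)].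
have P2 k : P (ww k) by case: k => [i|j] /=; [case: (Pi i)|case: (Pj j)].
apply/eqP; rewrite -subr_eq0; apply/eqP; apply: (@semi_trace_zero _ xx ww (m + m')) => //.
- move=> A; have [B1 [B2 [_ _ ->]]] := fset_sumtype A; apply: lerD; first exact: hm.
  apply: le_trans (hm' B2); rewrite le_eqVlt; apply/orP; left; apply/eqP.
  by apply: eq_bigr => j _ /=; rewrite qn//; case: (Pj j).
- apply: hsum_sumtype => //; apply: eq_hsum (hsumN hz') => j /=.
  by rewrite sn//; case: (Pj j).
- move=> y Py; have [d [h1 h2]] := hd y Py; rewrite -(subrr d).
  apply: hsum_sumtype => //; apply: eq_hsum (hsumN h2) => j /=.
  by rewrite sn ?mulNr//; case: (Pj j).
Qed.
End SemiInner.

(** * Positive operators *)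

Section PositiveOperators.
Variable R : realType.
Local Notation C := R[i].
Implicit Types H K W : hilbertType R.

Lemma adjM H (x y : op H) : bdd x -> bdd y -> adj (x \o y) = adj y \o adj x :> op _.
Proof.
move=> bx bY; apply: adj_eq => [|u v]; first exact: bdd_comp.
by rewrite /= !adjP.
Qed.

Lemma positive_sqr H (x : op H) : bdd x -> positive_op (adj x \o x : op H).
Proof. by move=> bx v /=; rewrite adjP'// ip_ge0. Qed.

(** Positivity makes [<x w, w>] real; taking [w = u + v] and [w = u + i v] compares the imaginary
    and the real parts. *)
Lemma positive_herm H (x : op H) u v : positive_op x -> '<x u, v> = conjc '<x v, u>.
Proof.
move=> px.
have h1 : complex.Im ('<x u, v> + '<x v, u>) = 0.
  have := px (u + v); rewrite linearD ipDl !ipDr => /ge0_complex.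
  move: (px u) (px v) => /ge0_complex -> /ge0_complex -> /(congr1 (@complex.Im R)).
  by rewrite !ImD /=; lra.
have h2 : complex.Im ('i%C * '<x v, u> - 'i%C * '<x u, v>) = 0.
  have := px (u + 'i%C *: v); rewrite linearD linearZ_LR ipDl !ipDr !ipZl !ipZr => /ge0_complex.
  have -> : conjc 'i%C = - 'i%C :> C by apply: complex_ext; rewrite /= ?oppr0.
  have -> : 'i%C * (- 'i%C * '<x v, v>) = '<x v, v>.
    by rewrite mulrA mulrN -expr2 sqr_i opprK mul1r.
  move: (px u) (px v) => /ge0_complex -> /ge0_complex -> /(congr1 (@complex.Im R)).
  by rewrite mulNr !ImD /=; lra.
move: h1 h2; case: '<x u, v> => a b; case: '<x v, u> => c d /= h1 h2.
by apply: complex_ext => /=; lra.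
Qed.

Lemma positive_adj H (x : op H) : bdd x -> positive_op x -> adj x = x.
Proof.
move=> bx px; apply: adj_eq => // u v.
by rewrite positive_herm// -ipC.
Qed.

Lemma positive_CS H (x : op H) u v : positive_op x ->
  ab '<x u, v> ^+ 2 <= complex.Re '<x u, u> * complex.Re '<x v, v>.
Proof.
move=> px; apply: (@semi_CS R H setT (fun u c v => u + c *: v) (fun u v => '<x u, v>)) => //.
- by move=> u' c v' w _ _ _; rewrite linearD linearZ_LR ipDl ipZl.
- by move=> u' v' _ _; exact: positive_herm.
Qed.

Lemma positive_nr H (x : op H) (N : R) v : positive_op x -> 0 <= N ->
  (forall w, complex.Re '<x w, w> <= N * nr w ^+ 2) ->
  nr (x v) ^+ 2 <= N * complex.Re '<x v, v>.
Proof.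
move=> px N0 hN; have a0 := ge0_Re (px v).
have [r0 hr] : exists2 r, 0 <= r & r ^+ 2 = N * complex.Re '<x v, v>.
  by exists (Num.sqrt (N * complex.Re '<x v, v>)); rewrite ?sqrtr_ge0// sqr_sqrtr// mulr_ge0.
move=> er; rewrite -er ler_pXn2r// ?nnegrE ?nr_ge0//.
apply: nr_le_ip => // w; rewrite -(@ler_pXn2r _ 2)// ?nnegrE ?ab_ge0 ?mulr_ge0 ?nr_ge0//.
apply: le_trans (positive_CS v w px) _; rewrite exprMn er mulrAC mulrC.
by rewrite ler_wpM2r// mulrC.
Qed.

Lemma positive_null H (x : op H) v : bdd x -> positive_op x -> complex.Re '<x v, v> = 0 ->
  x v = 0.
Proof.
move=> [M M0 hM] px v0; apply: ip_ext => w; rewrite ip0l; apply: ab_eq0; apply/eqP.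
by rewrite -sqrf_eq0 eq_le sqr_ge0 andbT (le_trans (positive_CS v w px))// v0 mul0r.
Qed.

Lemma Re_bdd H (x : op H) (M : R) v : (forall v, nr (x v) <= M * nr v) ->
  complex.Re '<x v, v> <= M * nr v ^+ 2.
Proof.
move=> hM; apply: le_trans (Re_ip_le _ _) _; rewrite expr2 mulrA.
by rewrite ler_wpM2r ?nr_ge0.
Qed.

(** Strong convergence controls the finitely many indices in [A], and the uniform bound [N] controls
    the tail. *)
Lemma nf_cvg H (kappa : op H -> C) (x : nat -> op H) (N : R) : nf kappa -> 0 <= N ->
  (forall n v, nr (x n v) <= N * nr v) ->
  (forall v (e : R), 0 < e -> exists m, forall n, (m <= n)%N -> nr (x n v) <= e) ->
  forall e : R, 0 < e -> exists m, forall n, (m <= n)%N -> ab (kappa (x n)) <= e.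
Proof.
move=> [I [u [v [[Mu Mu0 hu] [Mv Mv0 hv] hk]]]] N0 hN hx e e0.
have hs (A : {fset I}) : \sum_(i <- A) nr (u i) * nr (v i) <= Mu * Mv.
  by apply: (CS_sum Mu0 Mv0 _ _ (hu A) (hv A)) => i; exact: nr_ge0.
have d0 : 0 < e / (2 * (N + 1)) by rewrite divr_gt0// mulr_gt0// ltr_wpDl.
have [|A hA] := @tail_small _ _ _ _ _ _ hs d0; first by move=> i; rewrite mulr_ge0 ?nr_ge0.
pose S := \sum_(i <- A) nr (v i) + 1.
have S0 : 0 < S by rewrite ltr_wpDl// sumr_ge0// => i _; exact: nr_ge0.
have c0 : 0 < e / (2 * S) by rewrite divr_gt0// mulr_gt0.
have [m hm] : exists m, forall i, i \in (A : seq I) -> forall n, (m <= n)%N -> nr (x n (u i)) <= e / (2 * S).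
  elim: (A : seq I) => [|i r [m IH]]; first by exists 0%N.
  have [m' hm'] := hx (u i) _ c0; exists (maxn m m') => j; rewrite inE => jr n;
    rewrite geq_max => /andP[h1 h2].
  by case/orP: jr => [/eqP->|jr]; [apply: hm'|apply: IH].
exists m => n mn.
have bx : bdd (x n) by exists N.
apply: (hsum_le (hk _ bx)) => B; apply: le_trans (ler_ab_sum _ _ _) _.
rewrite (big_fsetID _ [in A])/=.
set B1 := [fset _ | _ in _ & _]%fset; set B2 := [fset _ | _ in _ & _]%fset.
have dB : forall i, i \in A -> i \notin B2.
  by move=> i iA; rewrite !inE /= iA andbF.
have sB : (B1 `<=` A)%fset by apply/fsubsetP => i; rewrite !inE /= => /andP[].
have h1 : \sum_(i <- B1) ab '<x n (u i), v i> <= e / 2.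
  apply: (@le_trans _ _ (\sum_(i <- B1) e / (2 * S) * nr (v i))).
    rewrite big_seq [leRHS]big_seq; apply: ler_sum => i /(fsubsetP sB) iA.
    by apply: le_trans (CS _ _) _; rewrite ler_wpM2r ?nr_ge0// hm.
  rewrite -mulr_sumr; apply: (@le_trans _ _ (e / (2 * S) * S)).
    apply: ler_wpM2l; first exact: ltW.
    apply: (@le_trans _ _ (\sum_(i <- A) nr (v i))); last by rewrite lerDl.
    by apply: ler_sum_fset => // i; exact: nr_ge0.
  by rewrite le_eqVlt; apply/orP; left; apply/eqP; field; rewrite gt_eqF.
have h2 : \sum_(i <- B2) ab '<x n (u i), v i> <= e / 2.
  apply: (@le_trans _ _ (\sum_(i <- B2) N * (nr (u i) * nr (v i)))).
    apply: ler_sum => i _; apply: le_trans (CS _ _) _; rewrite mulrA.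
    by rewrite ler_wpM2r ?nr_ge0.
  rewrite -mulr_sumr; apply: (@le_trans _ _ (N * (e / (2 * (N + 1))))).
    by rewrite ler_wpM2l// hA.
  have -> : e / 2 = (N + 1) * (e / (2 * (N + 1))) by field; lra.
  by rewrite ler_wpM2r ?ltW// ltrDl.
by lra.
Qed.

Section Cholesky.
Variables (H : hilbertType R) (x : op H) (e : nat -> H).
Hypotheses (bx : bdd x) (px : positive_op x) (he : is_onb e).

(* [y - cvec y v (cvec y v)^*] is positive and kills [v] (if [y v = 0] the inverse is
   [0^-1 = 0]). *)
Definition cvec (y : op H) (v : H) : H := ((Num.sqrt (complex.Re '<y v, v>))^-1)%:C *: y v.

(** The remainder after [n] elimination steps, as in the Cholesky factorisation of a matrix. *)
Fixpoint crest (n : nat) : op H :=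
  if n is n'.+1 then crest n' \- kb (cvec (crest n') (e n')) (cvec (crest n') (e n')) else x.

Definition cfac n := cvec (crest n) (e n).

Lemma cvec_le (y : op H) v w : positive_op y ->
  ab '<w, cvec y v> ^+ 2 <= complex.Re '<y w, w>.
Proof.
move=> py; rewrite /cvec ipZr conjc_real abM exprMn ab_real.
have a0 := ge0_Re (py v); set a := complex.Re '<y v, v> in a0 *.
have [z|nz] := eqVneq a 0.
  by rewrite z sqrtr0 invr0 normr0 expr0n mul0r ge0_Re.
have ap : 0 < a by rewrite lt_neqAle eq_sym nz.
rewrite normfV exprVn ger0_norm ?sqrtr_ge0// sqr_sqrtr// mulrC ler_pdivrMr//.
by rewrite (ipC w) abJ [leRHS]mulrC; exact: positive_CS.
Qed.

Lemma crest_bdd n : bdd (crest n).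
Proof.
by elim: n => // n IH; exact: (bdd_sub IH (bdd_kb _ _)).
Qed.

Lemma crest_pos n : positive_op (crest n).
Proof.
elim: n => // n IH v /=.
rewrite ipBl ipZl (ipC (cvec _ _) v) sqr_ab (ge0_complex (IH v)) -rmorphB.
by rewrite realc_ge0// subr_ge0 cvec_le.
Qed.

Lemma crestS n v : complex.Re '<crest n.+1 v, v> <= complex.Re '<crest n v, v>.
Proof.
by rewrite /= ipBl ipZl (ipC (cvec _ _) v) sqr_ab ReD ReN /= gerBl sqr_ge0.
Qed.

Lemma crest_kill n i : (i < n)%N -> crest n (e i) = 0.
Proof.
elim: n => // n IH; rewrite ltnS leq_eqVlt => /orP[/eqP->|/IH] /=.
  set y := crest n; have py : positive_op y by exact: crest_pos.
  have a0 := ge0_Re (py (e n)).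
  have [z|nz] := eqVneq (complex.Re '<y (e n), e n>) 0.
    have y0 := positive_null (crest_bdd n) py z.
    by rewrite /cvec -/y y0 scaler0 ip0r scale0r subr0.
  have hc : '<e n, y (e n)> = (complex.Re '<y (e n), e n>)%:C.
    by rewrite ipC ge0_conjc//; exact: ge0_complex.
  rewrite /cvec -/y ipZr conjc_real hc scalerA; move: a0 nz; set a := complex.Re _ => a0 nz.
  rewrite -!rmorphM /= mulrAC -invfM -expr2 sqr_sqrtr// mulVf// scale1r subrr//.
move=> h; rewrite h sub0r /cvec ipZr conjc_real.
rewrite (ipC (e i)) -positive_herm; last exact: crest_pos.
by rewrite h ip0l mulr0 scale0r oppr0.
Qed.

Lemma crest_sum (kappa : op H -> C) n : nf kappa ->
  kappa x = \sum_(0 <= k < n) kappa (kb (cfac k) (cfac k)) + kappa (crest n).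
Proof.
move=> nk; elim: n => [|n IH]; first by rewrite big_geq// add0r.
rewrite big_nat_recr//= IH -addrA; congr (_ + _).
apply: nf_add => //; [exact: bdd_kb|exact: (crest_bdd n.+1)|].
by move=> v /=; rewrite addrC subrK.
Qed.

Lemma crest_cvg (v : H) (d : R) : 0 < d -> exists m, forall n, (m <= n)%N -> nr (crest n v) <= d.
Proof.
move=> d0; case: bx => M M0 hM.
have M1 : 0 < M + 1 by rewrite ltr_wpDl.
have hle n w : complex.Re '<crest n w, w> <= (M + 1) * nr w ^+ 2.
  elim: n => [|n IH]; last exact: le_trans (crestS n w) IH.
  apply: le_trans (Re_bdd _ hM) _; rewrite ler_wpM2r ?sqr_ge0// lerDl//.
have [A hA] := onb_expand he.1 he.2 v (divr_gt0 d0 M1).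
exists (\max_(i <- A) i).+1 => n mn.
pose w := v - fproj e A v.
have -> : crest n v = crest n w.
  rewrite /w linearB /fproj linear_sum big_seq big1 ?subr0// => i iA.
  rewrite linearZ_LR crest_kill ?scaler0//.
  by apply: leq_trans mn; rewrite ltnS (big_rem i)//= leq_maxl.
have hw : nr w <= d / (M + 1) by exact/ltW/hA/fsubset_refl.
have : nr (crest n w) <= (M + 1) * nr w.
  rewrite -(@ler_pXn2r _ 2)// ?nnegrE ?mulr_ge0 ?nr_ge0//; last exact: ltW.
  apply: le_trans (positive_nr w (crest_pos n) (ltW M1) (hle n)) _.
  by rewrite exprMn expr2 -mulrA; apply: ler_wpM2l (hle n w); exact: ltW.
move=> /le_trans; apply; rewrite mulrC -ler_pdivlMr//.
Qed.

(** The remainders stay positive, decrease, and kill [e 0, ..., e (n - 1)], hence tend strongly to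
    [0]. In place of a square root, this reduces statements on positive operators to the rank-one
    operators [kb (cfac k) (cfac k)]. *)
Lemma cholesky (kappa : op H -> C) : nf kappa ->
  (forall k, 0 <= kappa (kb (cfac k) (cfac k))) ->
  hsum (fun k => kappa (kb (cfac k) (cfac k))) (kappa x).
Proof.
move=> nk pk.
have lim (d : R) : 0 < d -> exists m, forall n, (m <= n)%N ->
    ab (\sum_(0 <= k < n) kappa (kb (cfac k) (cfac k)) - kappa x) <= d.
  case: bx => M M0 hM.
  have hle n w : complex.Re '<crest n w, w> <= M * nr w ^+ 2.
    elim: n => [|n IH]; last exact: le_trans (crestS n w) IH.
    exact: Re_bdd.
  have hb n w : nr (crest n w) <= M * nr w.
    rewrite -(@ler_pXn2r _ 2)// ?nnegrE ?mulr_ge0 ?nr_ge0//.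
    apply: le_trans (positive_nr w (crest_pos n) M0 (hle n)) _.
    by rewrite exprMn expr2 -mulrA ler_wpM2l.
  move=> /(nf_cvg nk M0 hb crest_cvg)[m hm]; exists m => n mn.
  by rewrite (crest_sum n nk) opprD addrA subrr sub0r abN hm.
pose g k := complex.Re (kappa (kb (cfac k) (cfac k))).
have eg k : kappa (kb (cfac k) (cfac k)) = (g k)%:C by exact: ge0_complex.
have g0 k : 0 <= g k by exact: ge0_Re.
have hg (A : {fset nat}) : \sum_(i <- A) g i <= complex.Re (kappa x) + 1.
  have [m hm] := lim 1 ltr01.
  pose n := maxn m (\max_(i <- A) i).+1.
  apply: (@le_trans _ _ (\sum_(0 <= k < n) g k)).
    have -> : \sum_(0 <= k < n) g k = \sum_(k <- [fset k in iota 0 n]%fset) g k.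
      apply: perm_big; apply: uniq_perm; [exact: iota_uniq|exact: fset_uniq|].
      by move=> k; rewrite /index_iota subn0 !inE.
    apply: ler_sum_fset => //; apply/fsubsetP => i iA.
    rewrite !inE /= mem_iota /= add0n /n; apply: leq_trans (leq_maxr _ _).
    by rewrite ltnS (big_rem i)//= leq_maxl.
  have := hm n (leq_maxl _ _); move=> /(le_trans (Re_le _)).
  rewrite ReD ReN Re_sum; lra.
have [s [hs _]] := asum_hsum_nneg g0 hg.
have hs' : hsum (fun k => kappa (kb (cfac k) (cfac k))) s%:C.
  by apply: eq_hsum hs => k; rewrite eg.
suff <- : s%:C = kappa x by [].
apply: (nat_hsum hs') => d d0.
have [m hm] := lim (d / 2) (divr_gt0 d0 (ltr0Sn _ 1)).
by exists m => n /hm /le_lt_trans; apply; lra.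
Qed.
End Cholesky.

Lemma cvH_comb H (f g : nat -> H) l l' (a : C) : cvH f l -> cvH g l' ->
  cvH (fun n => a *: f n + g n) (a *: l + l').
Proof.
move=> hf hg d d0; have a1 : 0 < 2 * (ab a + 1) by rewrite mulr_gt0// ltr_wpDl ?ab_ge0.
have [m hm] := hf _ (divr_gt0 d0 a1); have [m' hm'] := hg _ (divr_gt0 d0 (ltr0Sn _ 1)).
exists (maxn m m') => n; rewrite geq_max => /andP[/hm h1 /hm' h2].
have -> : a *: f n + g n - (a *: l + l') = a *: (f n - l) + (g n - l').
  by rewrite scalerBr opprD addrACA.
apply: le_lt_trans (ler_nrD _ _) _; rewrite nrZ.
have h3 : ab a * nr (f n - l) <= (ab a + 1) * (d / (2 * (ab a + 1))).
  by apply: ler_pM; rewrite ?ab_ge0 ?nr_ge0 ?lerDl// ltW.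
have e1 : (ab a + 1) * (d / (2 * (ab a + 1))) = d / 2.
  by field; have := ab_ge0 a => ?; rewrite gt_eqF// ltr_wpDl.
by lra.
Qed.

Section Powers.
Variables (H : hilbertType R) (g : op H).
Hypotheses (pg : positive_op g) (hg : forall v, nr (g v) <= nr v).

Local Notation gp n v := (iter n g v).

Lemma gp_lin n : linear (fun v => gp n v).
Proof. by elim: n => // n IH a u v /=; rewrite IH linearP. Qed.

Lemma gp_nr n v : nr (gp n v) <= nr v.
Proof. by elim: n => //= n; apply: le_trans (hg _). Qed.

Lemma bdd_contraction : bdd g.
Proof. by exists 1 => // v; rewrite mul1r. Qed.

Lemma gp_herm n u v : '<gp n u, v> = '<u, gp n v>.
Proof.
elim: n u => // n IH u; rewrite iterSr IH iterS.
by rewrite adjP ?positive_adj//; exact: bdd_contraction.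
Qed.

Let a n v := complex.Re '<gp n v, v>.

(** Moving half of the factors to the other side shows that all powers of [g] are positive, without
    a square root of [g]. *)
Lemma gp_half n v : '<gp n v, v> = '<gp (odd n) (gp n./2 v), gp n./2 v>.
Proof.
have e : n = (n./2 + (odd n + n./2))%N by rewrite -[LHS]odd_double_half -addnn addnCA.
by rewrite {1}e !iterD gp_herm.
Qed.

Lemma gp_ge0 n v : 0 <= '<gp n v, v>.
Proof. by rewrite gp_half; case: (odd n) => /=; [exact: pg|exact: ip_ge0]. Qed.

Lemma gp_ip m n v : '<gp m v, gp n v> = (a (n + m) v)%:C.
Proof. by rewrite -gp_herm -iterD; apply: ge0_complex; exact: gp_ge0. Qed.

Lemma Re_gp_le w : complex.Re '<g w, w> <= nr w ^+ 2.
Proof.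
apply: le_trans (Re_ip_le _ _) _; rewrite expr2.
by apply: ler_wpM2r => //; exact: nr_ge0.
Qed.

Lemma a_mono n v : a n.+1 v <= a n v.
Proof.
rewrite /a [X in _ <= complex.Re X]gp_half [X in complex.Re X <= _]gp_half /= uphalf_half.
case: (odd n) => /=; rewrite ?add1n ?add0n /=; last first.
  by rewrite -sqr_nr; exact: Re_gp_le.
set w := gp _ v; rewrite -sqr_nr -[leRHS]mul1r; apply: positive_nr => // u.
by rewrite mul1r; exact: Re_gp_le.
Qed.

Lemma a_anti m n v : (m <= n)%N -> a n v <= a m v.
Proof.
move=> /subnK <-; elim: (n - m)%N => // k IH; rewrite addSn.
exact: le_trans (a_mono _ _) IH.
Qed.

(** [|g^i v - g^j v|^2 = a (2i) + a (2j) - 2 a (i + j)], and [a] decreases to its infimum. *)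
Lemma gp_cauchy v : exists l, cvH (fun n => gp n v) l.
Proof.
apply: cauchyH => d d0.
have d2 : 0 < d ^+ 2 / 4 by rewrite divr_gt0 ?exprn_gt0.
pose A := [set a n v | n in [set: nat]].
have hA : has_inf A.
  split; first by exists (a 0 v), 0%N.
  by exists 0 => _ [n _ <-]; exact/ge0_Re/gp_ge0.
have [_ [m _ <-] hm] := inf_adherent d2 hA.
have hl n : inf A <= a n v by apply: ge_inf; [exact: hA.2|exists n].
exists m => i j mi mj; rewrite -(@ltr_pXn2r _ 2)// ?nnegrE ?nr_ge0//; last exact: ltW.
rewrite sqr_nrB !sqr_nr !gp_ip /= mulr2n.
have h1 : a (i + i) v < inf A + d ^+ 2 / 4.
  by apply: le_lt_trans hm; apply: a_anti; rewrite (leq_trans mi)// leq_addr.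
have h2 : a (j + j) v < inf A + d ^+ 2 / 4.
  by apply: le_lt_trans hm; apply: a_anti; rewrite (leq_trans mj)// leq_addr.
have h3 := hl (j + i)%N.
have d4 : 0 < d ^+ 2 by rewrite exprn_gt0.
by lra.
Qed.

(** The strong limit of [g^n] is the projection onto the fixed vectors of [g], that is, its spectral
    projection at [1]. *)
Lemma power_limit : exists p : op H, [/\ bdd p, p \o p = p :> op _, adj p = p,
  g \o p = p :> op _ & forall v, cvH (fun n => gp n v) (p v)].
Proof.
pose f v := projT1 (cid (gp_cauchy v)).
have hf v : cvH (fun n => gp n v) (f v) := projT2 (cid (gp_cauchy v)).
have lf : linear f.
  move=> c u v; apply: (cvH_unique (hf _)).
  move=> d d0; have [m hm] := cvH_comb c (hf u) (hf v) d0; exists m => n /hm.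
  by rewrite gp_lin.
pose p : op H := mklin lf.
have np v : nr (p v) <= nr v by apply: (cvH_nr_le (hf v)) => n; exact: gp_nr.
have bp : bdd p by exists 1 => // v; rewrite mul1r.
have gpp v : g (p v) = p v.
  have h := bdd_cvH bdd_contraction (hf v).
  apply: (cvH_unique h) => d d0; have [m hm] := hf v d d0; exists m => n mn.
  exact: (hm n.+1 (leqW mn)).
have gnp n v : gp n (p v) = p v by elim: n => //= n ->.
have ppp v : p (p v) = p v.
  apply: (cvH_unique (hf (p v))) => d d0; exists 0%N => n _.
  by rewrite gnp subrr nr0.
have adjp u v : '<p u, v> = '<u, p v>.
  apply/eqP; rewrite -subr_eq0; apply/eqP; apply: ab_small0 => d d0.
  have d2 : 0 < d / 2 by rewrite divr_gt0.
  have [m hm] := cvH_ip v (hf u) d2; have [m' hm'] := cvH_ip u (hf v) d2.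
  have := hm _ (leq_maxl m m'); have := hm' _ (leq_maxr m m').
  set k := maxn m m' => h2 h1.
  have e1 : ab ('<gp k u, v> - '<u, p v>) < d / 2.
    by rewrite gp_herm ipC [X in _ - X]ipC -conjcB abJ.
  rewrite abC in h1.
  have -> : '<p u, v> - '<u, p v> = ('<p u, v> - '<gp k u, v>) + ('<gp k u, v> - '<u, p v>) by ring.
  apply: le_trans (ler_abD _ _) _.
  have h3 : ab ('<p u, v> - '<gp k u, v>) < d / 2 := h1; lra.
exists p; split => //; [exact: op_ext|exact: adj_eq|exact: op_ext].
Qed.

(** [g] is the identity on the range of [p] and respects the orthogonal complement, where it is
    positive. *)
Lemma power_limit_le (p : op H) v : bdd p -> p \o p = p :> op _ -> adj p = p ->
  g \o p = p :> op _ -> complex.Re '<p v, v> <= complex.Re '<g v, v>.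
Proof.
move=> bp pp ap gp'.
have gpE u : g (p u) = p u by have /(congr1 (fun f : op H => f u)) := gp'.
have ppE u : p (p u) = p u by have /(congr1 (fun f : op H => f u)) := pp.
pose w := v - p v.
have pw : p w = 0 by rewrite /w linearB ppE subrr.
have ev : v = p v + w by rewrite /w addrC subrK.
have h1 : '<w, p v> = 0 by have := adjP w v bp; rewrite ap pw ip0l.
have h2 : '<g w, p v> = 0 by rewrite (gp_herm 1 w (p v)) /= gpE.
have gv : g v = p v + g w by rewrite {1}ev linearD gpE.
have gw : '<g w, v> = '<g w, w>.
  have : '<g w, (p v + w)> = '<g w, w> by rewrite ipDr h2 add0r.
  by rewrite -ev.
have e1 : '<g v, v> = '<p v, v> + '<g w, w> by rewrite gv ipDl gw.
by rewrite e1 ReD lerDl; exact/ge0_Re/pg.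
Qed.

(* If [g ^ n] tended to [0] strongly, some [g ^ m] would have Hilbert-Schmidt norm at
   most [1/2], although [g] almost fixes some unit vector. *)
Lemma power_limit_neq0 (e : nat -> H) (L : C) : is_onb e ->
  hsum (fun i => '<g (e i), e i>) L ->
  (forall d : R, 0 < d -> exists2 xi : H, '<xi, xi> = 1 & 1 - d <= complex.Re '<g xi, xi>) ->
  exists v, ~ cvH (fun n => gp n v) 0.
Proof.
move=> he hL hsup; apply: contrapT => /forallNP h0.
have {}h0 v : cvH (fun n => gp n v) 0 by apply: contrapT; exact: h0.
pose f i := complex.Re '<g (e i), e i>.
have f0 i : 0 <= f i by exact/ge0_Re.
have hm (A : {fset nat}) : \sum_(i <- A) f i <= complex.Re L.
  by apply: sum_le_hsum => //; case: (hsum_ge0_real (fun i => pg (e i)) hL).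
(* Head and tail of the basis contribute [1/8] each to the squared Hilbert-Schmidt norm, which makes
   the norm at most [1/2]. *)
have d8 : 0 < 8^-1 :> R by rewrite invr_gt0.
have [A hA] := tail_small f0 hm d8.
have [m hmA] : exists m, forall n, (m <= n)%N -> \sum_(i <- A) nr (gp n (e i)) ^+ 2 <= 8^-1.
  elim: (enum_fset A) 8^-1 d8 => [d d0|i r IH d d0].
    by exists 0%N => n _; rewrite big_nil ltW.
  have d2 : 0 < d / 2 by rewrite divr_gt0.
  have [m1 h1] := IH _ d2.
  have [m2 h2] : exists m2, forall n, (m2 <= n)%N -> nr (gp n (e i)) ^+ 2 <= d / 2.
    have r0 : 0 < Num.sqrt (d / 2) by rewrite sqrtr_gt0.
    have [m2 h2] := h0 (e i) _ r0; exists m2 => n /h2; rewrite subr0 => h.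
    by rewrite -(sqr_sqrtr (ltW d2)) ler_pXn2r ?nnegrE ?nr_ge0// ?sqrtr_ge0// ltW.
  exists (maxn m1 m2) => n; rewrite geq_max => /andP[/h1 k1 /h2 k2].
  by rewrite big_cons; lra.
(* The exponent is [m.+1] because the tail estimate [|g^(m+1) (e i)|^2 = a (2m + 2) <= a 1 = f i]
   requires a positive one. *)
have hS (B : {fset nat}) : \sum_(i <- B) nr (gp m.+1 (e i)) ^+ 2 <= 4^-1.
  rewrite (big_fsetID _ [in A])/=.
  set B1 := [fset _ | _ in _ & _]%fset; set B2 := [fset _ | _ in _ & _]%fset.
  have dB : forall i, i \in A -> i \notin B2 by move=> i iA; rewrite !inE /= iA andbF.
  have sB : (B1 `<=` A)%fset by apply/fsubsetP => i; rewrite !inE /= => /andP[].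
  have k1 : \sum_(i <- B1) nr (gp m.+1 (e i)) ^+ 2 <= 8^-1.
    apply: le_trans (hmA _ (leqnSn m)).
    by apply: (ler_sum_fset _ sB) => i; exact: sqr_ge0.
  have k2 : \sum_(i <- B2) nr (gp m.+1 (e i)) ^+ 2 <= 8^-1.
    apply: le_trans (hA _ dB); apply: ler_sum => i _.
    by rewrite sqr_nr gp_ip /=; exact: (@a_anti 1 (m.+1 + m.+1) (e i)).
  by lra.
have hs xi : nr (gp m.+1 xi) ^+ 2 <= nr xi ^+ 2 / 4.
  have := hsum_le (parseval_sqr he.1 he.2 (gp m.+1 xi)); rewrite ab_real ger0_norm ?sqr_ge0//.
  apply => B; rewrite -realc_sum ab_real ger0_norm; last by apply: sumr_ge0 => i _; exact: sqr_ge0.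
  apply: (@le_trans _ _ (\sum_(i <- B) nr xi ^+ 2 * nr (gp m.+1 (e i)) ^+ 2)).
    apply: ler_sum => i _; rewrite gp_herm -exprMn.
    by rewrite ler_pXn2r ?nnegrE ?ab_ge0 ?mulr_ge0 ?nr_ge0//; exact: CS.
  by rewrite -mulr_sumr ler_wpM2l ?sqr_ge0.
pose k : R := m.+1%:R; have k0 : 0 < k by rewrite ltr0n.
(* [|g xi - xi| <= s0], so [m + 1] applications of [g] move the unit vector [xi] by at most [1/4];
   this leaves length at least [3/4], against the bound [1/2]. *)
pose s0 : R := (4 * k)^-1; have s00 : 0 < s0 by rewrite invr_gt0 mulr_gt0.
have [|xi xi1 hxi] := hsup (s0 ^+ 2 / 2); first by rewrite divr_gt0// exprn_gt0.
have nxi : nr xi ^+ 2 = 1 by rewrite sqr_nr xi1.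
have nxi1 : nr xi = 1 by apply/eqP; rewrite -(@eqrXn2 _ 2)// ?nr_ge0// nxi expr1n.
have h1 : nr (g xi - xi) <= s0.
  rewrite -(@ler_pXn2r _ 2)// ?nnegrE ?nr_ge0 ?(ltW s00)// sqr_nrB mulr2n nxi.
  have : nr (g xi) ^+ 2 <= 1 by rewrite -nxi ler_pXn2r// ?nnegrE ?nr_ge0.
  by lra.
have h2 n : nr (gp n xi - xi) <= n%:R * s0.
  elim: n => [|n IH]; first by rewrite subrr nr0 mul0r.
  rewrite iterS; have -> : g (gp n xi) - xi = g (gp n xi - xi) + (g xi - xi).
    by rewrite linearB addrA subrK.
  apply: le_trans (ler_nrD _ _) _; have := hg (gp n xi - xi).
  by rewrite -natr1 mulrDl mul1r; lra.
have h3 := h2 m.+1.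
have e3 : m.+1%:R * s0 = 4^-1 by rewrite -/k /s0; field; rewrite gt_eqF.
have h4 : nr (gp m.+1 xi) <= 2^-1.
  rewrite -(@ler_pXn2r _ 2)// ?nnegrE ?nr_ge0// ?invr_ge0//.
  by apply: le_trans (hs xi) _; rewrite nxi; lra.
have : nr xi <= nr (gp m.+1 xi) + nr (gp m.+1 xi - xi).
  rewrite [X in _ <= _ + X]nrC; have := ler_nrD (gp m.+1 xi) (xi - gp m.+1 xi).
  by rewrite addrC subrK.
by rewrite nxi1; rewrite e3 in h3; lra.
Qed.
End Powers.
End PositiveOperators.

(** * Traces as sums in the extended reals *)

Section Traces.
Variable R : realType.
Local Notation C := R[i].
Implicit Types H K W : hilbertType R.

Lemma esum_swap (I J : choiceType) (a : I -> J -> \bar R) : (forall i j, (0 <= a i j)%E) ->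
  (\esum_(i in [set: I]) \esum_(j in [set: J]) a i j =
   \esum_(j in [set: J]) \esum_(i in [set: I]) a i j)%E.
Proof.
move=> a0; rewrite !esum_esum//.
rewrite (@reindex_esum _ _ _ (setT `*`` fun=> setT) (setT `*`` fun=> setT)
  (fun z : J * I => (z.2, z.1)) (fun k : I * J => a k.1 k.2)).
  by apply: eq_esum => -[].
by split => [|[? ?] [? ?] _ _ [-> ->]|[i j] _] //; exists (j, i).
Qed.

Lemma esumZ (I : choiceType) (a : I -> \bar R) (r : R) : 0 <= r -> (forall i, (0 <= a i)%E) ->
  (\esum_(i in [set: I]) (r%:E * a i) = r%:E * \esum_(i in [set: I]) a i)%E.
Proof.
move=> r0 a0.
have le (s : R) (b : I -> \bar R) : 0 <= s -> (forall i, (0 <= b i)%E) ->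
    (\esum_(i in [set: I]) (s%:E * b i) <= s%:E * \esum_(i in [set: I]) b i)%E.
  move=> s0 b0; apply: ge_ereal_sup => _ [X [finX _] <-].
  rewrite -ge0_mule_fsumr//; apply: lee_wpmul2l; first by rewrite lee_fin.
  by apply: esum_ge; exists X.
have [->|rn] := eqVneq r 0.
  by rewrite mul0e esum1// => i _; rewrite mul0e.
apply/eqP; rewrite eq_le le//=.
have rp : 0 < r by rewrite lt_neqAle eq_sym rn.
have := le r^-1 (fun i => r%:E * a i)%E; rewrite invr_ge0 => /(_ r0) h.
have {}h : (\esum_(i in [set: I]) (r^-1%:E * (r%:E * a i)) <=
    r^-1%:E * \esum_(i in [set: I]) (r%:E * a i))%E.
  by apply: h => i; rewrite mule_ge0// lee_fin.
have -> : (\esum_(i in [set: I]) a i = \esum_(i in [set: I]) (r^-1%:E * (r%:E * a i)))%E.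
  by apply: eq_esum => i _; rewrite muleA -EFinM mulVf// mul1e.
apply: le_trans (lee_wpmul2l _ h) _; first by rewrite lee_fin.
by rewrite muleA -EFinM mulfV// mul1e.
Qed.

Lemma hsum_esum_Re (I : choiceType) (c : I -> C) (s : C) : (forall i, 0 <= c i) -> hsum c s ->
  (\esum_(i in [set: I]) (complex.Re (c i))%:E = (complex.Re s)%:E)%E.
Proof.
move=> c0 /(hsum_ge0_real c0)[_]; apply: esum_hsum => i; exact/ge0_Re.
Qed.

Lemma esum_term (I : choiceType) (a : I -> \bar R) (i : I) :
  (a i <= \esum_(i in [set: I]) a i)%E.
Proof. by apply: esum_ge; exists [set i]; [split|rewrite fsbig_set1]. Qed.

Lemma esum_eq0 (I : choiceType) (a : I -> \bar R) (i : I) : (forall i, (0 <= a i)%E) ->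
  (\esum_(i in [set: I]) a i = 0)%E -> a i = 0%E.
Proof. by move=> a0 h; apply/eqP; rewrite eq_le a0 andbT -h esum_term. Qed.

Definition etr H (I : choiceType) (e : I -> H) (x : op H) : \bar R :=
  (\esum_(i in [set: I]) (complex.Re '<x (e i), e i>)%:E)%E.
Lemma etr_ge0 H (I : choiceType) (e : I -> H) (x : op H) : positive_op x -> (0 <= etr e x)%E.
Proof. by move=> px; apply: esum_ge0 => i _; rewrite lee_fin; exact/ge0_Re. Qed.

Lemma etr_parseval H (I : choiceType) (e : I -> H) (f : H) : onf e -> total_family e ->
  (\esum_(i in [set: I]) (ab '<f, e i> ^+ 2)%:E = (nr f ^+ 2)%:E)%E.
Proof.
move=> o t; apply: esum_hsum (parseval_sqr o t f) => i; exact: sqr_ge0.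
Qed.

(** By Parseval each rank-one summand has trace [nr (cfac x e k) ^+ 2] in any basis [d]. The right
    side does not involve [d], so the trace is independent of the basis. *)
Lemma etr_cholesky H (x : op H) (e : nat -> H) (I : choiceType) (d : I -> H) :
  bdd x -> positive_op x -> is_onb e -> onf d -> total_family d ->
  etr d x = (\esum_(k in [set: nat]) (nr (cfac x e k) ^+ 2)%:E)%E.
Proof.
move=> bx px he od td.
have h i : (complex.Re '<x (d i), d i>)%:E =
    (\esum_(k in [set: nat]) (ab '<cfac x e k, d i> ^+ 2)%:E)%E.
  have q k : '<kb (cfac x e k) (cfac x e k) (d i), d i> = (ab '<cfac x e k, d i> ^+ 2)%:C.
    by rewrite /= ipZl (ipC (d i)) mulrC sqr_ab.
  rewrite -(hsum_esum_Re _ (cholesky bx px he (nf_vec (d i) (d i)) _)).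
  - by apply: eq_esum => k _; rewrite q.
  - by move=> k; rewrite q realc_ge0// sqr_ge0.
  - by move=> k; rewrite q realc_ge0// sqr_ge0.
rewrite /etr (eq_esum (fun i _ => h i)) esum_swap; last first.
  by move=> i j; rewrite lee_fin sqr_ge0.
by apply: eq_esum => k _; exact: etr_parseval.
Qed.

Lemma op_trace_etr H (E : set H) (x : op H) :
  op_trace E x = etr (fun i : set_type E => val i) x.
Proof.
rewrite /op_trace /etr (@reindex_esum _ _ _ setT E (fun i : set_type E => val i))//.
split=> [i _|i j _ _ /val_inj//|v Ev]; first exact: set_valP.
by exists (SigSub (mem_set Ev)).
Qed.

Lemma onb_set_type H (E : set H) : orthonormal_basis E ->
  onf (fun i : set_type E => val i) /\ total_family (fun i : set_type E => val i).
Proof.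
move=> [h1 h2 h3]; split; last first.
  by move=> v hv; apply: h3 => f Ef; exact: (hv (SigSub (mem_set Ef))).
split=> [i j ij|i]; last by left; apply: h1; exact: set_valP.
apply: h2; try exact: set_valP.
by move=> /val_inj e; rewrite e eqxx in ij.
Qed.
End Traces.

(** * Coactions on the bounded operators *)

Section Core.
Variable R : realType.
Local Notation C := R[i].
(** [F] and [G] stand for [Delta (x) id] and [id (x) alpha]. They are accessible through normality,
    multiplicativity and their values on elementary tensors, and [hFG] links them. [t] is the
    invariant trace, extended to a normal functional on all bounded operators. *)
Variables (T : hilbert_tensor R) (K H : hilbertType R).
Variables (M : set (op K)) (Delta : op K -> op (T K K)) (alpha : op H -> op (T K H)).
Variables (t : op K -> C) (Sl0 Sr0 : op (T K K) -> op K).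
Variables (F : op (T K H) -> op (T (T K K) H)) (G : op (T K H) -> op (T K (T K H))).

Local Notation htt K H := (istens_tens T K H).
Local Notation BH := (@bounded_op R H).
Local Notation MB := (vN_tensor T M BH).
Local Notation MM := (vN_tensor T M M).
Local Notation lW := (tl (htt K H)).
Local Notation rW := (tr (htt K H)).
Local Notation l2 := (tl (htt K K)).
Local Notation r2 := (tr (htt K K)).
Local Notation lF := (tl (htt (T K K) H)).
Local Notation rF := (tr (htt (T K K) H)).
Local Notation lG := (tl (htt K (T K H))).
Local Notation rG := (tr (htt K (T K H))).
Local Notation SlW := (Sl (htt K H)).
Local Notation Sl2 := (Sl (htt K K)).
Local Notation SlG := (Sl (htt K (T K H))).
Local Notation pfW := (pf (htt K H)).
Local Notation pf2 := (pf (htt K K)).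
Local Notation pfG := (pf (htt K (T K H))).

Hypothesis vM : von_neumann_algebra M.
Hypothesis vB : von_neumann_algebra BH.
Hypothesis hD : normal_star_hom M MM Delta.
Hypothesis nt : nf t.
Hypothesis t1 : t (idop K) = 1.
Hypothesis tpos : forall x, M x -> positive_op x -> 0 <= t x.
Hypothesis ttr : forall x y, M x -> M y -> t (x \o y) = t (y \o x).
Hypothesis hSl0 : left_slice M M t Sl0.
Hypothesis hSr0 : right_slice M M t Sr0.
Hypothesis hinv : forall x, M x -> Sl0 (Delta x) =1 t x \*: idop K /\
                                   Sr0 (Delta x) =1 t x \*: idop K.
Hypothesis ha : normal_star_hom BH MB alpha.
Hypothesis hF : hom_tens M BH MM BH Delta id F.
Hypothesis hG : hom_tens M BH M MB id alpha G.
Hypothesis hFG : forall x, BH x -> assoc_eq (F (alpha x)) (G (alpha x)).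

Implicit Types (a b c : op H) (x p q : op K) (Z : op (T K H)) (Y : op (T K K)).

(** * Closure properties and values on elementary tensors *)

Lemma BHP (x : op H) : BH x <-> bdd x.
Proof. exact: bdd_continuous. Qed.

Let sM : staralg M := staralg_vN vM.
Let sB : staralg BH := staralg_vN vB.
Let sMB : staralg MB := staralg_vNt T sM sB.
Let sMM : staralg MM := staralg_vNt T sM sM.

Lemma M_bdd x : M x -> bdd x.
Proof. by case: sM => + _ _ _; exact. Qed.
Lemma M_comp x y : M x -> M y -> M (x \o y).
Proof. by case: sM => _ _ + _; exact. Qed.
Lemma M_adj x : M x -> M (adj x).
Proof. by case: sM => _ _ _; exact. Qed.
Lemma M_id : M (idop K).
Proof. by case: sM. Qed.
Lemma MB_bdd Z : MB Z -> bdd Z.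
Proof. exact: commutant_bdd. Qed.
Lemma MM_bdd Y : MM Y -> bdd Y.
Proof. exact: commutant_bdd. Qed.
Lemma MB_comp Z Z' : MB Z -> MB Z' -> MB (Z \o Z').
Proof. by case: sMB => _ _ + _; exact. Qed.
Lemma MM_comp Y Y' : MM Y -> MM Y' -> MM (Y \o Y').
Proof. by case: sMM => _ _ + _; exact. Qed.
Lemma MB_adj Z : MB Z -> MB (adj Z).
Proof. by case: sMB => _ _ _; exact. Qed.
Lemma MB_tl x : M x -> MB (lW x).
Proof. by move=> Mx; exact: vNt_tl. Qed.
Lemma MB_tr (y : op H) : bdd y -> MB (rW y).
Proof. by move=> bY; apply: (vNt_tr T sM sB); apply/BHP. Qed.
Lemma MB_tltr x (y : op H) : M x -> bdd y -> MB (lW x \o rW y).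
Proof. by move=> Mx bY; apply: (vNt_tltr T sM sB) => //; apply/BHP. Qed.

Lemma MB_ext (w w' : op (T K H) -> C) z : nf w -> nf w' ->
  (forall x (y : op H), M x -> bdd y -> w (lW x \o rW y) = w' (lW x \o rW y)) ->
  MB z -> w z = w' z.
Proof.
move=> nw nw' h; apply: (vNt_ext sM sB nw nw') => x y Mx /BHP; exact: h.
Qed.

Lemma MM_ext (w w' : op (T K K) -> C) z : nf w -> nf w' ->
  (forall x y, M x -> M y -> w (l2 x \o r2 y) = w' (l2 x \o r2 y)) ->
  MM z -> w z = w' z.
Proof. exact: (vNt_ext sM sM). Qed.

Lemma alphaP a : bdd a -> MB (alpha a).
Proof. by move=> /BHP; case: ha => -[h _ _] _ _ _; exact: h. Qed.
Lemma bdd_alpha a : bdd a -> bdd (alpha a).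
Proof. by move=> /alphaP /MB_bdd. Qed.
Lemma alphaM (a b : op H) : bdd a -> bdd b -> alpha (a \o b) = alpha a \o alpha b :> op _.
Proof. by move=> /BHP ba /BHP bb; apply: op_ext; case: ha => _ h _ _; exact: h. Qed.
Lemma alpha1 : alpha (idop H) = idop (T K H).
Proof. by apply: op_ext; case: ha. Qed.
Lemma alphaA (a : op H) : bdd a -> adj (alpha a) = alpha (adj a).
Proof.
move=> ba; apply: adj_eq; first exact: bdd_alpha.
case: ha => _ _ h _; apply: h; [exact/BHP|exact/BHP/bdd_adj|].
by move=> u v; rewrite adjP.
Qed.
Lemma alpha_linear (c : C) (a b z : op H) : bdd a -> bdd b -> (forall v, z v = c *: a v + b v) ->
  forall v, alpha z v = c *: alpha a v + alpha b v.
Proof.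
move=> /BHP ba /BHP bb hz v; case: ha => -[_ h _] _ _ _.
by have /= <- := h c a b ba bb v; congr (alpha _ _); apply: op_ext => u; rewrite hz.
Qed.
Lemma alpha_nf kappa : nf kappa ->
  exists2 kappa', nf kappa' & forall a, bdd a -> kappa' a = kappa (alpha a).
Proof.
move=> nk; case: ha => hn _ _ _.
have [||k' nk' hk'] := normal_nf _ _ hn nk.
- by move=> x /BHP.
- exact: MB_bdd.
by exists k' => // a /BHP; exact: hk'.
Qed.

Lemma DeltaP x : M x -> MM (Delta x).
Proof. by case: hD => -[h _ _] _ _ _; exact: h. Qed.
Lemma DeltaM x y : M x -> M y -> Delta (x \o y) = Delta x \o Delta y :> op _.
Proof. by move=> Mx My; apply: op_ext; case: hD => _ h _ _; exact: h. Qed.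

Lemma F_nf kappa : nf kappa ->
  exists2 kappa', nf kappa' & forall Z, MB Z -> kappa' Z = kappa (F Z).
Proof.
move=> nk; case: hF => -[hn _ _ _] _; have [||k' nk' hk'] := normal_nf _ _ hn nk.
- exact: MB_bdd.
- move=> x; exact: commutant_bdd.
by exists k'.
Qed.
Lemma G_nf kappa : nf kappa ->
  exists2 kappa', nf kappa' & forall Z, MB Z -> kappa' Z = kappa (G Z).
Proof.
move=> nk; case: hG => -[hn _ _ _] _; have [||k' nk' hk'] := normal_nf _ _ hn nk.
- exact: MB_bdd.
- move=> x; exact: commutant_bdd.
by exists k'.
Qed.
Lemma F_bdd Z : MB Z -> bdd (F Z).
Proof. by case: hF => -[[h _ _] _ _ _] _ /h; exact: commutant_bdd. Qed.
Lemma G_bdd Z : MB Z -> bdd (G Z).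
Proof. by case: hG => -[[h _ _] _ _ _] _ /h; exact: commutant_bdd. Qed.
Lemma FM Z Z' : MB Z -> MB Z' -> F (Z \o Z') = F Z \o F Z' :> op _.
Proof. by move=> Ma Mb; apply: op_ext; case: hF => -[_ h _ _] _; exact: h. Qed.
Lemma GM Z Z' : MB Z -> MB Z' -> G (Z \o Z') = G Z \o G Z' :> op _.
Proof. by move=> Ma Mb; apply: op_ext; case: hG => -[_ h _ _] _; exact: h. Qed.

Lemma F_elem x (y : op H) : M x -> bdd y -> F (lW x \o rW y) = lF (Delta x) \o rF y.
Proof.
move=> Mx bY; apply: op_tensE => //; first exact/MM_bdd/DeltaP.
  exact/F_bdd/MB_tltr.
case: hF => _ h; apply: h => //; first exact/BHP.
  exact/bdd_continuous/bdd_tltr.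
apply: op_tens_tltr => //; exact: M_bdd.
Qed.

Lemma G_elem x (y : op H) : M x -> bdd y -> G (lW x \o rW y) = lG x \o rG (alpha y).
Proof.
move=> Mx bY; apply: op_tensE; [exact: M_bdd|exact: bdd_alpha|exact/G_bdd/MB_tltr|].
case: hG => _ h; apply: h => //; first exact/BHP.
  exact/bdd_continuous/bdd_tltr.
apply: op_tens_tltr => //; exact: M_bdd.
Qed.

Lemma F_tl x : M x -> F (lW x) = lF (Delta x).
Proof.
by move=> Mx; rewrite (tl_tltr T H x) (F_elem Mx (@bdd_id _ H)) -tl_tltr.
Qed.

Lemma G_tl x : M x -> G (lW x) = lG x.
Proof.
by move=> Mx; rewrite (tl_tltr T H x) (G_elem Mx (@bdd_id _ H)) alpha1 -tl_tltr.
Qed.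

(** * Invariance of the trace and the coaction identity, read through slices *)

Lemma right_invariance w x : nf w -> M x -> pf2 w t (Delta x) = w (idop K) * t x.
Proof.
move=> nw Mx; case: hSr0 => hn hel.
have [||w' nw' hw'] := normal_nf _ _ hn nw; [exact: MM_bdd|exact: M_bdd|].
rewrite (@MM_ext _ w' (Delta x) (nf_pf _ nw nt) nw' _ (DeltaP Mx)).
  rewrite hw'; last exact: DeltaP.
  rewrite mulrC; apply: (nf_scale nw (@bdd_id _ K)) => v.
  exact: (hinv Mx).2.
move=> p q Mp Mq; have bp := M_bdd Mp; have bq := M_bdd Mq.
rewrite pf_tltr// hw'; last exact: (vNt_tltr T sM sM).
rewrite mulrC; apply/esym/(nf_scale nw bp); apply: hel Mq _ _ => //.
  exact/bdd_continuous/bdd_tltr.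
exact: op_tens_tltr.
Qed.

Lemma left_slice_MM Y : MM Y -> Sl2 t Y = Sl0 Y.
Proof.
move=> hY; case: hSl0 => hn hel; apply: op_ext => u; apply: ip_ext => v.
have nv := nf_vec u v.
have [||w' nw' hw'] := normal_nf _ _ hn nv; [exact: MM_bdd|exact: M_bdd|].
rewrite -[RHS](hw' Y hY).
apply: (MM_ext (w := pf2 t (fun x => '<x u, v>))) => //; first exact: nf_pf.
move=> p q Mp Mq; have bp := M_bdd Mp; have bq := M_bdd Mq.
rewrite pf_tltr// hw'; last exact: (vNt_tltr T sM sM).
rewrite (hel p q)//=; first by rewrite ipZl.
  exact/bdd_continuous/bdd_tltr.
exact: op_tens_tltr.
Qed.

Lemma left_invariance x v : M x -> Sl2 t (Delta x) v = t x *: v.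
Proof. by move=> Mx; rewrite left_slice_MM ?(hinv Mx).1//; exact: DeltaP. Qed.

(** Brings in [G] whenever [alpha] is applied to a slice; the coaction identity can then exchange
    [G] for [F]. *)
Lemma slice_G w kappa Z : nf w -> nf kappa -> MB Z ->
  kappa (alpha (SlW w Z)) = pfG w kappa (G Z).
Proof.
move=> nw nk hZ.
have [k' nk' hk'] := alpha_nf nk.
have [g ng hg] := G_nf (nf_pf (htt K (T K H)) nw nk).
rewrite -hk'; last exact: bdd_Sl.
rewrite -(hg _ hZ); apply: (MB_ext (w := pfW w k')) => //; first exact: nf_pf.
move=> x y Mx bY; have bx := M_bdd Mx.
rewrite pf_tltr// hg; last exact: MB_tltr.
rewrite G_elem// pf_tltr//; last exact: bdd_alpha.
by rewrite hk'.
Qed.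

(* [kF] is [w (x) kappa] read through the canonical unitary. *)
Definition transport w kappa (kF : op (T (T K K) H) -> C) :=
  nf kF /\ forall (X : op (T (T K K) H)) (Y : op (T K (T K H))), bdd X -> bdd Y ->
    assoc_eq X Y -> kF X = pfG w kappa Y.

Lemma transport_exists w kappa : nf w -> nf kappa -> exists kF, transport w kappa kF.
Proof.
move=> nw nk; have [kF nF hk] := assoc_nf (nf_pf (htt K (T K H)) nw nk).
by exists kF.
Qed.

Lemma transport_MM w kappa kF Y (c : op H) : nf w -> nf kappa -> transport w kappa kF ->
  MM Y -> bdd c -> kF (lF Y \o rF c) = kappa (lW (Sl2 w Y) \o rW c).
Proof.
move=> nw nk [nF hk] hY bc.
pose k1 (X : op (T K K)) := kF (lF X \o rF c).
have n1 : nf k1 := nf_tl (htt _ _) (nf_mulr (bdd_tr _ c) nF).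
pose k2 (x : op K) := kappa (lW x \o rW c).
have n2 : nf k2 := nf_tl (htt _ _) (nf_mulr (bdd_tr _ c) nk).
apply: (MM_ext (w := k1) (w' := pf2 w k2)) => //; first exact: nf_pf.
move=> p q Mp Mq; have bp := M_bdd Mp; have bq := M_bdd Mq.
rewrite pf_tltr// /k1 (hk _ _ _ _ (assoc_eq_elem T bp bq bc)); try exact: bdd_tltr.
by rewrite pf_tltr//; exact: bdd_tltr.
Qed.

(** Left invariance replaces [Delta q] in the first two legs by the scalar [t q], leaving [1] in the
    second leg. *)
Lemma transport_F kappa kF Z : nf kappa -> transport t kappa kF -> MB Z ->
  kF (F Z) = kappa (rW (SlW t Z)).
Proof.
move=> nk tk hZ; have [g ng hg] := F_nf tk.1.
rewrite -(hg _ hZ).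
have n2 := nf_tr (htt K H) nk.
have -> : kappa (rW (SlW t Z)) = pfW t (fun b => kappa (rW b)) Z by [].
apply: (MB_ext ng (nf_pf (htt K H) nt n2) _ hZ).
move=> q c Mq bc; have bq := M_bdd Mq.
rewrite hg; last exact: MB_tltr.
rewrite F_elem// (transport_MM nt nk tk (DeltaP Mq) bc) pf_tltr//.
apply: (nf_scale nk (bdd_tr _ _)) => v /=.
have -> : lW (Sl2 t (Delta q)) = t q \*: idop (T K H) :> op _.
  apply: (op_eqt (htt K H)); [exact: bdd_tl|exact: bddZ|].
  move=> k h; rewrite tlE; last exact: bdd_Sl.
  by rewrite left_invariance// (tZl (htt K H)).
by [].
Qed.

(** Right invariance: [w (x) t] applied to [Delta q] gives [w 1] times [t q]. *)
Lemma transport_F_inv w omega kF Z : nf w -> nf omega ->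
  transport w (pfW t omega) kF -> MB Z ->
  kF (F Z) = w (idop K) * pfW t omega Z.
Proof.
move=> nw no tk hZ; have [g ng hg] := F_nf tk.1.
have npf := nf_pf (htt K H) nt no.
rewrite -(hg _ hZ); apply: (@MB_ext g (fun z => w (idop K) * pfW t omega z) Z ng (nfZ _ npf) _ hZ).
move=> q c Mq bc; have bq := M_bdd Mq.
rewrite hg; last exact: MB_tltr.
rewrite F_elem// (transport_MM nw npf tk (DeltaP Mq) bc) !pf_tltr//; last exact: bdd_Sl.
by rewrite mulrA; congr (_ * _); exact: right_invariance.
Qed.

(* [Eo] is the conditional expectation onto the fixed points of [alpha]. *)
Definition Ew w a := SlW w (alpha a).
Definition Eo := Ew t.

Lemma bdd_Ew w a : bdd (Ew w a).
Proof. exact: bdd_Sl. Qed.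

Lemma E_Ew w a v : nf w -> bdd a -> Eo (Ew w a) v = w (idop K) *: Eo a v.
Proof.
move=> nw ba; apply: ip_ext => u.
have no := nf_vec v u; have npf := nf_pf (htt K H) nt no.
have [kF tk] := transport_exists nw npf.
have aa := alphaP ba; have e1 := slice_G nw npf aa; rewrite [LHS]e1.
rewrite -(tk.2 _ _ (F_bdd aa) (G_bdd aa) (hFG _)); last exact/BHP.
by rewrite (transport_F_inv nw no tk aa) ipZl.
Qed.

Lemma alpha_E a : bdd a -> alpha (Eo a) = rW (Eo a).
Proof.
move=> ba; apply: op_ext => v; apply: ip_ext => u.
have nk := nf_vec v u; have aa := alphaP ba.
have [kF tk] := transport_exists nt nk.
have e1 := slice_G nt nk aa; rewrite /Eo /Ew [LHS]e1.
rewrite -(tk.2 _ _ (F_bdd aa) (G_bdd aa) (hFG _)); last exact/BHP.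
by rewrite (transport_F nk tk aa).
Qed.

Lemma bdd_lW x : bdd (lW x). Proof. exact: bdd_tl. Qed.
Lemma bdd_rW a : bdd (rW a). Proof. exact: bdd_tr. Qed.

Lemma slice_trace x Z : M x -> MB Z -> SlW t (lW x \o Z) = SlW t (Z \o lW x).
Proof.
move=> Mx hZ; have bx := M_bdd Mx; apply: op_ext => u; apply: ip_ext => v.
have npf := nf_pf (htt K H) nt (nf_vec u v).
apply: (@MB_ext (fun z => pfW t (fun b => '<b u, v>) (lW x \o z))
                (fun z => pfW t (fun b => '<b u, v>) (z \o lW x)) Z _ _ _ hZ).
- exact: nf_mull (bdd_lW x) npf.
- exact: nf_mulr (bdd_lW x) npf.
move=> p c Mp bc; have bp := M_bdd Mp.
have -> : lW x \o (lW p \o rW c) = lW (x \o p) \o rW c :> op _.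
  by rewrite tlM//; apply: op_ext.
have -> : (lW p \o rW c) \o lW x = lW (p \o x) \o rW c :> op _.
  by rewrite tlM//; apply: op_ext => z /=; rewrite -tl_trE.
rewrite (pf_tltr _ nt (nf_vec u v) (bdd_comp bx bp) bc).
by rewrite (pf_tltr _ nt (nf_vec u v) (bdd_comp bp bx) bc) (ttr Mx Mp).
Qed.

Lemma trace2 Y Y' : MM Y -> MM Y' -> pf2 t t (Y \o Y') = pf2 t t (Y' \o Y).
Proof.
move=> hY hY'; have npf := nf_pf (htt K K) nt nt.
have bY := MM_bdd hY; have bY' := MM_bdd hY'.
apply: (@MM_ext (fun z => pf2 t t (z \o Y')) (fun z => pf2 t t (Y' \o z)) Y _ _ _ hY).
- exact: nf_mulr npf.
- exact: nf_mull npf.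
move=> p q Mp Mq; have bp := M_bdd Mp; have bq := M_bdd Mq.
have be := @bdd_tltr _ T _ _ p q.
apply: (@MM_ext (fun z => pf2 t t ((l2 p \o r2 q) \o z))
                (fun z => pf2 t t (z \o (l2 p \o r2 q))) Y' _ _ _ hY').
- exact: nf_mull npf.
- exact: nf_mulr npf.
move=> p' q' Mp' Mq'; have bp' := M_bdd Mp'; have bq' := M_bdd Mq'.
have e (x1 x2 y1 y2 : op K) : bdd x1 -> bdd x2 -> bdd y1 -> bdd y2 ->
    (l2 x1 \o r2 y1) \o (l2 x2 \o r2 y2) = l2 (x1 \o x2) \o r2 (y1 \o y2) :> op _.
  by move=> *; rewrite tlM// trM//; apply: op_ext => z /=; rewrite -tl_trE.
rewrite !e// (pf_tltr _ nt nt (bdd_comp bp bp') (bdd_comp bq bq')).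
rewrite (pf_tltr _ nt nt (bdd_comp bp' bp) (bdd_comp bq' bq)).
by rewrite (ttr Mp Mp') (ttr Mq Mq').
Qed.

(** The coaction identity turns the left side into a functional of
    [F (alpha a) (x (x) 1 (x) 1) F (alpha b)]. On elementary tensors its first two legs are
    [Delta p (x (x) 1) Delta q]; traciality of [t (x) t] changes this into [(x (x) 1) Delta (q p)],
    and right invariance splits off [t x]. *)
Lemma E_sandwich a b x v : bdd a -> bdd b -> M x ->
  Eo (SlW t (alpha a \o lW x \o alpha b)) v = t x *: Eo (a \o b) v.
Proof.
move=> ba bb Mx; apply: ip_ext => u; have bx := M_bdd Mx.
have no := nf_vec v u; have npf := nf_pf (htt K H) nt no.
have [kF tk] := transport_exists nt npf.
have aa := alphaP ba; have ab_ := alphaP bb; have lx := MB_tl Mx.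
have hZ : MB (alpha a \o lW x \o alpha b) by apply: MB_comp => //; exact: MB_comp.
have e1 := slice_G nt npf hZ; rewrite [LHS]e1 {e1}.
have -> : G (alpha a \o lW x \o alpha b) = G (alpha a) \o (lG x \o G (alpha b)) :> op _.
  by rewrite GM//; [rewrite GM// G_tl//; apply: op_ext|exact: MB_comp].
have bl : bdd (lF (l2 x)) by exact: bdd_tl.
rewrite -(tk.2 (F (alpha a) \o (lF (l2 x) \o F (alpha b)))); last first.
- apply: assoc_eq_comp; try exact: F_bdd; try exact: G_bdd.
  + exact: bdd_comp bl (F_bdd ab_).
  + exact: bdd_comp (bdd_tl _ _) (G_bdd ab_).
  + exact/hFG/BHP.
  apply: assoc_eq_comp => //; try exact: F_bdd; try exact: G_bdd; try exact: bdd_tl.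
  + rewrite (tl_tltr T _ (l2 x)) (tl_tltr T _ x) (tl_tltr T (T K H) x).
    have := assoc_eq_elem T bx (@bdd_id _ K) (@bdd_id _ H).
    by rewrite -/(idop K) -/(idop H) -(tl_tltr T H (idop K)) (@tl_id _ _ _ _ _ (htt K H) (idop K)).
  + exact/hFG/BHP.
- by apply: bdd_comp (G_bdd aa) (bdd_comp (bdd_tl _ _) (G_bdd ab_)).
- by apply: bdd_comp (F_bdd aa) (bdd_comp bl (F_bdd ab_)).
have -> : '<(t x *: Eo (a \o b) v), u> = t x * pfW t (fun b0 => '<b0 v, u>) (alpha a \o alpha b).
  by rewrite ipZl /Eo /Ew alphaM.
have [nF _] := tk.
(* The two factors are replaced by elementary tensors one after the other, each time by normality in
   that factor. *)
have key Z Z' : MB Z -> MB Z' -> kF (F Z \o (lF (l2 x) \o F Z')) =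
    t x * pfW t (fun b0 => '<b0 v, u>) (Z \o Z').
  move=> hZ1 hZ2.
  have bF' := F_bdd hZ2; have bZ' := MB_bdd hZ2.
  have [g ng hg] := F_nf (nf_mulr (bdd_comp bl bF') nF).
  rewrite -[LHS](hg Z hZ1).
  apply: (@MB_ext g (fun z => t x * pfW t (fun b0 => '<b0 v, u>) (z \o Z')) Z ng _ _ hZ1).
    exact: nfZ (nf_mulr bZ' npf).
  move=> p c Mp bc; have bp := M_bdd Mp; have he := MB_tltr Mp bc.
  rewrite hg//.
  have [g' ng' hg'] := F_nf (nf_mull (bdd_comp (F_bdd he) bl) nF).
  have -> : F (lW p \o rW c) \o (lF (l2 x) \o F Z') =
            (F (lW p \o rW c) \o lF (l2 x)) \o F Z' :> op _ by apply: op_ext.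
  rewrite -[LHS](hg' Z' hZ2).
  apply: (@MB_ext g' (fun z => t x * pfW t (fun b0 => '<b0 v, u>) ((lW p \o rW c) \o z)) Z' ng' _ _ hZ2).
    exact: nfZ (nf_mull (bdd_tltr _ _ _) npf).
  move=> q d Mq bd; have bq := M_bdd Mq.
  rewrite hg' ?F_elem//; last exact: MB_tltr.
  have -> : (lW p \o rW c) \o (lW q \o rW d) = lW (p \o q) \o rW (c \o d) :> op _.
    by rewrite tlM// trM//; apply: op_ext => z /=; rewrite -tl_trE.
  rewrite (pf_tltr _ nt no (bdd_comp bp bq) (bdd_comp bc bd)).
  have hDp := DeltaP Mp; have hDq := DeltaP Mq.
  have bDp := MM_bdd hDp; have bDq := MM_bdd hDq.
  have hl : MM (l2 x) by exact: vNt_tl.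
  have bl2 : bdd (l2 x) by exact: bdd_tl.
  have -> : (lF (Delta p) \o rF c \o lF (l2 x)) \o (lF (Delta q) \o rF d) =
    lF (Delta p \o (l2 x \o Delta q)) \o rF (c \o d) :> op _.
    rewrite (tlM (htt (T K K) H) bDp (bdd_comp bl2 bDq)) (tlM (htt (T K K) H) bl2 bDq).
    rewrite (trM (htt (T K K) H) bc bd).
    by apply: op_ext => z /=; rewrite -!(tl_trE (htt (T K K) H)).
  have hp : MM (Delta p \o (l2 x \o Delta q)) by apply: MM_comp => //; exact: MM_comp.
  rewrite (transport_MM nt npf tk hp (bdd_comp bc bd)).
  rewrite pf_tltr//; try exact: bdd_Sl; try exact: bdd_comp.
  rewrite -[t (Sl2 t _)]/(pf2 t t _) trace2//; last exact: MM_comp.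
  have -> : (l2 x \o Delta q) \o Delta p = l2 x \o Delta (q \o p) :> op _.
    by rewrite DeltaM//; apply: op_ext.
  rewrite /pf2 /pf Sl_tll//; last exact/MM_bdd/DeltaP/M_comp.
  have nx := nf_mull bx nt.
  rewrite -[t _]/(pf2 (fun y => t (x \o y)) t _) right_invariance//; last exact: M_comp.
  have -> : x \o idop K = x :> op K by apply: op_ext.
  by rewrite mulrA (ttr Mq Mp).
exact: key.
Qed.

Definition Ey x a := SlW t (alpha a \o lW x).

Lemma bdd_Ey x a : bdd (Ey x a).
Proof. exact: bdd_Sl. Qed.

Lemma Ey_Ew x a : M x -> bdd a -> Ey x a = Ew (fun y => t (y \o x)) a.
Proof. by move=> Mx ba; apply: Sl_tlr => //; [exact: bdd_alpha|exact: M_bdd]. Qed.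

Lemma Ey_MB x a : M x -> bdd a -> MB (alpha a \o lW x).
Proof. by move=> Mx ba; apply: MB_comp; [exact: alphaP|exact: MB_tl]. Qed.

Lemma E_Ey x a v : M x -> bdd a -> Eo (Ey x a) v = t x *: Eo a v.
Proof.
move=> Mx ba; rewrite Ey_Ew// E_Ew//; last exact: nf_mulr (M_bdd Mx) nt.
by congr (t _ *: _); apply: op_ext.
Qed.

Lemma MM_ext0 (w : op (T K K) -> C) z : nf w ->
  (forall p q, M p -> M q -> w (l2 p \o r2 q) = 0) -> MM z -> w z = 0.
Proof.
move=> nw h hz; rewrite (@MM_ext w (fun Y => 0 * w Y) z nw (nfZ 0 nw) _ hz) ?mul0r//.
by move=> p q Mp Mq; rewrite h// mul0r.
Qed.

Lemma MB_ext0 (w : op (T K H) -> C) z : nf w ->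
  (forall p c, M p -> bdd c -> w (lW p \o rW c) = 0) -> MB z -> w z = 0.
Proof.
move=> nw h hz; rewrite (@MB_ext w (fun Z => 0 * w Z) z nw (nfZ 0 nw) _ hz) ?mul0r//.
by move=> p c Mp bc; rewrite h// mul0r.
Qed.

(* [1 (x) Ey x a] lies in the ultraweak closure of the span of the elements
   [alpha (Ey p a) (q (x) 1)]: compare the two sides of the coaction identity
   on [Delta x]. *)
Lemma slice_approximation kappa a : nf kappa -> bdd a ->
  (forall p q, M p -> M q -> kappa (alpha (Ey p a) \o lW q) = 0) ->
  forall x, M x -> kappa (rW (Ey x a)) = 0.
Proof.
move=> nk ba h x Mx; have aa := alphaP ba.
have [kF tk] := transport_exists nt nk.
have [nF hk] := tk.
rewrite -(transport_F nk tk (Ey_MB Mx ba)) FM//; last exact: MB_tl.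
rewrite F_tl//.
pose N (z : op (T K K)) := kF (F (alpha a) \o lF z).
have nN : nf N := nf_tl (htt (T K K) H) (nf_mull (F_bdd aa) nF).
rewrite -[LHS]/(N (Delta x)).
apply: (MM_ext0 nN _ (DeltaP Mx)) => p q Mp Mq; rewrite /N.
have bp := M_bdd Mp; have bq := M_bdd Mq.
have bE := bdd_tltr T p q.
rewrite (hk _ (G (alpha a) \o (lG p \o rG (lW q)))); last first.
- apply: assoc_eq_comp; try exact: bdd_tl; try exact: bdd_tltr; try exact: F_bdd; try exact: G_bdd.
  + exact/hFG/BHP.
  + have := assoc_eq_elem T bp bq (@bdd_id _ H).
    by rewrite -/(idop H) -!tl_tltr.
- exact: bdd_comp (G_bdd aa) (bdd_tltr _ _ _).
- exact: bdd_comp (F_bdd aa) (bdd_tl _ _).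
have hZ := Ey_MB Mp ba.
have -> : G (alpha a) \o (lG p \o rG (lW q)) = G (alpha a \o lW p) \o rG (lW q) :> op _.
  by rewrite GM//; [rewrite G_tl//; apply: op_ext|exact: MB_tl].
have nk' := nf_mulr (bdd_lW q) nk.
have e1 := slice_G nt nk' hZ.
rewrite /pf Sl_trr//; [|exact: G_bdd|exact: bdd_lW].
have -> : kappa (SlG t (G (alpha a \o lW p)) \o lW q) =
  pfG t (fun z => kappa (z \o lW q)) (G (alpha a \o lW p)) by [].
rewrite -e1; exact: h.
Qed.

(** * States invariant under the average *)

Section InvariantState.
Variables (psi : op H -> C) (zeta : H).
Hypothesis npsi : nf psi.
Hypothesis hpsi : forall a, bdd a -> psi a = '<Eo a zeta, zeta>.

Lemma psi_Ey x a : M x -> bdd a -> psi (Ey x a) = t x * psi a.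
Proof. by move=> Mx ba; rewrite !hpsi ?E_Ey ?ipZl//; exact: bdd_Ey. Qed.

Lemma psi_sandwich x a b : M x -> bdd a -> bdd b ->
  psi (SlW t (alpha a \o lW x \o alpha b)) = t x * psi (a \o b).
Proof.
by move=> Mx ba bb; rewrite !hpsi ?E_sandwich ?ipZl//; [exact: bdd_comp|exact: bdd_Sl].
Qed.

(** Both sides are normal in [1 (x) Ey x a], so by [slice_approximation] this may be replaced by
    [alpha (Ey p a) (q (x) 1)]. There [psi_Ey] and [psi_sandwich] extract the factor [t (q y)], and
    what remains is the hypothesis. *)
Lemma modular_step a b b' : bdd a -> bdd b -> bdd b' ->
  (forall p, M p -> psi (b \o Ey p a) = psi (Ey p a \o b')) ->
  forall x y, M x -> M y -> psi (Ey y b \o Ey x a) = psi (Ey x a \o Ey y b').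
Proof.
move=> ba bb bb' h x y Mx My.
have npf := nf_pf (htt K H) nt npsi.
have bab := bdd_alpha bb; have bab' := bdd_alpha bb'; have blW := bdd_lW.
pose k1 (z : op (T K H)) := pfW t psi (alpha b \o (z \o lW y)).
pose k2 (z : op (T K H)) := pfW t psi (z \o (lW y \o alpha b')).
have n1 : nf k1 := nf_mulr (blW y) (nf_mull bab npf).
have n2 : nf k2 := nf_mulr (bdd_comp (blW y) bab') npf.
have := slice_approximation (nfB n1 n2) ba.
have be p := bdd_Ey p a.
move=> /(_ _ x Mx) key; apply/eqP; rewrite -subr_eq0; apply/eqP.
have -> : psi (Ey y b \o Ey x a) = k1 (rW (Ey x a)).
  rewrite /k1; have -> : alpha b \o (rW (Ey x a) \o lW y) =
    (alpha b \o lW y) \o rW (Ey x a) :> op _.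
    by apply: op_ext => z /=; rewrite tl_trE//; exact: M_bdd.
  by rewrite /pf Sl_trr//; exact: bdd_comp.
have -> : psi (Ey x a \o Ey y b') = k2 (rW (Ey x a)).
  rewrite /k2 /pf Sl_trl//; last exact: bdd_comp.
  by rewrite slice_trace//; exact: alphaP.
apply: key => p q Mp Mq.
have Mqy := M_comp Mq My; have bq := M_bdd Mq; have by_ := M_bdd My.
have -> : k1 (alpha (Ey p a) \o lW q) = t (q \o y) * psi (b \o Ey p a).
  rewrite -psi_Ey//; last exact: bdd_comp.
  rewrite /k1 /pf [Ey (q \o y) _]/Ey (alphaM bb (be p)) (tlM _ bq by_); congr (psi (SlW t _)).
  exact: op_ext.
have -> : k2 (alpha (Ey p a) \o lW q) = t (q \o y) * psi (Ey p a \o b').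
  rewrite -psi_sandwich// /k2 /pf (tlM _ bq by_); congr (psi (SlW t _)).
  exact: op_ext.
by rewrite h// subrr.
Qed.

End InvariantState.

Lemma commutant_tl (y : op K) : commutant M y -> commutant (elem_tens (T := T) M BH) (lW y).
Proof.
move=> [/bdd_continuous bY hy]; split; first exact/bdd_continuous/bdd_tl.
move=> z /(elem_tensP sM sB)[p [c [Mp /BHP bc ->]]].
have bp := M_bdd Mp.
suff e : lW y \o (lW p \o rW c) = (lW p \o rW c) \o lW y :> op _.
  by move=> v; have /(congr1 (fun f : op (T K H) => f v)) := e.
apply: (op_eqt (htt K H)).
- exact: bdd_comp (bdd_lW _) (bdd_tltr _ _ _).
- exact: bdd_comp (bdd_tltr _ _ _) (bdd_lW _).
move=> k h /=; rewrite !(trE (htt K H))// !(tlE (htt K H))// (trE (htt K H))// (tlE (htt K H))//.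
by congr (tens T _ _); have := hy _ Mp k.
Qed.

(** For [y] in the commutant of [M], [y (x) 1] commutes with [Z], so the slices of [Z] commute with
    [y]. Membership in [M] matters because positivity and traciality of [t] are known only there. *)
Lemma rs_M xi eta Z : MB Z -> M (rs (htt K H) xi eta Z).
Proof.
move=> hZ; have bZ := MB_bdd hZ; have [_ _ <-] := vM.
split; first exact/bdd_continuous/bdd_rs.
move=> y hy k; have bY := commutant_bdd hy.
have := hZ.2 _ (commutant_tl hy) (tens T k xi).
rewrite /rs /= (tlE (htt K H))// => ->.
by rewrite RrA_tl.
Qed.

Lemma slice_rs omega_xi omega_eta Z : MB Z ->
  '<SlW t Z omega_xi, omega_eta> = t (rs (htt K H) omega_xi omega_eta Z).
Proof. by move=> hZ; rewrite SlP//; exact: MB_bdd. Qed.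

Lemma slice_positive Z v : MB Z -> positive_op Z -> 0 <= '<SlW t Z v, v>.
Proof.
move=> hZ pZ; rewrite slice_rs//; apply: tpos; first exact: rs_M.
by move=> k; rewrite rsP.
Qed.

Lemma E_positive_sqr a v : bdd a -> 0 <= '<Eo (adj a \o a) v, v>.
Proof.
move=> ba; have bb := bdd_adj a; apply: slice_positive; first exact/alphaP/bdd_comp.
by rewrite alphaM// -alphaA//; apply/positive_sqr/bdd_alpha.
Qed.

(** * Averages of rank-one operators and their traces *)

Section Averages.
Variables (e : nat -> H) (zeta : H).
Hypothesis he : is_onb e.
Hypothesis zeta1 : '<zeta, zeta> = 1.

Let kbz (f : H) : kb f zeta \o kb zeta f = kb f f :> op H.
Proof. by apply: op_ext => v; rewrite /= ipZl zeta1 mulr1. Qed.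

Let kzb (f : H) : kb zeta f \o kb f zeta = '<f, f> \*: kb zeta zeta :> op H.
Proof. by apply: op_ext => v; rewrite /= ipZl scalerA mulrC. Qed.

Lemma nf_E v u : exists2 kappa, nf kappa & forall a, bdd a -> kappa a = '<Eo a v, u>.
Proof. exact: alpha_nf (nf_pf (htt K H) nt (nf_vec v u)). Qed.

Lemma E_kb_ge0 f v : 0 <= '<Eo (kb f f) v, v>.
Proof.
have := E_positive_sqr v (bdd_kb zeta f).
by rewrite adj_kb kbz.
Qed.

Lemma E_cholesky (x : op H) v : bdd x -> positive_op x ->
  hsum (fun k => '<Eo (kb (cfac x e k) (cfac x e k)) v, v>) '<Eo x v, v>.
Proof.
move=> bx px; have [kappa nk hk] := nf_E v v.
rewrite -hk//; apply: (eq_hsum (c := fun k => kappa (kb (cfac x e k) (cfac x e k)))).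
  by move=> k; rewrite hk//; exact: bdd_kb.
by apply: cholesky => // k; rewrite hk; [exact: E_kb_ge0|exact: bdd_kb].
Qed.

Lemma E_ge0 (x : op H) : bdd x -> positive_op x -> positive_op (Eo x).
Proof.
move=> bx px v; apply: hsum_ge0 (E_cholesky v bx px) => k; exact: E_kb_ge0.
Qed.

(** On elementary tensors [p (x) c] and [q (x) d] both sides are [t (p q)] times
    [<c eta, xi> <d xi, eta>]. *)
Lemma flip_trace A A' xi eta : MB A -> MB A' ->
  pfW t (fun b => '<b xi, xi>) (A \o (rW (kb eta eta) \o A')) =
  pfW t (fun b => '<b eta, eta>) (A' \o (rW (kb xi xi) \o A)).
Proof.
move=> mA mA'; have bA := MB_bdd mA; have bA' := MB_bdd mA'.
have n1 := nf_pf (htt K H) nt (nf_vec xi xi); have n2 := nf_pf (htt K H) nt (nf_vec eta eta).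
have br := bdd_rW.
apply: (@MB_ext (fun Z => pfW t (fun b => '<b xi, xi>) (Z \o (rW (kb eta eta) \o A')))
  (fun Z => pfW t (fun b => '<b eta, eta>) (A' \o (rW (kb xi xi) \o Z))) A _ _ _ mA).
- by apply: nf_mulr n1; exact: bdd_comp.
- by apply: (nf_mull (br _) (nf_mull bA' n2)).
move=> p c Mp bc; have bp := M_bdd Mp.
have bpc := bdd_tltr T p c.
apply: (@MB_ext (fun Z => pfW t (fun b => '<b xi, xi>) ((lW p \o rW c) \o (rW (kb eta eta) \o Z)))
  (fun Z => pfW t (fun b => '<b eta, eta>) (Z \o (rW (kb xi xi) \o (lW p \o rW c)))) A' _ _ _ mA').
- by apply: (nf_mull (br _) (nf_mull bpc n1)).
- by apply: nf_mulr n2; exact: bdd_comp.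
move=> q d Mq bd; have bq := M_bdd Mq.
have ex (p1 p2 : op K) (c1 c2 b : op H) : bdd p1 -> bdd p2 -> bdd c1 -> bdd c2 -> bdd b ->
    (lW p1 \o rW c1) \o (rW b \o (lW p2 \o rW c2)) = lW (p1 \o p2) \o rW (c1 \o (b \o c2)) :> op _.
  move=> b1 b2 b3 b4 b5; have b6 := bdd_comp b5 b4.
  rewrite tlM// (trM _ b3 b6) (trM _ b5 b4); apply: op_ext => z /=.
  by rewrite -!(tl_trE (htt K H)).
have bk (v : H) := bdd_kb v v.
rewrite (ex _ _ _ _ _ bp bq bc bd (bk eta)) (ex _ _ _ _ _ bq bp bd bc (bk xi)).
have b1 := bdd_comp bc (bdd_comp (bk eta) bd); have b2 := bdd_comp bd (bdd_comp (bk xi) bc).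
rewrite (pf_tltr _ nt (nf_vec xi xi) (bdd_comp bp bq) b1).
rewrite (pf_tltr _ nt (nf_vec eta eta) (bdd_comp bq bp) b2) (ttr Mp Mq) /=.
by rewrite !linearZ_LR !ipZl; congr (_ * _); exact: mulrC.
Qed.

Lemma flip_hsum A A' xi : MB A -> MB A' ->
  hsum (fun j => pfW t (fun b => '<b xi, xi>) (A \o (rW (kb (e j) (e j)) \o A')))
       (pfW t (fun b => '<b xi, xi>) (A \o A')).
Proof.
move=> mA mA'; have bA := MB_bdd mA; have bA' := MB_bdd mA'.
have n1 := nf_pf (htt K H) nt (nf_vec xi xi).
pose k b := pfW t (fun b => '<b xi, xi>) (A \o (rW b \o A')).
have nk : nf k := nf_tr (htt K H) (nf_mulr bA' (nf_mull bA n1)).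
have := nf_onb_sum nk he.
have -> : k (idop H) = pfW t (fun b => '<b xi, xi>) (A \o A').
  by rewrite /k tr_id//; congr (pfW t _ _); exact: op_ext.
by [].
Qed.

Lemma flip_ge0 A xi eta : '<eta, eta> = 1 \/ eta = 0 -> MB A ->
  0 <= pfW t (fun b => '<b xi, xi>) (adj A \o (rW (kb eta eta) \o A)).
Proof.
move=> h mA; have bA := MB_bdd mA; have br := bdd_rW (kb eta eta).
have e1 : kb eta eta = adj (kb eta eta) \o kb eta eta :> op H.
  rewrite adj_kb; apply: op_ext => v /=; rewrite ipZl.
  by case: h => ->; rewrite ?mulr1// !scaler0.
have e2 : adj A \o (rW (kb eta eta) \o A) =
    adj (rW (kb eta eta) \o A) \o (rW (kb eta eta) \o A) :> op _.
  rewrite adjM// adj_tr ?adj_kb; try exact: bdd_kb.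
  rewrite {1}e1 adj_kb trM; try exact: bdd_kb.
  exact: op_ext.
rewrite e2; have mB : MB (rW (kb eta eta) \o A) by apply: MB_comp => //; apply: MB_tr; exact: bdd_kb.
apply: slice_positive; first by apply: MB_comp => //; exact: MB_adj.
by apply: positive_sqr; exact: MB_bdd.
Qed.

(* Insert [1 = \sum_j e_jj] in the second leg between the two factors. *)
Lemma etr_flip A : MB A ->
  (\esum_(i in [set: nat]) (complex.Re (pfW t (fun b => '<b (e i), e i>) (adj A \o A)))%:E =
   \esum_(i in [set: nat]) (complex.Re (pfW t (fun b => '<b (e i), e i>) (A \o adj A)))%:E)%E.
Proof.
move=> mA; have mA' := MB_adj mA; have bA := MB_bdd mA.
have ov i := he.1.2 i.
have aA : adj (adj A) = A by apply: op_ext; exact: adjK.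
have h1 i := hsum_esum_Re (fun j => flip_ge0 (e i) (ov j) mA) (flip_hsum (e i) mA' mA).
have f2 i j : 0 <= pfW t (fun b => '<b (e i), e i>) (A \o (rW (kb (e j) (e j)) \o adj A)).
  by have := flip_ge0 (e i) (ov j) mA'; rewrite aA.
have h2 i := hsum_esum_Re (f2 i) (flip_hsum (e i) mA mA').
rewrite -(eq_esum (fun i _ => h1 i)) -(eq_esum (fun i _ => h2 i)) esum_swap.
  apply: eq_esum => j _; apply: eq_esum => i _; congr ((complex.Re _)%:E).
  exact: flip_trace.
by move=> i j; rewrite lee_fin; exact/ge0_Re/flip_ge0.
Qed.

Let c := etr e (Eo (kb zeta zeta)).

(** Apply [etr_flip] to [A = alpha (kb zeta f)]: then [A^* A] is [alpha (kb f f)], while [A A^*] is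
    [|f|^2] times [alpha (kb zeta zeta)]. *)
Lemma etr_E_kb f : etr e (Eo (kb f f)) = ((nr f ^+ 2)%:E * c)%E.
Proof.
have bz : bdd (kb zeta f) by exact: bdd_kb.
have := etr_flip (alphaP bz); rewrite alphaA// adj_kb.
rewrite -!alphaM ?kbz ?kzb//; try exact: bdd_kb.
move=> h; apply: (etrans h); rewrite /c /etr -esumZ ?sqr_ge0//; last first.
  by move=> i; rewrite lee_fin; exact/ge0_Re/E_kb_ge0.
apply: eq_esum => i _.
have [kappa nk hk] := nf_E (e i) (e i).
have bk : bdd (kb zeta zeta) by exact: bdd_kb.
have bfk : bdd ('<f, f> \*: kb zeta zeta : op H) 
  by have [m m0 hm] := bdd_comp (@bddZ _ _ '<f, f>) bk; exists m.
rewrite -[pfW _ _ _]/('<Eo ('<f, f> \*: kb zeta zeta) (e i), e i>) -(hk _ bfk).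
rewrite (@nf_scale _ _ _ '<f, f> _ _ nk bk)// hk// ipvv ReZ.
by rewrite EFinM.
Qed.

Lemma etr_E (x : op H) : bdd x -> positive_op x ->
  etr e (Eo x) = (\esum_(k in [set: nat]) ((nr (cfac x e k) ^+ 2)%:E * c))%E.
Proof.
move=> bx px.
have h i := hsum_esum_Re (fun k => E_kb_ge0 (cfac x e k) (e i)) (E_cholesky (e i) bx px).
rewrite /etr -(eq_esum (fun i _ => h i)) esum_swap; last first.
  by move=> i j; rewrite lee_fin; exact/ge0_Re/E_kb_ge0.
by apply: eq_esum => k _; rewrite -etr_E_kb.
Qed.

End Averages.

Lemma rs_id xi eta : rs (htt K H) xi eta (idop (T K H)) = '<xi, eta> \*: idop K :> op K.
Proof.
apply: op_ext => k; apply: ip_ext => k'.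
by rewrite rsP /= ipZl (t_ip (htt K H)) mulrC.
Qed.

Lemma E_id : Eo (idop H) = idop H.
Proof.
apply: op_ext => v; apply: ip_ext => u.
rewrite /Eo /Ew alpha1 SlP//; last exact: bdd_id.
rewrite rs_id.
by rewrite (@nf_scale _ _ _ '<v, u> _ _ nt (@bdd_id _ K))// t1 mulr1.
Qed.

Lemma onb_unit (e : nat -> H) (zeta : H) : is_onb e -> '<zeta, zeta> = 1 -> exists i, '<e i, e i> = 1.
Proof.
move=> he h; apply: contrapT => /forallNP hn.
have z0 : zeta = 0.
  apply: he.2 => i; case: (he.1.2 i) => [/hn//|->]; exact: ip0r.
by move: h; rewrite z0 ip0l => /esym/eqP; rewrite oner_eq0.
Qed.

Lemma ge0_Re_ip (v : H) : (0 <= (complex.Re '<v, v>)%:E)%E.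
Proof. by rewrite lee_fin; exact/ge0_Re/ip_ge0. Qed.

(** * Faithfulness of the average *)

Section Faithful.
Variables (e : nat -> H) (zeta : H).
Hypothesis he : is_onb e.
Hypothesis zeta1 : '<zeta, zeta> = 1.
Local Notation c := (etr e (Eo (kb zeta zeta))).

Lemma etr_E_zeta_ge0 : (0 <= c)%E.
Proof. by apply: etr_ge0 => v; exact: (E_kb_ge0 zeta1). Qed.

(** With [c = 0] every positive [x] would have [Tr (E x) = 0], but [E 1 = 1]. *)
Lemma etr_E_zeta_neq0 : c != 0%E.
Proof.
apply/eqP => c0.
have pid : positive_op (idop H) by move=> v; exact: ip_ge0.
have := etr_E he zeta1 (@bdd_id _ H) pid.
rewrite E_id esum1; last by move=> k _; rewrite c0 mule0.
have [i hi] := onb_unit he zeta1.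
move=> h; have := @esum_eq0 _ _ _ i _ h; rewrite /= hi => /(_ _)/eqP h1.
by have := h1 (fun j => ge0_Re_ip (e j)); rewrite eqe oner_eq0.
Qed.

(** Faithfulness comes from the trace instead of from [t]: since [Tr (E r)] is [c] times the sum of
    the squared Cholesky factors and [c] is nonzero, possibly infinite, all factors of [r]
    vanish. *)
Lemma E_faithful (r : op H) : bdd r -> positive_op r -> (forall v, Eo r v = 0) -> forall v, r v = 0.
Proof.
move=> br pr h0 v.
have := etr_E he zeta1 br pr; rewrite [LHS]esum1; last first.
  by move=> i _; rewrite h0 ip0l.
move=> /esym h.
have f0 k : nr (cfac r e k) = 0.
  have := @esum_eq0 _ _ _ k _ h; rewrite /= => /(_ _)/eqP h1.
  have {h1} : ((nr (cfac r e k) ^+ 2)%:E * c == 0)%E.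
    by apply: h1 => j; rewrite mule_ge0 ?etr_E_zeta_ge0// lee_fin sqr_ge0.
  by rewrite mule_eq0 (negbTE etr_E_zeta_neq0) orbF eqe sqrf_eq0 => /eqP.
have := etr_cholesky br pr he he.1 he.2; rewrite [RHS]esum1; last first.
  by move=> k _; rewrite f0 expr0n.
move=> h1; apply: he.2 => i; rewrite positive_herm//.
have -> : r (e i) = 0; last by rewrite ip0l conjc0.
apply: positive_null => //.
have := @esum_eq0 _ _ _ i _ h1; rewrite /= => /(_ _)/eqP h2.
by apply/eqP; rewrite -eqe; apply: h2 => j; rewrite lee_fin ge0_Re.
Qed.
End Faithful.

(** * The form [t (y^* x)] on [M] *)

Lemma M_comb p (c : C) q : M p -> M q -> M (p \+ c \*: q).
Proof.
move=> Mp Mq; have bp := M_bdd Mp; have bq := M_bdd Mq; have [_ _ hM] := vM.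
rewrite -hM in Mp Mq *; split.
  apply/bdd_continuous; have [m m0 hm] := bdd_comb c bq bp.
  by exists m => // v; have := hm v; rewrite addrC.
move=> z hz v /=; have /= -> := Mp.2 z hz v; have /= -> := Mq.2 z hz v.
by rewrite linearD linearZ_LR.
Qed.

Let sM' x y := t (adj y \o x).

Let sM_l p (c : C) q r : M p -> M q -> M r -> sM' (p \+ c \*: q) r = sM' p r + c * sM' q r.
Proof.
move=> Mp Mq Mr; have ba := bdd_adj r; have bp := M_bdd Mp; have bq := M_bdd Mq.
rewrite /sM' addrC; apply: (nf_linear nt (bdd_comp ba bq) (bdd_comp ba bp)) => v /=.
by rewrite linearD linearZ_LR addrC.
Qed.

Let sM_pos p : M p -> 0 <= sM' p p.
Proof.
move=> Mp; apply: tpos; first by apply: M_comp => //; exact: M_adj.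
by apply: positive_sqr; exact: M_bdd.
Qed.

(** Polarisation of [t (z^* z) >= 0] with [z = x + c], for [c = 1] and [c = i]. *)
Lemma t_adj x : M x -> t (adj x) = conjc (t x).
Proof.
move=> Mx; have bx := M_bdd Mx; have bi := @bdd_id _ K.
have key (c : C) : 0 <= sM' x x + c * conjc c + (c * t (adj x) + conjc c * t x).
  have Mz := M_comb c Mx M_id; have bz := M_bdd Mz.
  have := sM_pos Mz; rewrite {1}/sM'.
  have e1 v : (adj (x \+ c \*: idop K) \o (x \+ c \*: idop K)) v =
      c *: (adj x) v + (adj x (x v) + conjc c *: (x v + c *: v)).
    rewrite /=; have -> u : adj (x \+ c \*: idop K) u = adj x u + conjc c *: u.
      apply: ip_ext => w; rewrite adjP'//= ipDr ipDl ipZr ipZl adjP'//.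
    by rewrite linearD linearZ_LR -addrA addrCA.
  pose y1 : op K := x \+ c \*: idop K.
  pose y2 : op K := (adj x \o x) \+ conjc c \*: y1.
  have b1 : bdd (adj x \o x) by apply: bdd_comp => //; exact: bdd_adj.
  have b2 : bdd y2.
    have [m m0 hm] := bdd_comb (conjc c) bz b1; exists m => // v.
    by have := hm v; rewrite addrC.
  rewrite (nf_linear (a := c) nt (bdd_adj x) b2); last exact: e1.
  rewrite (nf_linear (a := conjc c) (z := y2) (x := y1) (y := adj x \o x) nt bz b1); last first.
    by move=> v; rewrite [RHS]addrC.
  rewrite (nf_linear (a := c) (z := y1) (x := idop K) (y := x) nt bi bx); last first.
    by move=> v; rewrite [RHS]addrC.
  rewrite t1 mulr1 -/(sM' x x).
  suff -> : c * t (adj x) + (conjc c * (c + t x) + sM' x x) =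
    sM' x x + c * conjc c + (c * t (adj x) + conjc c * t x) by [].
  by ring.
have k1 := key 1; have k2 := key 'i%C; move: k1 k2.
rewrite conjc1 !mul1r sqr_ab (ge0_complex (sM_pos Mx)).
have -> : conjc 'i%C = - 'i%C :> C by apply: complex_ext; rewrite /= ?oppr0.
move=> /ge0_complex /(congr1 (@complex.Im R)) + /ge0_complex /(congr1 (@complex.Im R)).
case: (t x) => a b; case: (t (adj x)) => a' b' /= h1 h2.
by apply: complex_ext => /=; lra.
Qed.

Let sM_C p q : M p -> M q -> sM' p q = conjc (sM' q p).
Proof.
move=> Mp Mq; rewrite /sM' -t_adj; last by apply: M_comp => //; exact: M_adj.
rewrite adjM; [|exact: bdd_adj|exact: M_bdd].
by congr (t (_ \o _)); apply: op_ext => v; rewrite adjK//; exact: M_bdd.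
Qed.

Let q x := complex.Re (sM' x x).

Lemma q_adj x : M x -> q (adj x) = q x.
Proof.
move=> Mx; have bx := M_bdd Mx; rewrite /q /sM'; congr complex.Re.
rewrite (ttr (M_adj (M_adj Mx)) (M_adj Mx)); congr (t (_ \o _)).
by apply: op_ext; exact: adjK.
Qed.

Lemma adj_rs xi eta Z : bdd Z -> adj (rs (htt K H) xi eta Z) = rs (htt K H) eta xi (adj Z).
Proof.
move=> bZ; apply: adj_eq => [|k k']; first exact: bdd_rs.
by rewrite rsP (ipC k) rsP adjP// -ipC.
Qed.

Section SliceFamily.
Variables (e : nat -> H) (psi : op H -> C) (I : countType) (u v : I -> H).
Hypothesis he : is_onb e.
Hypothesis hrep : rep psi u v.
Variables (Z1 Z2 : op (T K H)).
Hypotheses (m1 : MB Z1) (m2 : MB Z2).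

(** With [psi = \sum_i <. (u i), v i>], matrix multiplication along [e] in the second leg makes
    [psi] of the slice of [Z1 Z2] the sum of the [t (B i A i)]. This is the trace of a kernel on
    [L^2 (M, t)], written as a sum of rank-one kernels. *)
Let A (i : I * nat) := rs (htt K H) (u i.1) (e i.2) Z2.
Let B (i : I * nat) := rs (htt K H) (e i.2) (v i.1) Z1.

(** Insert [1 = \sum_r kb (e r) (e r)] in the second leg; [1 (x) kb (e r) (e r)] factors as
    [Rr (e r)] after [RrA (e r)], which cuts the product into two entries. *)
Lemma slice_row xi eta Z' Z : MB Z' -> MB Z ->
  hsum (fun r => t (rs (htt K H) (e r) eta Z' \o rs (htt K H) xi (e r) Z))
       '<SlW t (Z' \o Z) xi, eta>.
Proof.
move=> hZ' hZ; have bZ' := MB_bdd hZ'; have bZ := MB_bdd hZ.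
have n1 := nf_pf (htt K H) nt (nf_vec xi eta).
pose k b := pfW t (fun b => '<b xi, eta>) (Z' \o (rW b \o Z)).
have nk : nf k := nf_tr (htt K H) (nf_mulr bZ (nf_mull bZ' n1)).
have := nf_onb_sum nk he.
have -> : k (idop H) = '<SlW t (Z' \o Z) xi, eta>.
  by rewrite /k tr_id//; congr (pfW t _ _); exact: op_ext.
apply: eq_hsum => r; rewrite /k /pf SlP//; last first.
  by apply: bdd_comp => //; apply: bdd_comp => //; exact: bdd_rW.
congr (t _); apply: op_ext => x; apply: ip_ext => y.
rewrite rsP rsP /=; congr ('<Z' _, _>).
have bk := bdd_kb (e r) (e r).
suff h z : rW (kb (e r) (e r)) z = tens T (RrA (htt K H) (e r) z) (e r) by rewrite h.
pose X : {linear T K H -> T K H} := Rr (htt K H) (e r) \o RrA (htt K H) (e r).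
have bX : bdd X by apply: bdd_comp; [exact: bdd_Rr|exact: bdd_RrA].
rewrite -[RHS]/(X z); have := op_eqt (htt K H) (bdd_rW (kb (e r) (e r))) bX => hh.
have -> // : rW (kb (e r) (e r)) = X; apply: hh => x' h'.
rewrite trE// /X /= RrA_t (tZl (htt K H)).
exact: (tZl (istens_flip (htt K H))).
Qed.

(** For a fixed vector, the squared [L^2] norms of the entries along [e] sum to a diagonal entry of
    the slice of [Z^* Z], bounded by [L] times its squared norm. *)
Lemma slice_col_bound (w : I -> H) Z : MB Z -> sqf w -> exists2 m : R, 0 <= m &
  forall S : {fset I * nat}, \sum_(i <- S) q (rs (htt K H) (w i.1) (e i.2) Z) <= m ^+ 2.
Proof.
move=> mZ [N N0 hN]; have bZ := MB_bdd mZ; have mZ' := MB_adj mZ.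
pose S0 := SlW t (adj Z \o Z).
have [L L0 hL] := bdd_Sl (htt K H) t (adj Z \o Z).
have q0 xi r : 0 <= q (rs (htt K H) xi (e r) Z) by exact/ge0_Re/sM_pos/rs_M.
have row xi (S : {fset nat}) : \sum_(r <- S) q (rs (htt K H) xi (e r) Z) <= L * nr xi ^+ 2.
  have c0 r : 0 <= t (rs (htt K H) (e r) xi (adj Z) \o rs (htt K H) xi (e r) Z).
    by rewrite -adj_rs//; exact/sM_pos/rs_M.
  have [_ h] := hsum_ge0_real c0 (slice_row xi xi mZ' mZ).
  apply: (@le_trans _ _ (complex.Re '<SlW t (adj Z \o Z) xi, xi>)); last exact: Re_bdd.
  apply: le_trans (sum_le_hsum S _ h); last by move=> r; exact: ge0_Re.
  by rewrite le_eqVlt; apply/orP; left; apply/eqP; apply: eq_bigr => r _; rewrite /q /sM' adj_rs.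
exists (Num.sqrt L * N); first by rewrite mulr_ge0// sqrtr_ge0.
move=> S; apply: le_trans (ler_sum_fset _ (fset_sub_prod S)) _ => //.
rewrite sum_prodset exprMn sqr_sqrtr//.
apply: (@le_trans _ _ (\sum_(i <- [fset x.1 | x in S]%fset) L * nr (w i) ^+ 2)).
  by apply: ler_sum => i _ /=; exact: (row (w i) [fset x.2 | x in S]%fset).
by rewrite -mulr_sumr ler_wpM2l.
Qed.

Lemma slice_family_bound : exists2 m : R, 0 <= m & forall S : {fset I * nat},
  \sum_(i <- S) Num.sqrt (q (A i)) * Num.sqrt (q (adj (B i))) <= m.
Proof.
have [su sv _] := hrep.
have [a a0 ba] := slice_col_bound m2 su.
have [b b0 bb] := slice_col_bound (MB_adj m1) sv.
exists (a * b); first exact: mulr_ge0.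
move=> S; apply: CS_sum => //; try by move=> i; exact: sqrtr_ge0.
  rewrite (eq_bigr (fun i => q (A i))) ?ba// => i _; rewrite sqr_sqrtr//.
  by apply/ge0_Re/sM_pos/rs_M.
rewrite (eq_bigr (fun i => q (rs (htt K H) (v i.1) (e i.2) (adj Z1)))) ?bb// => i _.
rewrite sqr_sqrtr /B ?adj_rs//; try exact: MB_bdd.
by apply/ge0_Re/sM_pos/rs_M/MB_adj.
Qed.

Lemma MA i : M (A i). Proof. exact: rs_M. Qed.
Lemma M_B i : M (B i). Proof. exact: rs_M. Qed.

Let sqrtq x : M x -> Num.sqrt (q x) ^+ 2 = q x.
Proof. by move=> Mx; rewrite sqr_sqrtr//; exact/ge0_Re/sM_pos. Qed.

Let sM_CS x y : M x -> M y -> ab (sM' x y) <= Num.sqrt (q x) * Num.sqrt (q y).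
Proof.
move=> Mx My; rewrite -(@ler_pXn2r _ 2)// ?nnegrE ?ab_ge0 ?mulr_ge0 ?sqrtr_ge0//.
rewrite exprMn !sqrtq//.
exact: (semi_CS (fun p (c : C) q => @M_comb p c q) (fun p (c : C) q r => @sM_l p c q r)
  (fun p q => @sM_C p q) (fun p => @sM_pos p)).
Qed.

Lemma slice_family_sum : hsum (fun i => t (B i \o A i)) (psi (SlW t (Z1 \o Z2))).
Proof.
have [m m0 hm] := slice_family_bound.
have aa i : adj (adj (B i)) = B i by apply: op_ext; apply: adjK; exact/M_bdd/M_B.
have hA : asum (fun i => t (B i \o A i)) m.
  move=> S; apply: le_trans (hm S); apply: ler_sum => i _.
  have := sM_CS (MA i) (M_adj (M_B i)); by rewrite /sM' aa.
have [s hs] := asum_hsum hA.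
have hs' := hsum_fubini hs (fun i => slice_row (u i) (v i) m1 m2).
have [_ _ hk] := hrep.
by rewrite (hsum_unique (hk _ (bdd_Sl _ _ _)) hs').
Qed.

(** Slicing before multiplying: the coefficients of the kernel against [y] and [y'] sum to [psi] of
    a product of two slices, the quantity that [modular_step] controls. *)
Lemma slice_family_pair y y' : M y -> M y' ->
  hsum (fun i => t (B i \o y') * t (A i \o y)) (psi (SlW t (Z1 \o lW y') \o SlW t (Z2 \o lW y))).
Proof.
move=> My My'; have [m m0 hm] := slice_family_bound.
have aa x : M x -> adj (adj x) = x by move=> /M_bdd bx; apply: op_ext; exact: adjK.
pose c := Num.sqrt (q (adj y)) * Num.sqrt (q y').
have c0 : 0 <= c by rewrite mulr_ge0 ?sqrtr_ge0.
have hA : asum (fun i => t (B i \o y') * t (A i \o y)) (c * m).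
  move=> S; apply: (@le_trans _ _ (\sum_(i <- S) c * (Num.sqrt (q (A i)) * Num.sqrt (q (adj (B i)))))).
    apply: ler_sum => i _; rewrite abM.
    have h1 : ab (t (B i \o y')) <= Num.sqrt (q y') * Num.sqrt (q (adj (B i))).
      by have := sM_CS My' (M_adj (M_B i)); rewrite /sM' (aa _ (M_B i)).
    have h2 : ab (t (A i \o y)) <= Num.sqrt (q (A i)) * Num.sqrt (q (adj y)).
      have := sM_CS (MA i) (M_adj My); rewrite /sM' (aa _ My).
      by rewrite (ttr My (MA i)).
    apply: le_trans (ler_pM (ab_ge0 _) (ab_ge0 _) h1 h2) _.
    by rewrite le_eqVlt; apply/orP; left; apply/eqP; rewrite /c; ring.
  by rewrite -mulr_sumr ler_wpM2l.
have [s hs] := asum_hsum hA.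
pose p1 := SlW t (Z1 \o lW y'); pose p2 := SlW t (Z2 \o lW y).
have b1 : bdd p1 by exact: bdd_Sl.
have b2 : bdd p2 by exact: bdd_Sl.
have row i : hsum (fun r => t (B (i, r) \o y') * t (A (i, r) \o y)) '<(p1 \o p2) (u i), v i>.
  have := parseval he.1 he.2 (p2 (u i)) (adj p1 (v i)); rewrite -adjP//.
  apply: eq_hsum => r; rewrite mulrC -(ipC (e r)) -adjP//; congr (_ * _).
    rewrite /p1 SlP//; last exact: bdd_comp (MB_bdd m1) (bdd_lW _).
    congr (t _); apply: op_ext => k; apply: ip_ext => k'.
    by rewrite !rsP /= tlE//; exact: M_bdd.
  rewrite /p2 SlP//; last exact: bdd_comp (MB_bdd m2) (bdd_lW _).
  congr (t _); apply: op_ext => k; apply: ip_ext => k'.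
  by rewrite !rsP /= tlE//; exact: M_bdd.
have hs' := hsum_fubini hs row.
have [_ _ hk] := hrep.
by rewrite (hsum_unique (hk _ (bdd_comp b1 b2)) hs').
Qed.
End SliceFamily.

(* The hypothesis says that two trace-class kernels on [L^2 (M, t)] agree on the
   diagonal, and the two sides of the conclusion are their traces. *)
Lemma psi_product (e : nat -> H) (psi : op H -> C) a b b' : is_onb e -> nf psi ->
  bdd a -> bdd b -> bdd b' ->
  (forall x y, M x -> M y -> psi (Ey y b \o Ey x a) = psi (Ey x a \o Ey y b')) ->
  psi (SlW t (alpha b \o alpha a)) = psi (SlW t (alpha a \o alpha b')).
Proof.
move=> he [I [u [v hrep]]] ba bb bb' h.
have ma := alphaP ba; have mb := alphaP bb; have mb' := alphaP bb'.
have [m _ hm] := slice_family_bound he hrep mb ma.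
have [m' _ hm'] := slice_family_bound he hrep ma mb'.
pose A i := rs (htt K H) (u i.1) (e i.2) (alpha a) : op K.
pose B i := rs (htt K H) (e i.2) (v i.1) (alpha b) : op K.
pose A' i := rs (htt K H) (u i.1) (e i.2) (alpha b') : op K.
pose B' i := rs (htt K H) (e i.2) (v i.1) (alpha a) : op K.
have aa x : M x -> adj (adj x) = x by move=> /M_bdd bx; apply: op_ext; exact: adjK.
have hA i : M (A i) by exact: rs_M.
have hB i : M (B i) by exact: rs_M.
have hA' i : M (A' i) by exact: rs_M.
have hB' i : M (B' i) by exact: rs_M.
apply: (@semi_trace_eq _ _ M (fun p (c : C) q => p \+ c \*: q) sM' (fun p (c : C) q => @M_comb p c q)
  (fun p (c : C) q r => @sM_l p c q r) (fun p q => @sM_C p q) (fun p => @sM_pos p)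
  _ _ A (fun i => adj (B i)) B' (fun i => adj (A' i)) m m').
- by move=> i; split => //; exact: M_adj.
- by move=> i; split => //; exact: M_adj.
- exact: hm.
- move=> S; apply: le_trans (hm' S); rewrite le_eqVlt; apply/orP; left; apply/eqP.
  apply: eq_bigr => i _; rewrite mulrC -/(q (adj (A' i))) q_adj//; congr (_ * Num.sqrt _).
  by rewrite -/(q (B' i)) -q_adj.
- by apply: eq_hsum (slice_family_sum he hrep mb ma) => i; rewrite /sM' aa.
- apply: eq_hsum (slice_family_sum he hrep ma mb') => i; rewrite /sM' aa//.
  exact: (ttr (hB' i) (hA' i)).
move=> y My; have My' := M_adj My; exists (psi (Ey y b \o Ey (adj y) a)); split.
  apply: eq_hsum (slice_family_pair he hrep mb ma My' My) => i.
  rewrite [LHS]mulrC -[in RHS]sM_C//; last exact: M_adj.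
  by rewrite /sM' aa// -[t (_ \o A i)](ttr (hA i) My').
rewrite h//; apply: eq_hsum (slice_family_pair he hrep ma mb' My My') => i.
rewrite -[in RHS]sM_C//; last exact: M_adj.
by rewrite /sM' aa// -[t (_ \o B' i)](ttr (hB' i) My').
Qed.

(** * Positivity and norm bounds for [alpha] and its slices *)

Section Contraction.
Variables (e : nat -> H) (zeta : H).
Hypothesis he : is_onb e.
Hypothesis zeta1 : '<zeta, zeta> = 1.

(** By Cholesky it suffices to treat [kb f f], whose square root is explicit enough: it is [x^* x]
    for [x = kb zeta f]. *)
Lemma alpha_positive (x : op H) : bdd x -> positive_op x -> positive_op (alpha x).
Proof.
move=> bx px z; have [kappa nk hk] := alpha_nf (nf_vec z z).
have k0 f : 0 <= kappa (kb f f).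
  have -> : kb f f = kb f zeta \o kb zeta f :> op H.
    by apply: op_ext => v; rewrite /= ipZl zeta1 mulr1.
  have b1 := bdd_kb f zeta; have b2 := bdd_kb zeta f.
  rewrite hk; last exact: bdd_comp.
  rewrite alphaM// -(adj_kb zeta f) -alphaA//.
  by apply: positive_sqr; exact: bdd_alpha.
rewrite -hk//; apply: hsum_ge0 (cholesky bx px he nk _) => k; exact: k0.
Qed.

(** Positivity of [alpha] is applied to [N^2 - a^* a]. *)
Lemma alpha_contraction a (N : R) : bdd a -> 0 <= N -> (forall v, nr (a v) <= N * nr v) ->
  forall z, nr (alpha a z) <= N * nr z.
Proof.
move=> ba N0 hN z; have bi := @bdd_id _ H; have baa := bdd_comp (bdd_adj a) ba.
pose x : op H := ((N ^+ 2)%:C \*: idop H) \- (adj a \o a).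
have bN : bdd ((N ^+ 2)%:C \*: idop H : op H) := @bddZ _ H (N ^+ 2)%:C.
have bx : bdd x by exact: (bdd_sub bN baa).
have px : positive_op x.
  move=> v; rewrite /x /= ipBl ipZl adjP'// !ipvv -rmorphM -rmorphB realc_ge0// subr_ge0.
  by rewrite -exprMn ler_pXn2r// ?nnegrE ?mulr_ge0 ?nr_ge0.
have := alpha_positive bx px z => /ge0_Re.
have -> : '<alpha x z, z> = (N ^+ 2 * nr z ^+ 2 - nr (alpha a z) ^+ 2)%:C.
  rewrite (alpha_linear (c := -1) (a := adj a \o a) (b := (N ^+ 2)%:C \*: idop H) baa).
  - rewrite (alphaM (bdd_adj a) ba) -alphaA// ipDl ipZl mulN1r /= adjP'; last exact: bdd_alpha.
    have -> : alpha ((N ^+ 2)%:C \*: idop H) z = (N ^+ 2)%:C *: z.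
      rewrite (alpha_linear (c := (N ^+ 2)%:C - 1) (a := idop H) (b := idop H) bi bi).
        by rewrite alpha1 /= scalerBl scale1r subrK.
      by move=> v /=; rewrite scalerBl scale1r subrK.
    by rewrite ipZl !ipvv -rmorphM -rmorphN -rmorphD; congr (_%:C); exact: addrC.
  - exact: (@bddZ _ H (N ^+ 2)%:C).
  - by move=> v /=; rewrite scaleN1r addrC.
rewrite /= subr_ge0 -exprMn ler_pXn2r// ?nnegrE ?mulr_ge0 ?nr_ge0//.
Qed.

Lemma Ey_bound x : M x -> exists2 m : R, 0 <= m & forall a (N : R), bdd a -> 0 <= N ->
  (forall v, nr (a v) <= N * nr v) -> forall v, nr (Ey x a v) <= m * N * nr v.
Proof.
move=> Mx; have [mx mx0 hx] := bdd_lW x; have [mt mt0 ht] := nf_bound nt.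
exists (mt * mx); first exact: mulr_ge0.
move=> a N ba N0 hN v; have bZ : bdd (alpha a \o lW x) by exact: MB_bdd (Ey_MB Mx ba).
apply: nr_le_ip => [|u]; first by rewrite !mulr_ge0// nr_ge0.
rewrite /Ey SlP//; apply: (@le_trans _ _ (mt * (mx * N * nr v * nr u))); last first.
  by rewrite le_eqVlt; apply/orP; left; apply/eqP; ring.
apply: ht => [|k]; first by rewrite !mulr_ge0// nr_ge0.
apply: le_trans (RrA_nr _ _ _) _.
apply: (@le_trans _ _ (nr u * (N * (mx * (nr k * nr v))))); last first.
  by rewrite le_eqVlt; apply/orP; left; apply/eqP; ring.
apply: ler_wpM2l; first exact: nr_ge0.
apply: le_trans (alpha_contraction ba N0 hN _) _; apply: ler_wpM2l => //.
by apply: le_trans (hx _) _; rewrite /= (nr_t (htt K H)).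
Qed.
End Contraction.

Lemma kb_nr (xi eta v : H) : nr (kb xi eta v) <= nr xi * nr eta * nr v.
Proof.
rewrite /= nrZ; have -> : nr xi * nr eta * nr v = nr v * nr eta * nr xi by ring.
by apply: ler_wpM2r; [exact: nr_ge0|exact: CS].
Qed.

(** * Densities of normal functionals and the modular identity *)

Lemma nf_density (psi : op H -> C) : nf psi ->
  exists2 h : op H, bdd h & forall xi eta, '<h xi, eta> = psi (kb xi eta).
Proof.
move=> npsi; have [m m0 hm] := nf_bound npsi.
have [||u v|h hb hh] := @form_operator R H H (fun xi eta => psi (kb xi eta)) m m0.
- move=> a u u' v; apply: (nf_linear npsi (bdd_kb u v) (bdd_kb u' v)) => w /=.
  by rewrite scalerDr !scalerA mulrC.
- move=> a u v v'; apply: (nf_linear npsi (bdd_kb u v) (bdd_kb u v')) => w /=.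
  by rewrite ipDr ipZr scalerDl scalerA.
- rewrite -mulrA; apply: hm; first by rewrite mulr_ge0 ?nr_ge0.
  exact: kb_nr.
exists h => //; by exists m.
Qed.

Section Modular.
Variables (e : nat -> H) (zeta : H) (psi : op H -> C) (g : op H) (lam : C).
Hypothesis he : is_onb e.
Hypothesis npsi : nf psi.
Hypothesis hpsi : forall a, bdd a -> psi a = '<Eo a zeta, zeta>.
Hypothesis bg : bdd g.
Hypothesis lam0 : lam != 0.
Hypothesis hg : forall xi eta, psi (kb xi eta) = lam * '<g xi, eta>.

(** With [psi = lam Tr (g .)] both sides are [lam Tr (g a g b)]; checking rank-one [b] avoids any
    use of [Tr]. *)
Lemma psi_density a b : bdd a -> bdd b -> psi ((a \o g) \o b) = psi (b \o (g \o a)).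
Proof.
move=> ba bb; have bag := bdd_comp ba bg; have bga := bdd_comp bg ba.
apply: (nf_kb_ext (nf_mull bag npsi) (nf_mulr bga npsi) bb) => xi eta.
rewrite comp_kb kb_comp// !hg; congr (_ * _).
by rewrite -adjP.
Qed.

Lemma psi_E a : bdd a -> psi (Eo a) = psi a.
Proof. by move=> ba; rewrite !hpsi//; [rewrite E_Ew// t1 scale1r|exact: bdd_Ew]. Qed.

(** The relation [psi (b c) = psi (c b')] holds for [b = a g] and [b' = g a]. One [modular_step]
    carries it to the slices of [b] and [b'], but only against slices of [c]. A second one, followed
    by [psi_product] and invariance of [psi], lifts this restriction, and rank-one [c] then gives
    the operator identity. *)
Lemma modular_g a y v : bdd a -> M y -> g (Ey y (a \o g) v) = Ey y (g \o a) (g v).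
Proof.
move=> ba My; have bag := bdd_comp ba bg; have bga := bdd_comp bg ba.
have bE z c := bdd_Ey z c.
have s1 c x' y' : bdd c -> M x' -> M y' ->
    psi (Ey y' (a \o g) \o Ey x' c) = psi (Ey x' c \o Ey y' (g \o a)).
  by move=> bc; apply: (modular_step npsi hpsi bc bag bga) => p Mp; exact: psi_density.
set b := Ey y (a \o g); set b' := Ey y (g \o a).
have s2 c : bdd c -> psi (b \o c) = psi (c \o b').
  move=> bc; have s3 x' y' : M x' -> M y' -> psi (Ey y' b \o Ey x' c) = psi (Ey x' c \o Ey y' b').
    by apply: (modular_step npsi hpsi bc (bE _ _) (bE _ _)) => p Mp; exact: s1.
  have := psi_product he npsi bc (bE _ _) (bE _ _) s3.
  rewrite -!alphaM; try exact: bE; try exact: bc.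
  move=> h; have h' : psi (Eo (b \o c)) = psi (Eo (c \o b')) := h.
  by rewrite (psi_E (bdd_comp (bE _ _) bc)) (psi_E (bdd_comp bc (bE _ _))) in h'.
apply: ip_ext => u; apply: (mulfI lam0).
have := s2 _ (bdd_kb v u); rewrite comp_kb (kb_comp _ _ (bE _ _)) !hg => ->.
by rewrite -adjP//; exact: bE.
Qed.
End Modular.

(** * The spectral projection of the density at its norm *)

Section TopProjection.
Variables (e : nat -> H) (zeta : H).
Hypothesis he : is_onb e.
Hypothesis zeta1 : '<zeta, zeta> = 1.

(* The density of the invariant state, scaled so that its norm is [1]. *)
Lemma top_operator : exists (psi : op H -> C) (g : op H) (lam : R),
  [/\ nf psi, 0 < lam, forall a, bdd a -> psi a = '<Eo a zeta, zeta> &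
      forall xi eta, psi (kb xi eta) = lam%:C * '<g xi, eta> ] /\
  [/\ positive_op g, forall v, nr (g v) <= nr v,
      hsum (fun i => '<g (e i), e i>) (lam^-1)%:C &
      forall d : R, 0 < d -> exists2 xi : H, '<xi, xi> = 1 & 1 - d <= complex.Re '<g xi, xi> ].
Proof.
have [psi npsi hpsi] := nf_E zeta zeta.
have [h bh hh] := nf_density npsi.
have ph : positive_op h.
  by move=> v; rewrite hh hpsi; [exact: E_kb_ge0 zeta1 _ _|exact: bdd_kb].
have [m m0 hm] := bh.
pose S := [set complex.Re '<h xi, xi> | xi in [set xi : H | '<xi, xi> = 1]].
have S0 : S !=set0 by exists (complex.Re '<h zeta, zeta>), zeta.
have hS : has_sup S.
  split => //; exists m => _ [xi xi1 <-]; apply: le_trans (Re_bdd _ hm) _.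
  by rewrite sqr_nr xi1 mulr1.
pose lam := sup S.
have hle (v : H) : complex.Re '<h v, v> <= lam * nr v ^+ 2.
  have [->|v0] := eqVneq v 0; first by rewrite nr0 expr0n mulr0 ip0r.
  have nv : 0 < nr v by rewrite lt_neqAle nr_ge0 andbT eq_sym; apply: contra_neq v0; exact: nr_eq0.
  pose w := ((nr v)^-1)%:C *: v.
  have w1 : '<w, w> = 1 by exact: ip_unit.
  have : complex.Re '<h w, w> <= lam by apply: ub_le_sup; [exact: hS.2|exists w].
  rewrite /w (linearZ_LR h) ipZl ipZr conjc_real mulrA -rmorphM ReZ => k.
  rewrite -ler_pdivrMr ?exprn_gt0//; apply: le_trans k.
  by rewrite le_eqVlt; apply/orP; left; apply/eqP; field; rewrite gt_eqF.
have h1 : hsum (fun i => '<h (e i), e i>) 1.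
  have := nf_onb_sum npsi he; rewrite hpsi; last exact: bdd_id.
  by rewrite E_id zeta1; apply: eq_hsum => i; rewrite hh.
(* Otherwise the diagonal of [h] would vanish, although it sums to [psi 1 = 1]. *)
have lam0 : 0 < lam.
  rewrite ltNge; apply/negP => l0.
  have z i : '<h (e i), e i> = 0.
    rewrite (ge0_complex (ph (e i))); congr (_%:C); apply/eqP.
    rewrite eq_le ge0_Re ?andbT//; apply: le_trans (hle _) _.
    by rewrite mulr_le0_ge0// sqr_ge0.
  have := hsum_unique h1 (eq_hsum (fun i => esym (z i)) (@hsum0 R nat)).
  by move=> /eqP; rewrite oner_eq0.
have lamC : lam%:C != 0 by rewrite fmorph_eq0 gt_eqF.
pose g : op H := (lam^-1)%:C \*: h.
have gE v w : '<g v, w> = (lam^-1)%:C * '<h v, w> by rewrite /g /= ipZl.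
have pg : positive_op g.
  by move=> v; rewrite gE mulr_ge0// realc_ge0// invr_ge0 ltW.
have gle v : complex.Re '<g v, v> <= 1 * nr v ^+ 2.
  by rewrite gE ReZ mul1r mulrC ler_pdivrMr// mulrC.
exists psi, g, lam; split; split => //.
- move=> xi eta; rewrite gE mulrA -rmorphM divff ?gt_eqF// mul1r hh//.
- move=> v; have h2 := positive_nr v pg ler01 gle.
  rewrite -(@ler_pXn2r _ 2)// ?nnegrE ?nr_ge0//; apply: le_trans h2 _.
  by have := gle v; rewrite !mul1r.
- have := hsumZ (lam^-1)%:C h1; rewrite mulr1; apply: eq_hsum => i; by rewrite gE.
- move=> d d0; have [_ [xi xi1 <-] hxi] := sup_adherent (mulr_gt0 d0 lam0) hS.
  exists xi => //; rewrite gE ReZ mulrC ler_pdivlMr// mulrBl mul1r.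
  exact: ltW.
Qed.

Section Kill.
Variables (psi : op H -> C) (g p : op H) (lam : R).
Hypothesis npsi : nf psi.
Hypothesis hpsi : forall a, bdd a -> psi a = '<Eo a zeta, zeta>.
Hypothesis lam0 : 0 < lam.
Hypothesis hg : forall xi eta, psi (kb xi eta) = lam%:C * '<g xi, eta>.
Hypothesis pg : positive_op g.
Hypothesis ng : forall v, nr (g v) <= nr v.
Hypothesis bp : bdd p.
Hypothesis pp : p \o p = p :> op _.
Hypothesis ap : adj p = p.
Hypothesis gp : g \o p = p :> op _.
Hypothesis lp : forall v, cvH (fun n => iter n g v) (p v).

Let gpE v : g (p v) = p v.
Proof. by have /(congr1 (fun f : op H => f v)) := gp. Qed.
Let ppE v : p (p v) = p v.
Proof. by have /(congr1 (fun f : op H => f v)) := pp. Qed.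

(* [E_y (xi eta^* ) v = g^n E_y (xi (g^n eta)^* ) v], and [g^n eta] tends to [0]. *)
Lemma Ey_kill y xi v eta : M y -> p xi = xi -> p v = v -> p eta = 0 -> Ey y (kb xi eta) v = 0.
Proof.
move=> My pxi pv peta; have bg := bdd_contraction ng.
have lamC : lam%:C != 0 :> C by rewrite fmorph_eq0 gt_eqF.
have gxi : g xi = xi by rewrite -pxi gpE.
have gv : g v = v by rewrite -pv gpE.
have step u : g (Ey y (kb xi (g u)) v) = Ey y (kb xi u) v.
  have := modular_g he npsi hpsi bg lamC hg v (bdd_kb xi u) My.
  by rewrite comp_kb (kb_comp _ _ bg) (positive_adj bg pg) gxi gv.
have iterE n u : iter n g (Ey y (kb xi (iter n g u)) v) = Ey y (kb xi u) v.
  by elim: n u => // n IH u; rewrite [iter n.+1 g u]iterSr [LHS]iterS IH step.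
have [m m0 hm] := Ey_bound he zeta1 My.
apply: nr_eq0; apply/eqP; rewrite eq_le nr_ge0 andbT; apply: ler_eps => d d0; rewrite add0r.
have c0 : 0 < m * nr xi * nr v + 1 by rewrite ltr_wpDl// !mulr_ge0// nr_ge0.
have [n hn] := lp eta (divr_gt0 d0 c0).
have {}hn := hn n (leqnn n); rewrite peta subr0 in hn.
rewrite -(iterE n); apply: le_trans (gp_nr ng _ _) _.
have := hm _ (nr xi * nr (iter n g eta)) (bdd_kb xi (iter n g eta)) _ (kb_nr _ _) v.
move=> /(_ (mulr_ge0 (nr_ge0 _) (nr_ge0 _))) k.
apply: le_trans k _; rewrite mulrA mulrAC.
apply: (@le_trans _ _ ((m * nr xi * nr v + 1) * nr (iter n g eta))).
  by rewrite ler_wpM2r ?nr_ge0// lerDl.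
by rewrite mulrC -ler_pdivlMr// ltW.
Qed.

(** Factor [kb eta eta] through the unit vector [xi] and expand [alpha (kb eta xi)] in elementary
    tensors [x (x) c]. Traciality moves [x] to the right end, leaving [c] applied to
    [Ey x (kb xi eta) v], which [Ey_kill] annihilates. *)
Lemma E_kill v eta xi : '<xi, xi> = 1 -> p xi = xi -> p v = v -> p eta = 0 -> Eo (kb eta eta) v = 0.
Proof.
move=> xi1 pxi pv peta; apply: ip_ext => u; rewrite ip0l.
have b1 := bdd_kb eta xi; have b2 := bdd_kb xi eta.
have -> : kb eta eta = kb eta xi \o kb xi eta :> op H.
  by apply: op_ext => z; rewrite /= ipZl xi1 mulr1.
pose k Z := pfW t (fun b => '<b v, u>) (Z \o alpha (kb xi eta)).
have nv := nf_vec v u; have ba := bdd_alpha b2.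
have nk : nf k := nf_mulr ba (nf_pf (htt K H) nt nv).
have -> : '<Eo (kb eta xi \o kb xi eta) v, u> = k (alpha (kb eta xi)).
  by rewrite /k /Eo /Ew alphaM.
apply: (MB_ext0 nk _ (alphaP b1)) => x c Mx bc; have bx := M_bdd Mx; rewrite /k.
have -> : (lW x \o rW c) \o alpha (kb xi eta) = lW x \o (rW c \o alpha (kb xi eta)) :> op _.
  exact: op_ext.
rewrite /pf slice_trace//; last first.
  by apply: MB_comp; [exact: MB_tr|exact: alphaP].
have -> : (rW c \o alpha (kb xi eta)) \o lW x = rW c \o (alpha (kb xi eta) \o lW x) :> op _.
  exact: op_ext.
rewrite Sl_trl//; last exact: bdd_comp ba (bdd_lW _).
by rewrite /= -/(Ey x _) (Ey_kill Mx pxi pv peta) linear0 ip0l.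
Qed.

(** [E (1 - p)] vanishes on the range of [p], so [E p] is the identity there and [E p - p] is
    positive. Since [E E = E], the average of this difference is [0], and faithfulness ends the
    argument. *)
Lemma E_top : (exists v, p v != 0) -> forall v, Eo p v = p v.
Proof.
move=> [v0 pv0].
have [xi xi1 pxi] : exists2 xi, '<xi, xi> = 1 & p xi = xi.
  by exists ((nr (p v0))^-1%:C *: p v0); [exact: ip_unit|rewrite linearZ_LR ppE].
pose Q : op H := idop H \- p.
have bi := @bdd_id _ H.
have bQ : bdd Q by exact: (bdd_sub bi bp).
have QE v : Q v = v - p v by [].
have pQ v : p (Q v) = 0 by rewrite QE linearB ppE subrr.
have aQ : adj Q = Q.
  apply: adj_eq => // u v; rewrite !QE ipBl ipBr; congr (_ - _).
  by rewrite adjP// ap.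
have QQ v : Q (Q v) = Q v by rewrite [LHS]QE pQ subr0.
(* [Q] is the sum of the [kb (Q (e i)) (Q (e i))], and [E_kill] applies to each term. *)
have EQ v : p v = v -> Eo Q v = 0.
  move=> pv; apply: ip_ext => u; rewrite ip0l.
  have [kappa nk hk] := nf_E v u; rewrite -hk//.
  pose k b := kappa (Q \o (b \o Q)).
  have nk' : nf k := nf_mulr bQ (nf_mull bQ nk).
  have := nf_onb_sum nk' he.
  have -> : k (idop H) = kappa Q by congr kappa; apply: op_ext => w /=; rewrite -[RHS]QQ.
  move=> h; apply: (hsum_unique h); apply: eq_hsum (@hsum0 R nat) => i.
  have -> : k (kb (e i) (e i)) = kappa (kb (Q (e i)) (Q (e i))).
    congr kappa; apply: op_ext => w.
    by rewrite -[LHS]/(Q ('<Q w, e i> *: e i)) linearZ_LR adjP// aQ.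
  rewrite hk; last exact: bdd_kb.
  by rewrite (E_kill xi1 pxi pv (pQ _)) ip0l.
have Ep v : p v = v -> Eo p v = v.
  move=> pv; apply: ip_ext => u; have [kappa nk hk] := nf_E v u.
  have : kappa (idop H) = kappa p + kappa Q.
    by apply: nf_add => // w; rewrite QE addrC subrK.
  by rewrite !hk// E_id (EQ v pv) ip0l addr0.
have posp : positive_op p.
  by move=> v; rewrite -ppE -{1}ap adjP'// ip_ge0.
have posE := E_ge0 he zeta1 bp posp.
have bE : bdd (Eo p) by exact: bdd_Ew.
have hE := positive_adj bE posE.
pose r : op H := Eo p \- p.
have br : bdd r by exact: (bdd_sub bE bp).
have rE v : r v = Eo p v - p v by [].
have rp v : r (p v) = 0 by rewrite rE Ep ?ppE// subrr.
(* [r] is hermitian and vanishes on the range of [p], so its form sees only [Q v], where it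
   coincides with that of [E p]. *)
have pr : positive_op r.
  move=> v; have ev : v = p v + Q v by rewrite QE addrC subrK.
  have -> : r v = r (Q v) by rewrite {1}ev linearD rp add0r.
  have ar : adj r = r.
    by apply: adj_eq => // a b; rewrite !rE ipBl ipBr adjP// hE adjP// ap.
  rewrite {2}ev ipDr (adjP _ _ br) ar rp ip0r add0r.
  by rewrite rE pQ subr0; exact: posE.
have r0 : forall v, Eo r v = 0.
  move=> v; apply: ip_ext => u; rewrite ip0l; have [kappa nk hk] := nf_E v u.
  have : kappa (Eo p) = kappa r + kappa p.
    by apply: nf_add => // w; rewrite rE subrK.
  rewrite !hk// E_Ew// t1 scale1r => /esym/eqP; rewrite -subr_eq0 addrK => /eqP.
  by [].
by move=> v; apply/eqP; rewrite -subr_eq0 -rE (E_faithful he zeta1 br pr r0).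
Qed.
End Kill.

(** The trace of [g] is [lam^-1] and [p <= g], so [p] has finite trace; finite trace and norm [1] of
    [g] also prevent [p] from being [0]. *)
Lemma fixed_projection : exists p : op H, [/\ bdd p, positive_op p, exists v, p v != 0,
  (etr e p < +oo)%E & forall v, Eo p v = p v].
Proof.
have [psi [g [lam [[npsi lam0 hpsi hg] [pg ng hs hsup]]]]] := top_operator.
have [p [bp pp ap gp lp]] := power_limit pg ng.
have [v hv] := power_limit_neq0 pg ng he hs hsup.
have pv : p v != 0 by apply/eqP => pv; apply: hv; rewrite -pv.
have posp : positive_op p.
  move=> u; have ppE : p (p u) = p u by have /(congr1 (fun f : op H => f u)) := pp.
  by rewrite -ppE -{1}ap adjP'// ip_ge0.
exists p; split => //; first by exists v.
  apply: (@le_lt_trans _ _ (etr e g)).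
    by apply: le_esum => i _; rewrite lee_fin; exact: (power_limit_le pg ng).
  by rewrite /etr (hsum_esum_Re (fun i => pg (e i)) hs) ltry.
by apply: (E_top npsi hpsi lam0 hg pg ng bp pp ap gp lp); exists v.
Qed.

Lemma etr_E_zeta : etr e (Eo (kb zeta zeta)) = 1%E.
Proof.
have [p [bp pp [v pv] fin hE]] := fixed_projection.
have c0 := etr_E_zeta_ge0 e zeta1; set c := etr _ _ in c0 *.
have := etr_E he zeta1 bp pp; rewrite -/c (op_ext hE).
have := etr_cholesky bp pp he he.1 he.2.
set f := fun k => nr (cfac p e k) ^+ 2.
have f0 k : 0 <= f k by exact: sqr_ge0.
move=> e1 e2.
have [k fk] : exists k, f k != 0.
  apply: contrapT => /forallNP hf; move: e1; rewrite esum1; last first.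
    by move=> k _; congr (_%:E); apply/eqP; have /negP := hf k; rewrite negbK.
  move=> h; move: pv; apply/negP; rewrite negbK; apply/eqP; apply: he.2 => i.
  rewrite positive_herm// (_ : p (e i) = 0) ?ip0l ?conjc0//.
  apply: positive_null => //; have := @esum_eq0 _ _ _ i _ h; rewrite /= => /(_ _)/eqP h2.
  by apply/eqP; rewrite -eqe; apply: h2 => j; rewrite lee_fin ge0_Re.
have fp : 0 < f k by rewrite lt_neqAle eq_sym fk f0.
(* An infinite [c] together with one nonzero Cholesky factor of [p] would make [Tr (E p) = Tr p]
   infinite. With [c] finite, [Tr p = c Tr p] can be divided by [Tr p]. *)
have cfin : c \is a fin_num.
  rewrite ge0_fin_numE//; rewrite ltey; apply/eqP => ci.
  move: fin; rewrite e2; apply/negP; rewrite -leNgt.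
  apply: le_trans (esum_term _ k); rewrite ci.
  by rewrite mulry gtr0_sg// mul1e.
move: e2; rewrite -(fineK cfin) => e2.
have e3 : etr e p = ((fine c)%:E * etr e p)%E.
  rewrite {2}e1 -esumZ; [|exact: fine_ge0|by move=> i; rewrite lee_fin; exact: f0].
  by rewrite e2; apply: eq_esum => i _; rewrite muleC.
have pfin : etr e p \is a fin_num by rewrite ge0_fin_numE//; exact: etr_ge0.
have ppos : fine (etr e p) != 0.
  rewrite gt_eqF// fine_gt0// fin andbT; apply: (@lt_le_trans _ _ (f k)%:E).
    by rewrite lte_fin.
  by rewrite e1; exact: (esum_term (fun k => (f k)%:E)).
congr (_%:E); move: e3; rewrite -(fineK pfin) -EFinM => -[e3].
by apply: (mulIf ppos); rewrite mul1r -e3.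
Qed.

Lemma etr_invariant (x : op H) : bdd x -> positive_op x -> etr e (Eo x) = etr e x.
Proof.
move=> bx px; rewrite (etr_E he zeta1 bx px) (etr_cholesky bx px he he.1 he.2).
by apply: eq_esum => k _; rewrite etr_E_zeta mule1.
Qed.
End TopProjection.

(** * Invariance of the trace and finiteness of the dimension *)

Lemma left_slice_MB (w omega : op K -> C) S Z : nf w -> (forall x, M x -> w x = omega x) ->
  left_slice M BH omega S -> MB Z -> S Z = SlW w Z.
Proof.
move=> nw hw [hn hel] hZ; apply: op_ext => u; apply: ip_ext => v.
have nv := nf_vec u v.
have [z mz|z /BHP//|w' nw' hw'] := normal_nf _ _ hn nv; first exact: MB_bdd mz.
rewrite -[LHS](hw' Z hZ).
apply: (MB_ext (w' := pfW w (fun b => '<b u, v>)) nw' _ _ hZ); first exact: nf_pf.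
move=> p c Mp bc; have bp := M_bdd Mp.
rewrite pf_tltr// hw'; last exact: MB_tltr.
have bcc := bdd_tltr T p c.
rewrite (hel p c)//; [by rewrite /= ipZl hw|exact/BHP|exact/bdd_continuous|].
exact: op_tens_tltr.
Qed.

Section Conclusion.
Variables (e : nat -> H) (zeta : H).
Hypothesis he : is_onb e.
Hypothesis zeta1 : '<zeta, zeta> = 1.

Lemma trace_invariant_core : trace_invariant M alpha.
Proof.
move=> omega S E x [hp hpos h1] hS hE /BHP bx px.
have [w nw hw] := predual_nf M_bdd hp.
have [oE tE] := onb_set_type hE.
have mx := alphaP bx; have bax := MB_bdd mx.
rewrite (left_slice_MB nw hw hS mx) -[SlW w _]/(Ew w x) !op_trace_etr.
have bw := bdd_Ew w x.
have pw : positive_op (Ew w x).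
  move=> v; rewrite /Ew SlP// hw; last exact: rs_M.
  apply: hpos; first exact: rs_M.
  by move=> k; rewrite rsP; exact: (alpha_positive he zeta1 bx px).
have etrE (y : op H) : bdd y -> positive_op y -> etr (fun i : set_type E => val i) y = etr e y.
  by move=> by_ py; rewrite (etr_cholesky by_ py he oE tE) (etr_cholesky by_ py he he.1 he.2).
rewrite !etrE// -(etr_invariant he zeta1 bw pw) -(etr_invariant he zeta1 bx px).
congr etr; apply: op_ext => v; rewrite E_Ew// hw ?h1 ?scale1r//; exact: M_id.
Qed.

Lemma finite_dimensional_core : ergodic BH alpha -> finite_dimensional H.
Proof.
move=> herg; have bk := bdd_kb zeta zeta.
have bE : BH (Eo (kb zeta zeta)) by exact/BHP/bdd_Ew.
have [|s hs] := herg _ bE.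
  by move=> k h; rewrite alpha_E// trE//; exact: bdd_Ew.
have h1 := etr_E_zeta he zeta1.
have eE i : (complex.Re '<Eo (kb zeta zeta) (e i), e i>)%:E =
    (complex.Re s * complex.Re '<e i, e i>)%:E.
  by rewrite hs /= ipZl ipvv mulrC ReZ mulrC.
have s0 : 0 < complex.Re s.
  rewrite ltNge; apply/negP => s0.
  have : (etr e (Eo (kb zeta zeta)) <= 0)%E.
    rewrite -[leRHS](@esum1 _ _ [set: nat] (fun=> 0%E))//; apply: le_esum => i _.
    by rewrite eE lee_fin mulr_le0_ge0//; exact/ge0_Re/ip_ge0.
  by rewrite h1 lee_fin ler10.
(* Each nonzero basis vector contributes [Re s] to a trace equal to [1], so there are at most
   [1 / Re s] of them. *)
have fin : finite_set [set i | e i != 0].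
  apply: contrapT => /(infinite_set_fset (Num.bound (complex.Re s)^-1))[B hB nB].
  have : ((\sum_(i <- B) complex.Re s)%:E <= (1 : \bar R))%E.
    rewrite -h1; apply: (@le_trans _ _
        (\sum_(i <- B) (complex.Re '<Eo (kb zeta zeta) (e i), e i>)%:E)%E).
      rewrite -sumEFin big_seq [leRHS]big_seq; apply: lee_sum => i iB.
      rewrite eE lee_fin; case: (he.1.2 i) => [->|ei]; first by rewrite mulr1.
      by have := hB i iB; rewrite /= ei eqxx.
    by apply: esum_ge; exists [set` B]; [split|rewrite fsbig_finite//= set_fsetK].
  rewrite big_const_seq count_predT iter_addr_0 lee_fin -mulr_natr.
  apply/negP; rewrite -ltNge mulrC -ltr_pdivrMr// mul1r.
  apply: lt_le_trans (archi_boundP _) _; first by rewrite invr_ge0 ltW.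
  by rewrite ler_nat.
pose A := fset_set [set i | e i != 0].
have hA v : v = fproj e A v.
  apply/eqP; rewrite -subr_eq0; apply/eqP; apply: he.2 => i.
  have [iA|iA] := boolP (i \in A); first exact: fproj_orth he.1 _ _ _ iA.
  have -> : e i = 0; last exact: ip0r.
  by move: iA; rewrite in_fset_set// notin_setE /= => /negP; rewrite negbK => /eqP.
exists (size A), (fun k => e (nth 0%N A k)) => v.
exists (fun k => '<v, e (nth 0%N A k)>).
by rewrite {1}(hA v) /fproj (big_nth 0%N) big_mkord.
Qed.
End Conclusion.
End Core.

Lemma unit_or_trivial (R : realType) (H : hilbertType R) :
  (exists zeta : H, '<zeta, zeta> = 1) \/ (forall v : H, v = 0).
Proof.
have [h|h] := pselect (exists v : H, v != 0); [left|right].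
  by have [v v0] := h; exists ((nr v)^-1%:C *: v); exact: ip_unit.
by move=> v; apply/eqP; apply: contrapT => v0; apply: h; exists v; apply/negP.
Qed.

Theorem corollary5p2 (R : realType) (T : hilbert_tensor R)
    (K : hilbertType R) (M : set (op K)) (Delta : op K -> op (T K K))
    (H : hilbertType R) (alpha : op H -> op (T K H)) :
  compact_kac_algebra M Delta ->
  left_coaction M Delta (@bounded_op R H) alpha ->
  trace_invariant M alpha /\
  (ergodic (@bounded_op R H) alpha -> finite_dimensional H).
Proof.
move=> [[vM hD _ _] [tau [Sl0 [Sr0 [[tp tpos tau1] ttr hSl hSr hinv]]]]].
move=> [vB ha _ [F [G [hF hG hFG]]]].
(* The zero space has no unit vector [zeta] and is treated apart. *)
have [[zeta zeta1]|H0] := unit_or_trivial H; last first.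
  split.
    move=> w S E x _ _ _ _ _; apply: eq_esum => f _.
    by rewrite (H0 f) !ip0r.
  by move=> _; exists 0%N, (fun=> 0) => v; exists (fun=> 0); rewrite big_ord0 (H0 v).
have [Mb Mid Mc _] := staralg_vN vM.
(* [t] agrees with [tau] on [M] and is normal on all bounded operators; the hypotheses on [tau] are
   transferred to it below. *)
have [t nt ht] := predual_nf Mb tp.
have [e he] := onb_exists H.
have t1 : t (idop K) = 1 by rewrite ht.
have tpos' x : M x -> positive_op x -> 0 <= t x by move=> Mx px; rewrite ht//; exact: tpos.
have ttr' x y : M x -> M y -> t (x \o y) = t (y \o x).
  by move=> Mx My; rewrite !ht; [exact: ttr|exact: Mc|exact: Mc].
have hSl' : left_slice M M t Sl0.
  by case: hSl => hn h; split => // x y z Mx My; rewrite ht//; exact: h.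
have hSr' : right_slice M M t Sr0.
  by case: hSr => hn h; split => // x y z Mx My; rewrite ht//; exact: h.
have hinv' x : M x -> Sl0 (Delta x) =1 t x \*: idop K /\ Sr0 (Delta x) =1 t x \*: idop K.
  by move=> Mx; rewrite ht//; exact: hinv.
split.
  exact: (trace_invariant_core vM vB hD nt t1 tpos' ttr' hSl' hSr' hinv' ha hF hG hFG he zeta1).
exact: (finite_dimensional_core vM vB hD nt t1 tpos' ttr' hSl' hSr' hinv' ha hF hG hFG he zeta1).
Qed.
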